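(* Let $\mathbb{K}=\mathbb{Q}(q,\nu,w)$, let $Y_1=1+O(t)$ and $Y_2=\frac{s}{w(\nu-1)}+O(t)$ be the two series of $\mathbb{K}(s)[[t]]$ satisfying $K(1+ts,Y_i)=0$ (kernel $K$ below), and let $I(y)=wtyqM(1,y)+\frac{y-1}{y}+\frac{ty}{y-1}$. Let $d\in\mathbb{N}$ and let $H(y)\in\mathbb{K}(y)((t))$ have valuation at least $-d$ in $(y-1)$, i.e. each coefficient $[t^n]H(y)$ is a rational function of $y$ that either has no pole at $y=1$ or has a pole of multiplicity at most $d$ there. Then $H(Y_1)$ and $H(Y_2)$ are well-defined elements of $\mathbb{K}(s)((t))$. If moreover $H(Y_1)=H(Y_2)$, then there exist Laurent series $A_0,\dots,A_d\in\mathbb{K}((t))$ such that $H(y)=\sum_{i=0}^d A_i\,I(y)^i$.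
   Context: Planar maps are connected planar graphs properly embedded in the oriented sphere up to orientation-preserving homeomorphism (loops and multiple edges allowed), rooted by a distinguished corner whose vertex/face are the root-vertex/root-face; degrees count edges with multiplicity; the atomic map is included; $e,v,f$ count edges, vertices, faces; $d_v,d_f$ are root-vertex and root-face degrees. The Potts polynomial is $P_G(q,\nu)=\sum_{c:V(G)\to\{1,\dots,q\}}\nu^{m(c)}$, $m(c)$ = number of monochromatic edges (loops always monochromatic), viewed as a polynomial in $q,\nu$. $M(x,y)=M(q,\nu,t,w,1;x,y)$, where $M(q,\nu,t,w,z;x,y)=\frac1q\sum_{M}t^{e(M)}w^{v(M)-1}z^{f(M)-1}x^{d_v(M)}y^{d_f(M)}P_M(q,\nu)$ over rooted planar maps. The kernel is $K(x,y)=1-\frac{x^2ywt(\nu-1)}{x-1}-\frac{xy^2t}{y-1}-xyt(x\nu-1)M(x,1)-xywt((\nu-1)(y-1)+qy)M(1,y)$; $s$ is an indeterminate. A series in $t$ with rational coefficients in $y$ is extended here to Laurent series in $t$ ($\mathbb{K}(y)((t))$). *)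

(* Defs.v *)
From HB Require Import structures.
From mathcomp Require Import all_boot all_order all_algebra all_fingroup.
From mathcomp Require Import fraction.
Set Implicit Arguments. Unset Strict Implicit. Unset Printing Implicit Defensive.
Import Order.TTheory GRing.Theory Num.Theory.
Local Open Scope ring_scope.

(* Fields.  KK = Q(q,nu,w) = fraction field of Q[q][nu][w].           *)
(* KKx = KK(X) = fraction field of KK[X]; it is used both for K(y)    *)
(* (rational functions in y) and for K(s) (the indeterminate s).      *)
Notation KK := {fraction {poly {poly {poly rat}}}}.
Definition qK : KK := tofrac ((('X : {poly rat})%:P)%:P).
Definition nuK : KK := tofrac (('X : {poly {poly rat}})%:P).
Definition wK : KK := tofrac ('X : {poly {poly {poly rat}}}).
Notation KKx := {fraction {poly KK}}.
Definition KtoKx (k : KK) : KKx := tofrac (k%:P).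
(* the indeterminate (called y in K(y), s in K(s)) *)
Definition varX : KKx := tofrac 'X.

Definition ps (F : Type) := nat -> F.
Definition ps_c (F : nzRingType) (c : F) : ps F := fun n => if n is 0%N then c else 0.
Definition ps_t (F : nzRingType) : ps F := fun n => if n == 1%N then 1 else 0.
Definition ps_add (F : nzRingType) (a b : ps F) : ps F := fun n => a n + b n.
Definition ps_opp (F : nzRingType) (a : ps F) : ps F := fun n => - a n.
Definition ps_mul (F : nzRingType) (a b : ps F) : ps F :=
  fun n => \sum_(i < n.+1) a i * b (n - i)%N.
Definition ps_exp (F : nzRingType) (a : ps F) (k : nat) : ps F :=
  iter k (ps_mul a) (ps_c 1).
Definition ps_peval (F G : nzRingType) (f : F -> G) (p : {poly F}) (Y : ps G) : ps G :=
  \big[@ps_add G/ps_c 0]_(i < size p) ps_mul (ps_c (f p`_i)) (ps_exp Y i).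
Definition ps_compseq (F G : nzRingType) (P : nat -> {poly F}) (f : F -> G) (X : ps G)
  : ps G := fun N => \sum_(n < N.+1) ps_peval f (P n) X (N - n)%N.

(* Formal Laurent series in t:  t^(lval L) * (sum_m lps L m t^m).      *)
(* Equality of Laurent series is coefficientwise (ls_eq).             *)
Record ls (F : Type) := LS { lval : int ; lps : nat -> F }.
Definition lcoef (F : nzRingType) (L : ls F) (n : int) : F :=
  match (n - lval L)%R with Posz m => lps L m | Negz _ => 0 end.
Definition ls_eq (F : nzRingType) (L1 L2 : ls F) : Prop :=
  forall n : int, lcoef L1 n = lcoef L2 n.
Definition ls_of_ps (F : Type) (a : ps F) : ls F := LS 0 a.
Definition ls0 (F : nzRingType) : ls F := LS 0 (fun _ => 0).
Definition ls1 (F : nzRingType) : ls F := LS 0 (ps_c 1).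
Definition ls_add (F : nzRingType) (L1 L2 : ls F) : ls F :=
  let v := Num.min (lval L1) (lval L2) in
  LS v (fun m => lcoef L1 (v + m%:Z) + lcoef L2 (v + m%:Z)).
Definition ls_mul (F : nzRingType) (L1 L2 : ls F) : ls F :=
  LS (lval L1 + lval L2) (ps_mul (lps L1) (lps L2)).
Definition ls_scale (F : nzRingType) (c : F) (L : ls F) : ls F :=
  LS (lval L) (fun m => c * lps L m).
Definition ls_shift (F : Type) (k : int) (L : ls F) : ls F := LS (lval L + k) (lps L).
Definition ls_exp (F : nzRingType) (L : ls F) (k : nat) : ls F := iter k (ls_mul L) (ls1 F).
Definition ls_map (F G : Type) (f : F -> G) (L : ls F) : ls G := LS (lval L) (fun m => f (lps L m)).
Definition ls_peval (F G : nzRingType) (f : F -> G) (p : {poly F}) (Y : ls G) : ls G :=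
  \big[@ls_add G/ls0 G]_(i < size p) ls_scale (f p`_i) (ls_exp Y i).

(* Substitution of a Laurent series Y in K(s)((t)) into an element    *)
(* H of K(y)((t)).                                                     *)
(* rat_eval_rel h Y Z : Z = h(Y), where h = a/b with b(Y) <> 0.        *)
(* subst_rel H Y Z : H(Y) = sum_m t^(lval H + m) h_m(Y) is well       *)
(* defined (each h_m(Y) defined, valuations of the terms tend to      *)
(* infinity) and equals Z.                                             *)
Definition rat_eval_rel (h : KKx) (Y Z : ls KKx) : Prop :=
  exists a b : {poly KK}, [/\ b != 0, h = tofrac a / tofrac b,
    ~ ls_eq (ls_peval KtoKx b Y) (ls0 KKx) &
    ls_eq (ls_mul (ls_peval KtoKx b Y) Z) (ls_peval KtoKx a Y)].

Definition subst_rel (H Y Z : ls KKx) : Prop :=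
  exists Zs : nat -> ls KKx,
    let T m := ls_shift (lval H + m%:Z) (Zs m) in
    [/\ forall m, rat_eval_rel (lps H m) Y (Zs m),
        forall N : int, exists m0, forall m, (m0 <= m)%N ->
           forall k : int, k < N -> lcoef (T m) k = 0 &
        forall k : int, exists m0,
           (forall m, (m0 <= m)%N -> lcoef (T m) k = 0) /\
           lcoef Z k = \sum_(m < m0) lcoef (T m) k].

Definition pole_at1_le (d : nat) (h : KKx) : Prop :=
  exists p r : {poly KK}, r.[1] != 0 /\ h = tofrac p / tofrac (('X - 1) ^+ d * r).

(* Rooted planar maps with n.+1 edges, as combinatorial maps on the   *)
(* darts 'I_(2(n+1)): sigma (rotation around vertices), alpha (fixed- *)
(* point-free involution = edges), transitive, Euler genus 0.  The    *)
(* root is dart ord0; vertices = cycles of sigma, faces = cycles of   *)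
(* phi = sigma o alpha = (alpha * sigma)%g.  Isomorphism classes of    *)
(* rooted maps = orbits under relabelings fixing the root dart.       *)
Notation dart n := ('I_(n.*2.+2)).
Notation cmap n := ({perm dart n} * {perm dart n})%type.

Definition map_valid (n : nat) (p : cmap n) : bool :=
  let sg := p.1 in let al := p.2 in
  [&& [forall h, al (al h) == h], [forall h, al h != h],
      [forall h, connect (fun x y => (y == sg x) || (y == al x)) ord0 h] &
      (#|porbits sg| + #|porbits (al * sg)%g| == n.+1 + 2)%N].

Definition map_class (n : nat) (p : cmap n) : {set cmap n} :=
  [set ((p.1 ^ tau)%g, (p.2 ^ tau)%g) | tau in [set tau : {perm dart n} | tau ord0 == ord0]].

Definition nvert n (p : cmap n) : nat := #|porbits p.1|.
Definition deg_root_vertex n (p : cmap n) : nat := #|porbit p.1 ord0|.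
Definition deg_root_face n (p : cmap n) : nat := #|porbit (p.2 * p.1)%g ord0|.

(* Potts sum with j colours: vertex colourings = sigma-invariant dart
   colourings; an edge {h, alpha h} is monochromatic iff f h = f (alpha h). *)
Definition col_sum n (p : cmap n) (j : nat) : KK :=
  \sum_(f : {ffun dart n -> 'I_j} | [forall h, f (p.1 h) == f h])
     nuK ^+ (#|[set h | f h == f (p.2 h)]| %/ 2).

(* Potts polynomial P(q,nu), the polynomial in q (of degree <= #vertices)
   interpolating the colouring sums at q = 0..#vertices, evaluated at the
   indeterminates q, nu of KK. *)
Definition potts n (p : cmap n) : KK :=
  let N := nvert p in
  \sum_(j < N.+1) col_sum p j *
      \prod_(i < N.+1 | i != j) ((qK - (i : nat)%:R) / ((j : nat)%:R - (i : nat)%:R)).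

(* contribution of a labelled map: weight w^(v-1) P/q, divided by the
   size of its isomorphism class (so that the sum runs over rooted maps) *)
Definition map_weight n (p : cmap n) : KK :=
  wK ^+ (nvert p).-1 * potts p / qK / (#|map_class p|)%:R.

(* [t^n] M(x,1) as a polynomial in x, and [t^n] M(1,y) as a polynomial in y;
   n = 0 is the atomic map (contribution q/q = 1). *)
Definition M_x1 (n : nat) : {poly KK} :=
  if n is n'.+1 then \sum_(p : cmap n' | map_valid p) (map_weight p)%:P * 'X^(deg_root_vertex p)
  else 1.
Definition M_1y (n : nat) : {poly KK} :=
  if n is n'.+1 then \sum_(p : cmap n' | map_valid p) (map_weight p)%:P * 'X^(deg_root_face p)
  else 1.

(* The kernel equation K(1+ts, Y) = 0, for Y in K(s)[[t]], multiplied *)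
(* by (Y - 1) (and with x^2 y w t (nu-1)/(x-1) = x^2 y w (nu-1)/s).   *)
Definition kc (k : KK) : ps KKx := ps_c (KtoKx k).
Definition kernel_root (Y : ps KKx) : Prop :=
  let pa := @ps_add KKx in let pm := @ps_mul KKx in let t := ps_t KKx in
  let x := pa (ps_c 1) (pm (ps_c varX) t) in
  let Mx1 := ps_compseq M_x1 KtoKx x in
  let M1Y := ps_compseq M_1y KtoKx Y in
  let Ym1 := pa Y (ps_c (-1)) in
  let inner :=
    pa (ps_c 1) (ps_opp (pa (pm (pm (pm x x) Y) (ps_c (KtoKx (wK * (nuK - 1)) / varX)))
       (pa (pm (pm (pm t x) Y) (pm (pa (pm x (kc nuK)) (ps_c (-1))) Mx1))
           (pm (pm (pm (pm t x) Y) (kc wK))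
               (pm (pa (pm (kc (nuK - 1)) Ym1) (pm (kc qK) Y)) M1Y))))) in
  forall n, pa (pm Ym1 inner) (ps_opp (pm (pm t x) (pm Y Y))) n = 0.

Definition I_ps : ps KKx :=
  let pa := @ps_add KKx in let pm := @ps_mul KKx in let t := ps_t KKx in
  pa (pm (ps_c (KtoKx (wK * qK) * varX)) (pm t (fun n => tofrac (M_1y n))))
     (pa (ps_c ((varX - 1) / varX)) (pm (ps_c (varX / (varX - 1))) t)).
Definition I_ls : ls KKx := ls_of_ps I_ps.

(* Main.v *)
(* Maps are pairs of permutations (rotation s, edge involution a) of a fixed set of darts, rooted at
   a dangling half-edge, a fixed point of a.  Deleting the root edge of a planar map leaves either a
   planar map with two dangling half-edges in the same face or two disjoint planar maps; Euler's
   inequality, applied to each part, shows that genus zero is preserved.  With the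
   deletion-contraction rule this gives Tutte's equation for the Potts series M(x,y), contraction
   being deletion in the dual map.  On the kernel curve K(1+ts,y) = 0, Tutte's equation expresses I(y)
   through x = 1+ts alone, so that I(Y1) = I(Y2).

   As a function of y, I has a simple pole at y = 1 with residue t.  Subtracting from H a multiple
   A_d I^d lowers the order of its pole at 1 and keeps the equality of the values at Y1 and Y2.  After
   d steps no pole is left, and then H is constant: if the coefficients of t^m for m < n are constant,
   that of t^n satisfies h(1) = h(s/(w(nu-1))), where s/(w(nu-1)) is transcendental over K. *)

Require Import Defs.
From HB Require Import structures.
From mathcomp Require Import all_boot all_order all_algebra all_fingroup.
From mathcomp Require Import boolp fraction zify ring.
Set Implicit Arguments. Unset Strict Implicit. Unset Printing Implicit Defensive.

(** * Cycles of a permutation multiplied by a transposition *)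

(** All maps live on subsets [A] of one finite type, and both permutations fix the darts outside
    [A]: cutting a map into pieces changes the permutations and [A], never the type of darts. A dart
    outside [A] counts as an isolated vertex, which explains the powers of [w * q]. The sums run
    over labelled maps. A rooted map has no automorphism fixing its root, so a set of n darts
    besides the leg gives n! times the rooted sum, and binomial coefficients turn pairs of pieces
    into convolutions. As q is an indeterminate, identities between colour sums are proved for every
    number of colours and carried over as polynomial identities. In the second half the obstacle is
    that I has a pole at 1 while Y1 - 1 is divisible by t. The argument is therefore run on J = (y -
    1) I, whose coefficients are regular at 1 and whose value there is t; the denominators met at Y1
    and Y2 are then units of the power series ring. Laurent series are treated as elements of the
    fraction field of that ring. *)

Section Transpositions.
Import GroupScope.
Variable T : finType.
Implicit Types (s a : {perm T}) (x y z r e : T) (D : {set T}).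

Lemma porbit_step s x : s x \in porbit s x.
Proof. by rewrite -{1}(expg1 s) mem_porbit. Qed.

Lemma porbit_closed s x y : y \in porbit s x -> s y \in porbit s x.
Proof.
by case/porbitP=> i ->; apply/porbitP; exists i.+1; rewrite expgSr permM.
Qed.

Lemma porbit_sub s x D :
  x \in D -> (forall y, y \in D -> s y \in D) -> porbit s x \subset D.
Proof.
move=> xD sD; apply/subsetP=> y /porbitP[i ->].
by elim: i => [|i IH]; rewrite ?perm1 // expgSr permM sD.
Qed.

Lemma porbit_eqP s x y : reflect (porbit s x = porbit s y) (x \in porbit s y).
Proof. by rewrite -eq_porbit_mem; apply: eqP. Qed.

Lemma perm_closed_mem s D x :
  (forall y, y \in D -> s y \in D) -> (s x \in D) = (x \in D).
Proof.
move=> sD; apply/idP/idP => [|/sD//].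
move=> sxD; have /subsetP := porbit_sub sxD sD; apply.
have /porbit_eqP-> := porbit_step s x; exact: porbit_id.
Qed.

Lemma perm_fix_eq s x y : s y = y -> (s x == y) = (x == y).
Proof. by move=> sy; rewrite -{1}sy (inj_eq perm_inj). Qed.

Lemma porbit_fix s x : s x = x -> porbit s x = [set x].
Proof.
move=> sx; apply/eqP; rewrite eqEsubset; apply/andP; split.
  by apply: porbit_sub; rewrite ?inE // => y /[!inE] /eqP->; rewrite sx.
by rewrite sub1set porbit_id.
Qed.

Lemma card_porbit_gt0 s x : 0 < #|porbit s x|.
Proof. by rewrite lt0n card_porbit_neq0. Qed.

Lemma tperm_mul_other s x y z : z != x -> z != y -> (tperm x y * s) z = s z.
Proof. by move=> ? ?; rewrite permM tpermD // eq_sym. Qed.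

Lemma perm_involution s : (forall x, s (s x) = x) -> s * s = 1.
Proof. by move=> sK; apply/permP=> x; rewrite permM perm1. Qed.

Lemma tperm_mul_involution s x y : (forall z, s (s z) = z) -> s x = y ->
  forall z, (tperm x y * s) ((tperm x y * s) z) = z.
Proof.
move=> sK sx z; have sy : s y = x by rewrite -sx sK.
rewrite permM [(tperm x y * s) z]permM.
case: (tpermP x y z) => [->|->|zx zy]; first by rewrite sy tpermL sy.
  by rewrite sx tpermR sx.
rewrite tpermD ?sK //; apply/eqP=> E; first by apply: zy; rewrite -(sK z) -E sx.
by apply: zx; rewrite -(sK z) -E sy.
Qed.

Lemma perm_on_tperm_mul D s x y : x \in D -> y \in D -> perm_on D s -> perm_on D (tperm x y * s).
Proof.
move=> xD yD; apply: perm_onM; apply: subset_trans (tperm_on _ _) _.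
by rewrite subUset !sub1set xD.
Qed.

Lemma perm_on_setD1 D s x : perm_on D s -> s x = x -> perm_on (D :\ x) s.
Proof.
move=> sD sx; apply/subsetP=> y /[!inE] ny; rewrite (subsetP sD) ?inE // andbT.
by apply: contra ny => /eqP->; rewrite sx.
Qed.

Lemma perm_on_sub D D' s : D \subset D' -> perm_on D s -> perm_on D' s.
Proof. by move=> DD' sD; apply: subset_trans DD'. Qed.

Lemma card_porbits_split s x y : x != y -> y \in porbit s x ->
  #|porbits (tperm x y * s)| = #|porbits s|.+1.
Proof.
move=> nxy yx; have := porbits_mul_tperm s x y.
by rewrite porbit_sym yx nxy /= addn0 addn1.
Qed.

Lemma card_porbits_merge s x y : y \notin porbit s x ->
  #|porbits (tperm x y * s)|.+1 = #|porbits s|.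
Proof.
move=> yx; have nxy : x != y by apply: contraNneq yx => ->; rewrite porbit_id.
have := porbits_mul_tperm s x y.
rewrite porbit_sym yx nxy /=; lia.
Qed.

Lemma notin_porbit_fix s x y : s y = y -> x != y -> y \notin porbit s x.
Proof. by move=> sy nxy; rewrite porbit_sym (porbit_fix sy) inE. Qed.

Lemma card_porbits_insert s x y : s y = y -> x != y ->
  #|porbits (tperm x y * s)|.+1 = #|porbits s|.
Proof. by move=> sy nxy; apply/card_porbits_merge/notin_porbit_fix. Qed.

Lemma porbit_tperm_other s x y z : x \notin porbit s z -> y \notin porbit s z ->
  porbit (tperm x y * s) z = porbit s z.
Proof.
move=> xz yz.
have H i : ((tperm x y * s) ^+ i) z = (s ^+ i) z.
  elim: i => [|i IH]; rewrite ?expg0 // !expgSr !permM IH tpermD //.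
    by apply: contraNneq xz => ->; rewrite mem_porbit.
  by apply: contraNneq yz => ->; rewrite mem_porbit.
apply/setP=> w; apply/porbitP/porbitP => -[i ->]; exists i; by rewrite H.
Qed.

Lemma porbit_tperm_merge s x y : y \notin porbit s x ->
  porbit (tperm x y * s) x = porbit s x :|: porbit s y.
Proof.
move=> yx; have nxy : x != y by apply: contraNneq yx => ->; rewrite porbit_id.
have xy : x \notin porbit s y by rewrite porbit_sym.
apply/eqP; rewrite eqEsubset; apply/andP; split.
  apply: porbit_sub; first by rewrite inE porbit_id.
  move=> z; rewrite !inE permM; case: tpermP => [->|->|_ _].
  - by move=> _; rewrite porbit_step orbT.
  - by move=> _; rewrite porbit_step.
  - by case/orP=> /porbit_closed->; rewrite ?orbT.
set u := tperm x y * s.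
(* From [v] the product jumps to [s w] and then follows the cycle of [w] under [s] until it reaches
   [w], without meeting [v]. *)
have main w v : w \notin porbit s v -> v \notin porbit s w -> tperm x y = tperm v w ->
    porbit s w \subset porbit u v.
  move=> wv vw E; have nvw : v != w by apply: contraNneq wv => ->; rewrite porbit_id.
  have H i : i < #|porbit s w| -> (s ^+ i.+1) w \in porbit u v.
    elim: i => [|i IH] li.
      have -> : (s ^+ 1) w = u v by rewrite expg1 permM E tpermL.
      exact: porbit_step.
    have := IH (ltnW li); set z := (s ^+ i.+1) w.
    move/porbit_closed; rewrite permM E tpermD.
    - by rewrite /z -permM -expgSr.
    - by apply: contraNneq vw => ->; apply: mem_porbit.
    - apply/eqP=> Ez; have := uniq_traject_porbit s w.
      case: #|porbit s w| li => // n li /=; case/andP=> /negP[].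
      apply/trajectP; exists i => //.
      by rewrite {1}Ez /z permX iterSr.
  apply/subsetP=> z; rewrite porbit_traject => /trajectP[i li ->].
  case: i li => [|i] li; last by rewrite -permX; apply: H; apply: ltnW.
  have := H #|porbit s w|.-1; rewrite prednK ?(leq_ltn_trans _ li) //.
  by rewrite permX iter_porbit /= => ->.
rewrite subUset; apply/andP; split.
  have /porbit_eqP <- : y \in porbit u x.
    by have /subsetP := main y x yx xy erefl; apply; apply: porbit_id.
  exact: (main x y xy yx (tpermC _ _)).
exact: (main y x yx xy erefl).
Qed.

Lemma porbit_tperm_insert s x y : s y = y -> x != y ->
  porbit (tperm x y * s) x = y |: porbit s x.
Proof.
move=> sy nxy; rewrite porbit_tperm_merge; first by rewrite (porbit_fix sy) setUC.
exact: notin_porbit_fix.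
Qed.

Lemma card_porbit_insert s x y : s y = y -> x != y ->
  #|porbit (tperm x y * s) x| = #|porbit s x|.+1.
Proof.
move=> sy nxy; rewrite porbit_tperm_insert // cardsU1.
by rewrite (notin_porbit_fix sy nxy).
Qed.

Lemma card_porbit_merge s x y : y \notin porbit s x ->
  #|porbit (tperm x y * s) x| = #|porbit s x| + #|porbit s y|.
Proof.
move=> yx; rewrite porbit_tperm_merge // cardsU.
suff -> : porbit s x :&: porbit s y = set0 by rewrite cards0 subn0.
apply/setP=> z; rewrite !inE; apply/negP=> /andP[].
move/porbit_eqP => zx /porbit_eqP zy; case/negP: yx.
by apply/porbit_eqP; rewrite -zx.
Qed.

(** The new cycle of [x] skips the [i] points that followed it: it jumps to [(s ^+ i.+1) x] and then
    runs along [s] back to [x]. *)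
Lemma card_porbit_split s x i : 0 < i < #|porbit s x| ->
  #|porbit (tperm x ((s ^+ i) x) * s) x| = #|porbit s x| - i.
Proof.
set L := #|porbit s x| => /andP[i0 iL]; set y := (s ^+ i) x.
set u := tperm x y * s.
have inj j k : j < L -> k < L -> (s ^+ j) x = (s ^+ k) x -> j = k.
  move=> jL kL E; apply/eqP.
  rewrite -(nth_uniq x _ _ (uniq_traject_porbit s x)) ?size_traject //.
  by rewrite !nth_traject // -!permX E.
have inj0 j : 0 < j < L -> x <> (s ^+ j) x.
  case/andP=> j0 jL E; have L0 : 0 < L by lia.
  by have := inj 0 j L0 jL; rewrite perm1 => /(_ E); lia.
have sL : (s ^+ L) x = x by rewrite permX iter_porbit.
have H j : i + j < L -> (u ^+ j.+1) x = (s ^+ (i + j).+1) x.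
  elim: j => [|j IH] lj; first by rewrite expg1 permM tpermL -permM -expgSr addn0.
  rewrite expgSr permM IH; last by lia.
  rewrite permM tpermD; first by rewrite -permM -expgSr addnS.
    by apply/eqP/inj0; lia.
  by apply/eqP=> /inj; lia.
have uL : (u ^+ (L - i)) x = x.
  have -> : L - i = (L - i).-1.+1 by lia.
  rewrite H; last by lia.
  by have -> : (i + (L - i).-1).+1 = L by lia.
have per m : (u ^+ m) x = (u ^+ (m %% (L - i))) x.
  rewrite {1}(divn_eq m (L - i)) expgD permM; congr (_ _); rewrite mulnC expgM.
  by rewrite permX; elim: (m %/ _) => //= k ->; rewrite uL.
have -> : porbit u x = [set (u ^+ (j : 'I_(L - i))) x | j in [set: 'I_(L - i)]].
  apply/setP=> z; apply/porbitP/imsetP => [[m ->]|[j _ ->]]; last by exists j.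
  have lm : m %% (L - i) < L - i by rewrite ltn_mod; lia.
  by exists (Ordinal lm); rewrite // per.
rewrite card_imset ?cardsT ?card_ord // => j k E; apply: val_inj; move: E.
case: j k => [[|j] lj] [[|k] lk] //=; rewrite ?expg0 ?perm1.
- by rewrite H; [move/inj0; lia|lia].
- by rewrite H; [move/esym/inj0; lia|lia].
by rewrite !H; try lia; move/inj; lia.
Qed.

End Transpositions.

(** * Euler's inequality *)

Section Euler.
Import GroupScope.
Variable T : finType.
Implicit Types (s a : {perm T}) (x y z r e : T) (D : {set T}).

Lemma inv_porbit (I : Type) (f : T -> I) s x y :
  (forall z, f (s z) = f z) -> y \in porbit s x -> f y = f x.
Proof.
move=> fs /porbitP[i ->]; elim: i => [|i IH]; rewrite ?perm1 //.
by rewrite expgSr permM fs.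
Qed.

(** An invariant function is a function on the set of cycles. Conversely, numbers of cycles can be
    read off from numbers of invariant functions. *)
Lemma card_inv_ffun (I : finType) s :
  #|[set f : {ffun T -> I} | [forall h, f (s h) == f h]]| = (#|I| ^ #|porbits s|)%N.
Proof.
pose U : finType := {B : {set T} | B \in porbits s}.
have pm x : porbit s x \in porbits s by apply/imsetP; exists x.
pose h (g : {ffun U -> I}) : {ffun T -> I} := [ffun x => g (Sub (porbit s x) (pm x))].
have -> : [set f : {ffun T -> I} | [forall h, f (s h) == f h]] = [set h g | g in setT].
  apply/setP=> f; rewrite inE; apply/forallP/imsetP => [fs|[g _ ->] x].
    have fs' z : f (s z) = f z by apply/eqP.
    have ex (B : U) : exists x, porbit s x == val B.
      by case/imsetP: (valP B) => x _ ->; exists x.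
    exists [ffun B => f (xchoose (ex B))] => //.
    apply/ffunP=> x; rewrite !ffunE.
    have /eqP/porbit_eqP H := xchooseP (ex (Sub (porbit s x) (pm x))).
    by rewrite (inv_porbit fs' H).
  rewrite !ffunE; apply/eqP; congr (g _); apply: val_inj => /=.
  by apply/porbit_eqP; apply: porbit_step.
rewrite card_imset; first by rewrite cardsT card_ffun card_sig.
move=> g1 g2 E; apply/ffunP=> -[B pB].
case/imsetP: (pB) => x _ EB; have /ffunP/(_ x) := E; rewrite !ffunE.
by congr (g1 _ = g2 _); apply: val_inj.
Qed.

Definition binv s a : {set {ffun T -> bool}} :=
  [set f : {ffun T -> bool} | [forall h, (f (s h) == f h) && (f (a h) == f h)]].

Lemma binvP s a (f : {ffun T -> bool}) :
  reflect ((forall h, f (s h) = f h) /\ (forall h, f (a h) = f h)) (f \in binv s a).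
Proof.
rewrite inE; apply: (iffP forallP) => [H|[H1 H2] h]; last by rewrite H1 H2 !eqxx.
by split=> h; have /andP[/eqP? /eqP?] := H h.
Qed.

Notation c s := (#|porbits s|).

Lemma card_porbits1 : c (1 : {perm T}) = #|T|.
Proof.
rewrite /porbits card_imset // => x y /eqP.
by rewrite eq_porbit_mem (porbit_fix (perm1 _)) inE => /eqP.
Qed.

(* Euler's inequality V + E + F <= N + 2 comp, with 2 ^ comp read as the number of invariant
   boolean functions; induction on a decomposition of a into transpositions. *)
Lemma euler_binv s a :
  (2 ^ (c s + c a + c (a * s)) <= 2 ^ #|T| * #|binv s a| ^ 2)%N.
Proof.
move: {2}#|_|.+1 (ltnSn #|[set x | a x != x]|) => n; elim: n a => // n IH a lan.
have [/eqP a1|] := boolP (a == 1).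
  subst a.
  have -> : binv s 1 = [set f : {ffun T -> bool} | [forall h, f (s h) == f h]].
    by apply/setP=> f; rewrite !inE; apply: eq_forallb => h; rewrite perm1 eqxx andbT.
  rewrite card_inv_ffun card_bool mul1g -expnM -expnD leq_exp2l //.
  rewrite card_porbits1; lia.
move=> na1; have [x nx] : exists x, a x != x.
  apply/existsP; rewrite -negb_forall; apply: contra na1 => /forallP H.
  by apply/eqP/permP=> x; rewrite perm1; apply/eqP.
set y := a x; set a' := tperm x y * a.
have yx : y \in porbit a x by apply: porbit_step.
have nxy : x != y by rewrite eq_sym.
have a'x : a' y = y by rewrite permM tpermR.
have lea : (#|[set x | a' x != x]| < n)%N.
  rewrite -ltnS; apply: leq_trans lan; rewrite ltnS; apply: proper_card; apply/properP; split.
    apply/subsetP=> z; rewrite !inE permM; case: tpermP => [-> //|->|//]. by rewrite eqxx.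
  exists y; rewrite !inE ?a'x ?eqxx //.
  by apply: contra nxy => /eqP; rewrite {2}/y => /perm_inj->.
have {IH}IH := IH a' lea.
have ca : c a' = (c a).+1 by apply: card_porbits_split.
have Ea : a = tperm x y * a' by rewrite tpermKg.
have Eas : a * s = tperm x y * (a' * s) by rewrite mulgA -Ea.
have sub : binv s a \subset binv s a'.
  apply/subsetP=> f /binvP[fs fa]; apply/binvP; split=> // z.
  rewrite permM fa; case: tpermP => [->|->|//]; by rewrite /y fa.
have back f : f \in binv s a' -> f x = f y -> f \in binv s a.
  move=> /binvP[fs fa] fxy; apply/binvP; split=> // z.
  by rewrite Ea permM fa; case: tpermP => [->|->|].
(* Restoring the transposition removes a cycle of [a]. If [x] and [y] share a face, a face is gained
   in return. Otherwise a face is lost as well, and the resulting factor 4 pays for a halving of the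
   number of invariant functions. *)
have [yin|yout] := boolP (y \in porbit (a' * s) x).
  have -> : binv s a = binv s a'.
    apply/eqP; rewrite eqEsubset sub; apply/subsetP=> f fi; apply: back => //.
    case/binvP: fi => fs fa; apply/esym/(inv_porbit _ yin) => z.
    by rewrite permM fs fa.
  have := card_porbits_split nxy yin; rewrite -Eas => ->.
  by move: IH; rewrite ca !addnS !addSn.
have := card_porbits_merge yout; rewrite -Eas => cas.
have le2 : (#|binv s a'| <= 2 * #|binv s a|)%N.
  have [] := boolP [exists f, (f \in binv s a') && (f x != f y)]; last first.
    rewrite negb_exists => /forallP H.
    have -> : binv s a = binv s a'; last by lia.
    apply/eqP; rewrite eqEsubset sub; apply/subsetP=> f fi; apply: back => //.
    by have := H f; rewrite fi /= negbK => /eqP.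
  case/existsP=> f0 /andP[/binvP[f0s f0a] nf0].
  rewrite -(cardsID (binv s a) (binv s a')) mul2n -addnn; apply: leq_add.
    by apply: subset_leq_card; apply: subsetIr.
  (* Adding one fixed function that separates [x] from [y] sends the functions that separate them
     injectively to functions that do not. *)
  pose g (f : {ffun T -> bool}) := [ffun z => f z (+) f0 z].
  rewrite -(card_imset (binv s a' :\: binv s a) (_ : injective g)); last first.
    by move=> f1 f2 /ffunP E; apply/ffunP=> z; have := E z; rewrite !ffunE => /addIb.
  apply: subset_leq_card; apply/subsetP=> _ /imsetP[f /setDP[fi nfi] ->].
  have nf : f x != f y by apply: contra nfi => /eqP; apply: back.
  apply: back; last by move: nf nf0; rewrite !ffunE; case: (f x); case: (f y); case: (f0 x); case: (f0 y).
  by case/binvP: fi => fs fa; apply/binvP; split=> z; rewrite !ffunE ?fs ?fa ?f0s ?f0a.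
rewrite -(leq_pmul2l (_ : 0 < 4)%N) //.
apply: (@leq_trans (2 ^ #|T| * #|binv s a'| ^ 2)).
  apply: leq_trans IH; rewrite (_ : 4 = 2 ^ 2)%N // -expnD leq_exp2l //; lia.
rewrite mulnCA leq_mul2l; apply/orP; right.
by rewrite (_ : 4 = 2 ^ 2)%N // -expnMn leq_exp2r.
Qed.

Definition closed2 s a D := [forall x in D, (s x \in D) && (a x \in D)].

Lemma closed2P s a D :
  reflect ((forall x, x \in D -> s x \in D) /\ (forall x, x \in D -> a x \in D))
    (closed2 s a D).
Proof.
apply: (iffP forall_inP) => [H|[H1 H2] x xD]; last by rewrite H1 ?H2.
by split=> x /H /andP[].
Qed.

(** Connectivity from [R] without paths: for permutations of a finite set, closure under images
    already gives closure under inverse images. *)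
Definition conn (A : {set T}) (R : {set T}) s a :=
  [forall D : {set T}, (R \subset D) && closed2 s a D ==> (A \subset D)].

Lemma connP (A R : {set T}) s a :
  reflect (forall D, R \subset D -> (forall x, x \in D -> s x \in D) ->
     (forall x, x \in D -> a x \in D) -> A \subset D) (conn A R s a).
Proof.
apply: (iffP forallP) => [H D RD sD aD|H D].
  by have /implyP := H D; apply; rewrite RD /=; apply/closed2P.
by apply/implyP=> /andP[RD /closed2P[]]; apply: H.
Qed.

(** An invariant boolean function is determined by its value at [r] and its values outside [A]; this
    bounds the right-hand side of [euler_binv]. *)
Lemma euler_conn (A : {set T}) r s a : r \in A -> conn A [set r] s a ->
  (c s + c a + c (a * s) <= #|T| + 2 * (#|T| - #|A|).+1)%N.
Proof.
move=> rA /connP cA.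
rewrite -(leq_exp2l (m := 2)) //; apply: leq_trans (euler_binv s a) _.
rewrite expnD leq_mul2l; apply/orP; right.
rewrite mulnC expnM leq_exp2r //.
pose B := r |: ~: A.
have fA f z : f \in binv s a -> z \in A -> f z = f r.
  case/binvP=> fs fa zA.
  have H : A \subset [set z | f z == f r].
    by apply: cA => [|x|x]; rewrite ?sub1set !inE ?fs ?fa.
  by have /subsetP/(_ z zA) := H; rewrite inE => /eqP.
pose g (f : {ffun T -> bool}) := [set z in B | f z].
rewrite -(card_in_imset (f := g) (D := binv s a)).
  apply: (@leq_trans #|powerset B|).
    by apply/subset_leq_card/subsetP=> _ /imsetP[f _ ->]; rewrite inE /g; apply/subsetP=> z /[!inE] /andP[].
  rewrite card_powerset leq_exp2l // /B cardsU1 inE rA /=.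
  by rewrite -(cardsC A) addKn.
move=> f1 f2 i1 i2 /setP E; apply/ffunP=> z.
have [zA|zA] := boolP (z \in A); last by have := E z; rewrite !inE zA orbT /=.
by rewrite !(fA _ z) //; have := E r; rewrite !inE eqxx /=.
Qed.

End Euler.

(** * The Potts polynomial *)

Section Parity.
Import GRing.Theory.
Local Open Scope ring_scope.
Variable T : finType.

Lemma even_card_involution (a : T -> T) (S : {set T}) :
  (forall x, x \in S -> a x \in S) -> (forall x, x \in S -> a (a x) = x) ->
  (forall x, x \in S -> a x != x) -> ~~ odd #|S|.
Proof.
move: {2}#|S|.+1 (ltnSn #|S|) => n; elim: n S => // n IH S lS cS iS fS.
have [->|[x xS]] := set_0Vmem S; first by rewrite cards0.
have nx := fS x xS; have axS := cS x xS.
have E : #|S| = #|S :\ x :\ a x|.+2.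
  by rewrite (cardsD1 x S) xS (cardsD1 (a x) (S :\ x)) !inE nx axS.
rewrite E /= negbK; apply: IH.
- by lia.
- move=> y; rewrite !inE => /and3P[yax yx yS]; rewrite cS // andbT; apply/andP; split.
    by apply: contra yx => /eqP E2; rewrite -(iS y) // E2 iS.
  by apply: contra yax => /eqP E2; rewrite -(iS y) // E2.
- by move=> y; rewrite !inE => /and3P[_ _]; apply: iS.
- by move=> y; rewrite !inE => /and3P[_ _]; apply: fS.
Qed.

End Parity.

Section Col.
Import GRing.Theory.
Local Open Scope ring_scope.
Variables (F : fieldType) (nu : F) (T : finType).
Implicit Types (s a : {perm T}) (x y z r e : T) (B D : {set T}).
Notation c s := (#|porbits s|).

Section Colours.
Variable I : finType.
Implicit Type f : {ffun T -> I}.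

Definition vcol s f := [forall h, f (s h) == f h].
(** Fixed points of [a] are legs and carry no edge. Every monochromatic edge contributes both its
    darts, hence the half in [wcol]. *)
Definition monoset a f := [set h | (a h != h) && (f h == f (a h))].
Definition wcol a f : F := nu ^+ #|monoset a f|./2.
Definition colsum s a : F := \sum_(f | vcol s f) wcol a f.

Lemma vcolP s f : reflect (forall h, f (s h) = f h) (vcol s f).
Proof. by apply: (iffP forallP) => H h; apply/eqP. Qed.

Lemma vcol_porbit s f x y : vcol s f -> y \in porbit s x -> f y = f x.
Proof. by move/vcolP; apply: inv_porbit. Qed.

Lemma colsum1 s : colsum s 1 = #|I|%:R ^+ c s.
Proof.
rewrite -natrX -card_inv_ffun -sum1dep_card natr_sum; apply: eq_bigr => f _.
by rewrite /wcol (_ : monoset 1 f = set0) ?cards0 //; apply/setP=> h; rewrite !inE perm1 eqxx.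
Qed.

Lemma monoset_even a f : (forall h, a (a h) = h) -> ~~ odd #|monoset a f|.
Proof.
move=> aK; apply: (even_card_involution (a := a)) => x; rewrite !inE ?aK //.
  by rewrite eq_sym [f (a x) == _]eq_sym.
by case/andP.
Qed.

Section Edge.
Variables (a : {perm T}) (e e' : T).
Hypotheses (nee : e != e') (ae : a e = e') (ae' : a e' = e).
Let a' := (tperm e e' * a)%g.

Lemma wcol_edge f : wcol a f = (if f e == f e' then nu else 1) * wcol a' f.
Proof.
have a'e : a' e = e by rewrite permM tpermL.
have a'e' : a' e' = e' by rewrite permM tpermR.
have a'o h : h != e -> h != e' -> a' h = a h.
  by move=> ? ?; rewrite permM tpermD // eq_sym.
rewrite /wcol; case: eqP => fee.
  have -> : monoset a f = e |: (e' |: monoset a' f).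
    apply/setP=> h; rewrite !inE.
    have [->|he] := eqVneq h e; first by rewrite ae eq_sym nee fee eqxx.
    have [->|he'] := eqVneq h e'; first by rewrite ae' nee fee eqxx.
    by rewrite a'o.
  rewrite !cardsU1 !inE !(negbTE nee) a'e a'e' !eqxx /=.
  by rewrite add0n exprS.
rewrite mul1r; suff -> : monoset a f = monoset a' f by [].
apply/setP=> h; rewrite !inE.
have [->|he] := eqVneq h e; first by rewrite ae a'e eqxx (introF eqP fee) andbF.
have [->|he'] := eqVneq h e'; first by rewrite ae' a'e' eqxx [f e' == _]eq_sym (introF eqP fee) andbF.
by rewrite a'o.
Qed.

(** When both ends are at one vertex the edge is a loop and contracting it means deleting it; the
    weights 1 and nu - 1 then add up to nu. *)
Definition contr s := if e' \in porbit s e then s else (tperm e e' * s)%g.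

Lemma vcol_tperm s f : e' \notin porbit s e ->
  vcol (tperm e e' * s) f = vcol s f && (f e == f e').
Proof.
move=> out; apply/idP/andP => [H|[/vcolP H /eqP E]].
  have E : f e' = f e.
    by apply: (vcol_porbit H); rewrite porbit_tperm_merge // inE porbit_id orbT.
  split; last by rewrite E.
  apply/vcolP=> h; rewrite -{1}(tpermKg e e' s) permM.
  by rewrite (vcolP _ _ H); case: tpermP => [->|->|].
by apply/vcolP=> h; rewrite permM H; case: tpermP => [->|->|].
Qed.

Lemma colsum_contr s : colsum (contr s) a' = \sum_(f | vcol s f && (f e == f e')) wcol a' f.
Proof.
rewrite /contr; case: ifPn => [inn|out].
  apply: eq_bigl => f; apply/idP/andP => [H|[]//]; split=> //.
  by rewrite (vcol_porbit H inn).
by apply: eq_bigl => f; rewrite vcol_tperm.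
Qed.

Lemma colsum_del_contr s : colsum s a = colsum s a' + (nu - 1) * colsum (contr s) a'.
Proof.
rewrite colsum_contr mulr_sumr big_mkcondr /= -big_split /=; apply: eq_bigr => f _.
rewrite wcol_edge; case: ifP => _; last by rewrite mul1r addr0.
by rewrite -{2}[wcol a' f]mul1r -mulrDl addrC subrK.
Qed.
End Edge.

(** No vertex and no edge meets both [B] and its complement, so colours may be permuted outside [B]
    alone. Given the colour of [r], each colour of [e] therefore contributes equally, and gluing the
    two vertices keeps one of [#|I|] equal parts. *)
Lemma colsum_merge s a r e B :
    (forall x, (s x \in B) = (x \in B)) -> (forall x, (a x \in B) = (x \in B)) ->
    r \in B -> e \notin B ->
  #|I|%:R * colsum (tperm r e * s) a = colsum s a.
Proof.
move=> sB aB rB eB.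
have out : e \notin porbit s r.
  apply: contra eB; apply: (subsetP (porbit_sub rB _)) => y; by rewrite sB.
pose W b1 b2 := \sum_(f | vcol s f && ((f r == b1) && (f e == b2))) wcol a f.
have WE b1 b2 : W b1 b2 = W b1 b1.
  pose h f := [ffun x => if x \in B then f x else tperm b1 b2 (f x)].
  have hK : involutive h.
    by move=> f; apply/ffunP=> x; rewrite !ffunE; case: (x \in B); rewrite ?tpermK.
  rewrite /W (reindex_inj (inv_inj hK)) /=; apply: eq_big => [f|f _].
    rewrite !ffunE rB (negbTE eB).
    have -> : vcol s (h f) = vcol s f.
      apply: eq_forallb => x; rewrite !ffunE sB; case: (x \in B) => //.
      by rewrite (inj_eq perm_inj).
    suff -> : (tperm b1 b2 (f e) == b2) = (f e == b1) by [].
    by rewrite -[X in _ == X](tpermL b1 b2) (inj_eq perm_inj).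
  rewrite /wcol; suff -> : monoset a (h f) = monoset a f by [].
  apply/setP=> x; rewrite !inE !ffunE aB; case: (x \in B) => //.
  by rewrite (inj_eq perm_inj).
have -> : colsum (tperm r e * s) a = \sum_b W b b.
  rewrite /colsum (partition_big (fun f : {ffun T -> I} => f r) predT) //=.
  apply: eq_bigr => b _; apply: eq_bigl => f.
  rewrite vcol_tperm // -!andbA; congr (_ && _).
  by have [->|] := eqVneq (f r) b; rewrite ?andbT ?andbF // eq_sym.
rewrite /colsum (partition_big (fun f : {ffun T -> I} => f r) predT) //= mulr_sumr.
apply: eq_bigr => b1 _.
rewrite (partition_big (fun f : {ffun T -> I} => f e) predT) //=.
transitivity (\sum_(b2 : I) W b1 b2); last first.
  by apply: eq_bigr => b2 _; apply: eq_bigl => f; rewrite -andbA.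
rewrite (eq_bigr (fun=> W b1 b1)) => [|b2 _]; last exact: WE.
by rewrite big_const -Monoid.iteropE /= -[RHS]mulr_natl cardE.
Qed.

(** Exchanging the two colourings outside [B] joins their relevant halves into one colouring for
    [s1 * s2]; the other colouring becomes unconstrained and accounts for the power of [#|I|]. *)
Lemma colsum_disjoint B s1 a1 s2 a2 :
    (forall h, a1 (a1 h) = h) -> (forall h, a2 (a2 h) = h) ->
    perm_on B s1 -> perm_on B a1 -> perm_on (~: B) s2 -> perm_on (~: B) a2 ->
  colsum s1 a1 * colsum s2 a2 = colsum (s1 * s2) (a1 * a2) * #|I|%:R ^+ #|T|.
Proof.
move=> a1K a2K s1B a1B s2B a2B.
have onB u1 u2 x : perm_on B u1 -> perm_on (~: B) u2 -> x \in B -> (u1 * u2)%g x = u1 x.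
  by move=> ou1 ou2 xB; rewrite permM (out_perm ou2) // inE negbK perm_closed.
have onC u1 u2 x : perm_on B u1 -> perm_on (~: B) u2 -> x \notin B -> (u1 * u2)%g x = u2 x.
  by move=> ou1 ou2 xB; rewrite permM (out_perm ou1).
have -> : (#|I|%:R ^+ #|T| : F) = \sum_(g : {ffun T -> I}) 1.
  by rewrite sumr_const -natrX card_ffun.
rewrite /colsum !big_distrlr /= !pair_big /=.
pose h (p : {ffun T -> I} * {ffun T -> I}) :=
  ([ffun x => if x \in B then p.1 x else p.2 x], [ffun x => if x \in B then p.2 x else p.1 x]).
have hK : involutive h.
  case=> f g; rewrite /h /=; congr (_, _); apply/ffunP=> x; by rewrite !ffunE /=; case: (x \in B).
rewrite [RHS](reindex_inj (inv_inj hK)) /=; apply: eq_big => [[f g]|[f g] _] /=.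
  rewrite andbT; apply/andP/vcolP => [[/vcolP H1 /vcolP H2] x|H].
    rewrite !ffunE; have [xB|xB] := boolP (x \in B).
      by rewrite onB // perm_closed // xB H1.
    rewrite onC //; have := perm_closed x s2B; rewrite !inE (negbTE xB) /=.
    by move=> /negbTE->; rewrite H2.
  split; apply/vcolP=> x; have [xB|xB] := boolP (x \in B).
  - by have := H x; rewrite !ffunE onB // perm_closed // xB.
  - by rewrite (out_perm s1B).
  - by rewrite (out_perm s2B) // inE xB.
  - have := H x; rewrite !ffunE onC // (negbTE xB).
    by have := perm_closed x s2B; rewrite !inE (negbTE xB) /= => /negbTE->.
rewrite mulr1 /wcol -exprD; congr (_ ^+ _).
have -> : monoset (a1 * a2) (h (f, g)).1 = monoset a1 f :|: monoset a2 g.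
  apply/setP=> x; rewrite !inE !ffunE /=; have [xB|xB] := boolP (x \in B).
    by rewrite onB // perm_closed // xB (out_perm a2B) ?inE ?xB // eqxx orbF.
  rewrite onC // (out_perm a1B xB) eqxx /=.
  by have := perm_closed x a2B; rewrite !inE (negbTE xB) /= => /negbTE->.
have dis : monoset a1 f :&: monoset a2 g = set0.
  apply/setP=> x; rewrite !inE; have [xB|xB] := boolP (x \in B).
    by rewrite (out_perm a2B) ?inE ?xB // eqxx /= andbF.
  by rewrite (out_perm a1B xB) eqxx.
rewrite cardsU dis cards0 subn0 halfD.
by rewrite (negbTE (monoset_even f a1K)).
Qed.

End Colours.
End Col.

Section Potts.
Import GRing.Theory.
Local Open Scope ring_scope.
Variables (F : fieldType) (nu q : F).
Hypothesis ch0 : forall n, n.+1%:R != 0 :> F.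

Lemma natr_inj0 m n : (m%:R == n%:R :> F) = (m == n).
Proof.
wlog le : m n / (m <= n)%N.
  by move=> H; case/orP: (leq_total m n) => /H //; rewrite eq_sym => ->; rewrite eq_sym.
rewrite eq_sym -subr_eq0 -natrB //.
case E : (n - m)%N => [|k].
  by rewrite eqxx; apply/esym/eqP; lia.
by rewrite (negbTE (ch0 k)); apply/esym/eqP; lia.
Qed.

Lemma poly_nat_eq0 (p : {poly F}) : (forall j, (j < size p)%N -> p.[j%:R] = 0) -> p = 0.
Proof.
move=> H; apply: (roots_geq_poly_eq0 (rs := [seq j%:R | j <- iota 0 (size p)])).
- by apply/allP=> x /mapP[j]; rewrite mem_iota => /andP[_ ?] ->; rewrite /root H.
- rewrite map_inj_uniq ?iota_uniq // => m n /eqP; by rewrite natr_inj0 => /eqP.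
- by rewrite size_map size_iota.
Qed.

Lemma poly_nat_eq (p p' : {poly F}) : (forall j, p.[j%:R] = p'.[j%:R]) -> p = p'.
Proof.
move=> H; apply/eqP; rewrite -subr_eq0; apply/eqP/poly_nat_eq0 => j _.
by rewrite hornerD hornerN H subrr.
Qed.

(** Lagrange interpolation at 0, ..., N, in the form taken by the definition of [potts]. *)
Definition interp N (v : nat -> F) (x : F) : F :=
  \sum_(j < N.+1) v j * \prod_(i < N.+1 | i != j) ((x - (i : nat)%:R) / ((j : nat)%:R - (i : nat)%:R)).

Lemma interpE N (p : {poly F}) v x : (size p <= N.+1)%N ->
  (forall j, (j <= N)%N -> v j = p.[j%:R]) -> interp N v x = p.[x].
Proof.
move=> sp vp.
pose L : {poly F} := \sum_(j < N.+1) (v j)%:P *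
  \prod_(i < N.+1 | i != j) (('X - (i : nat)%:R%:P) * (((j : nat)%:R - (i : nat)%:R)^-1)%:P).
have LE y : L.[y] = interp N v y.
  rewrite horner_sum; apply: eq_bigr => j _; rewrite hornerM hornerC horner_prod.
  by congr (_ * _); apply: eq_bigr => i _; rewrite hornerM hornerXsubC hornerC.
rewrite -LE; congr (_.[_]); apply/eqP; rewrite -subr_eq0; apply/eqP/poly_nat_eq0 => k lk.
have sL : (size L <= N.+1)%N.
  apply: leq_trans (size_sum _ _ _) _; apply/bigmax_leqP=> j _.
  rewrite mul_polyC; apply: leq_trans (size_scale_leq _ _) _.
  apply: leq_trans (size_poly_prod_leq _ _) _.
  rewrite -sum1_card.
  apply: (@leq_trans ((\sum_(i < N.+1 | i != j) 2).+1 - \sum_(i < N.+1 | i != j) 1)%N).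
    apply: leq_sub => //; rewrite ltnS; apply: leq_sum => i _.
    apply: leq_trans (size_polyMleq _ _) _; rewrite size_XsubC.
    by rewrite addSn /= add1n ltnS size_polyC_leq1.
  rewrite !sum_nat_const muln1 cardC1 card_ord; lia.
have lkN : (k < N.+1)%N.
  apply: leq_trans lk _; apply: leq_trans (size_polyD _ _) _.
  by rewrite size_polyN geq_max sL.
rewrite hornerD hornerN LE -vp //.
rewrite /interp (bigD1 (Ordinal lkN)) //= [X in _ * X + _]big1 => [|i ni]; last first.
  rewrite divff // subr_eq0 natr_inj0 eq_sym; apply: contra ni => /eqP E.
  by apply/eqP/val_inj.
rewrite mulr1 big1 ?addr0 ?subrr // => j nj.
rewrite (bigD1 (Ordinal lkN)) 1?eq_sym //= subrr !mul0r mulr0 //.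
Qed.

Variable T : finType.
Implicit Types (s a : {perm T}) (x y z r e : T) (B D : {set T}).
Notation c s := (#|porbits s|).
Notation colj j s a := (@colsum F nu T 'I_j s a).

Definition pottsval s a := interp (c s) (fun j => colj j s a) q.

(** Induction on the number of darts moved by [a], by deletion and contraction; contraction does not
    increase the number of vertices, which keeps the degree bound. *)
Lemma colsum_poly s a : (forall h, a (a h) = h) ->
  exists2 p : {poly F}, (size p <= (c s).+1)%N & forall j, colj j s a = p.[j%:R].
Proof.
move: {2}#|_|.+1 (ltnSn #|[set x | a x != x]|) => n; elim: n a s => // n IH a s lan aK.
have [/eqP a1|] := boolP (a == 1%g).
  exists ('X^(c s)); first by rewrite size_polyXn.
  by move=> j; rewrite a1 colsum1 card_ord hornerXn.
move=> na1; have [x nx] : exists x, a x != x.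
  apply/existsP; rewrite -negb_forall; apply: contra na1 => /forallP H.
  by apply/eqP/permP=> x; rewrite perm1; apply/eqP.
set y := a x; set a' := (tperm x y * a)%g.
have nxy : x != y by rewrite eq_sym.
have ay : a y = x by rewrite /y aK.
have a'x : a' x = x by rewrite permM tpermL.
have a'y : a' y = y by rewrite permM tpermR.
have a'K h : a' (a' h) = h.
  have [->|hx] := eqVneq h x; first by rewrite !a'x.
  have [->|hy] := eqVneq h y; first by rewrite !a'y.
  rewrite [a' h]permM tpermD 1?eq_sym // permM tpermD ?aK //.
    by apply: contra hy => /eqP E; rewrite /y E aK.
  by apply: contra hx => /eqP /perm_inj ->.
have lea : (#|[set x | a' x != x]| < n)%N.
  rewrite -ltnS; apply: leq_trans lan; rewrite ltnS; apply: proper_card; apply/properP; split.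
    apply/subsetP=> z; rewrite !inE permM; case: tpermP => [-> //|->|//].
    by rewrite eqxx.
  by exists x; rewrite !inE // a'x eqxx.
have [p sp pE] := IH a' s lea a'K.
have [p' sp' pE'] := IH a' (contr x y s) lea a'K.
exists (p + (nu - 1) *: p').
  apply: leq_trans (size_polyD _ _) _; rewrite geq_max sp.
  apply: leq_trans (size_scale_leq _ _) _; apply: leq_trans sp' _.
  rewrite /contr; case: ifPn => // /card_porbits_merge; lia.
move=> j; rewrite (colsum_del_contr nu 'I_j nxy erefl ay) pE pE'.
by rewrite hornerD hornerZ.
Qed.

(** The way from colour sums to Potts values: an identity valid for all numbers of colours becomes a
    polynomial identity by [poly_nat_eq] and is then evaluated at [q]. *)
Lemma potts_spec s a : (forall h, a (a h) = h) ->
  exists2 p : {poly F}, (forall j, colj j s a = p.[j%:R]) & pottsval s a = p.[q].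
Proof. by case/(colsum_poly s) => p sp pE; exists p => //; apply: interpE. Qed.

Lemma potts1 s : pottsval s 1 = q ^+ c s.
Proof.
have [|p pE ->] := @potts_spec s 1; first by move=> h; rewrite !perm1.
suff -> : p = 'X^(c s) by rewrite hornerXn.
by apply: poly_nat_eq => j; rewrite -pE colsum1 card_ord hornerXn.
Qed.

Lemma potts_edge s a e e' : (forall h, a (a h) = h) -> e != e' -> a e = e' ->
  pottsval s a = pottsval s (tperm e e' * a) + (nu - 1) * pottsval (contr e e' s) (tperm e e' * a).
Proof.
move=> aK nee ae; have a'K := tperm_mul_involution aK ae.
have ae' : a e' = e by rewrite -ae aK.
have [p pE ->] := potts_spec s aK; have [p1 pE1 ->] := potts_spec s a'K.
have [p2 pE2 ->] := potts_spec (contr e e' s) a'K.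
suff -> : p = p1 + (nu - 1)%:P * p2 by rewrite hornerD hornerM hornerC.
apply: poly_nat_eq => j; rewrite hornerD hornerM hornerC -pE -pE1 -pE2.
exact: colsum_del_contr.
Qed.

Lemma potts_merge s a r e B : (forall h, a (a h) = h) ->
    (forall x, (s x \in B) = (x \in B)) -> (forall x, (a x \in B) = (x \in B)) ->
    r \in B -> e \notin B ->
  q * pottsval (tperm r e * s) a = pottsval s a.
Proof.
move=> aK sB aB rB eB.
have [p pE ->] := potts_spec s aK; have [p1 pE1 ->] := potts_spec (tperm r e * s) aK.
suff -> : p = 'X * p1 by rewrite hornerM hornerX.
apply: poly_nat_eq => j; rewrite hornerM hornerX -pE -pE1.
by rewrite -(colsum_merge nu 'I_j sB aB rB eB) card_ord.
Qed.

Lemma potts_insert s a x y : (forall h, a (a h) = h) -> s y = y -> a y = y -> x != y ->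
  q * pottsval (tperm x y * s) a = pottsval s a.
Proof.
move=> aK sy ay xy; apply: (potts_merge aK (B := ~: [set y])).
- by move=> t; rewrite !inE (perm_fix_eq _ sy).
- by move=> t; rewrite !inE (perm_fix_eq _ ay).
- by rewrite !inE.
- by rewrite !inE eqxx.
Qed.

Lemma potts_disjoint B s1 a1 s2 a2 :
    (forall h, a1 (a1 h) = h) -> (forall h, a2 (a2 h) = h) ->
    (forall h, (a1 * a2)%g ((a1 * a2)%g h) = h) ->
    perm_on B s1 -> perm_on B a1 -> perm_on (~: B) s2 -> perm_on (~: B) a2 ->
  pottsval s1 a1 * pottsval s2 a2 = pottsval (s1 * s2) (a1 * a2) * q ^+ #|T|.
Proof.
move=> a1K a2K aK s1B a1B s2B a2B.
have [p pE ->] := potts_spec (s1 * s2) aK; have [p1 pE1 ->] := potts_spec s1 a1K.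
have [p2 pE2 ->] := potts_spec s2 a2K.
suff E : p1 * p2 = p * 'X^#|T| by rewrite -hornerM E hornerM hornerXn.
apply: poly_nat_eq => j; rewrite !hornerM hornerXn -pE1 -pE2 -pE.
by rewrite (colsum_disjoint nu 'I_j a1K a2K s1B a1B s2B a2B) card_ord.
Qed.

End Potts.

Section DisjointProduct.
Import GRing.Theory.
Local Open Scope ring_scope.

(** With two colours and no edges the colour sum is 2 to the number of cycles, so [colsum_disjoint]
    already contains this count. *)
Lemma card_porbits_disjoint (T : finType) (B : {set T}) (s1 s2 : {perm T}) :
  perm_on B s1 -> perm_on (~: B) s2 ->
  (#|porbits s1| + #|porbits s2| = #|porbits (s1 * s2)%g| + #|T|)%N.
Proof.
move=> s1B s2B.
have id1 (h : T) : (1%g : {perm T}) ((1%g : {perm T}) h) = h by rewrite !perm1.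
have := @colsum_disjoint rat 1 T bool B s1 1%g s2 1%g id1 id1 s1B (perm_on1 _) s2B (perm_on1 _).
rewrite mulg1 !colsum1 card_bool -!exprD -!natrX => /eqP; rewrite Num.Theory.eqr_nat.
by rewrite eqn_exp2l // => /eqP.
Qed.

End DisjointProduct.

(** * Planar maps with legs *)

Section LeggedMaps.
Import GroupScope.
Variable T : finType.
Implicit Types (s a : {perm T}) (x y z r e : T) (A B D R : {set T}).
Notation c s := (#|porbits s|).

(* Maps with legs: R consists of dangling half-edges, which are the fixed points of a. *)
Definition legged A R s a :=
  [&& perm_on A s, perm_on A a, R \subset A, [forall x, a (a x) == x],
      [forall x in A, (a x == x) == (x \in R)] & conn A R s a].

Record legged_spec A R s a : Prop := LeggedSpec {
  lg_s : perm_on A s;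
  lg_a : perm_on A a;
  lg_R : R \subset A;
  lg_aK : forall x, a (a x) = x;
  lg_fix : forall x, x \in A -> (a x == x) = (x \in R);
  lg_conn : conn A R s a }.

Lemma leggedP A R s a : reflect (legged_spec A R s a) (legged A R s a).
Proof.
apply: (iffP idP) => [|[H1 H2 H3 H4 H5 H6]].
  case/and5P=> H1 H2 H3 /forallP H4 /andP[/forall_inP H5 H6].
  by split=> // x; [apply/eqP|move=> /H5/eqP].
apply/and5P; split=> //; first by apply/forallP=> x; apply/eqP.
by apply/andP; split=> //; apply/forall_inP => x /H5 ->.
Qed.

(* Genus zero; every dart outside A is a cycle of s, of a and of a * s. *)
Definition rooted A r s a :=
  legged A [set r] s a && (c s + c a + c (a * s) == #|T| + 2 * #|~: A|.+1).

(* The transposition splits or merges the faces at the two legs: the relation holds for a connected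
   planar map with both legs in one face and for two disjoint planar maps. *)
Definition birooted A r e' s a :=
  [&& r != e', legged A [set r; e'] s a &
      c s + c a + c (tperm r e' * (a * s)) == #|T| + 2 * #|~: A| + 3].

Lemma perm_commute_tperm a r e : a r = r -> a e = e -> a * tperm r e = tperm r e * a.
Proof. by move=> ar ae; have := conjgC (tperm r e) a; rewrite tpermJ ar ae. Qed.

(** In terms of the map after deletion, the root edge acts on the face permutation by two
    transpositions on the left: the outer one inserts [e], and the inner one cuts or joins the faces
    at [r] and [e']. The face counts for the root edge rest on this form. *)
Lemma face_of_deletion s a r e e' : a r = r -> a e = e -> r != e -> r != e' -> e != e' ->
  tperm e e' * a * (tperm r e * s) = tperm r e * (tperm r e' * (a * s)).
Proof.
move=> ar ae re re' ee'.
rewrite mulgA -[tperm e e' * a * _]mulgA perm_commute_tperm // !mulgA; congr (_ * _ * _).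
have := conjgC (tperm e e') (tperm r e).
by rewrite tpermJ tpermR tpermD // => ->.
Qed.

Lemma card_setCD1 A e : e \in A -> #|~: (A :\ e)| = #|~: A|.+1.
Proof. by move=> eA; rewrite setCD setUC cardsU1 !inE eA. Qed.

(** The root edge starts with the dart [e] that follows the leg [r]. This dart is discarded, while
    its partner [e'] stays as a second leg and marks the place where the edge ended. *)
Lemma deletion_fwd A r s a (e := s r) (e' := a e) : e != r -> rooted A r s a ->
  e \in A /\ birooted (A :\ e) r e' (tperm r e * s) (tperm e e' * a).
Proof.
move=> er /andP[/leggedP[sA aA /[!sub1set] rA aK af C] /eqP E].
have eA : e \in A by rewrite perm_closed.
have e'A : e' \in A by rewrite perm_closed.
have ee' : e != e' by rewrite eq_sym /e' af // inE.
have ar : a r = r by apply/eqP; rewrite af // inE.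
have ae' : a e' = e by rewrite aK.
have re : r != e by rewrite eq_sym.
have re' : r != e' by apply: contra er => /eqP E1; rewrite -ae' -E1 ar.
set s' := tperm r e * s; set a' := tperm e e' * a.
have Es : s = tperm r e * s' by rewrite tpermKg.
have Ea : a = tperm e e' * a' by rewrite tpermKg.
have s'e : s' e = e by rewrite permM tpermR.
have a'e : a' e = e by rewrite permM tpermL.
have a'e' : a' e' = e' by rewrite permM tpermR.
have a'r : a' r = r by rewrite permM tpermD // eq_sym.
have a'o h : h != e -> h != e' -> a' h = a h by apply: tperm_mul_other.
split=> //; apply/and3P; split=> //.
  apply/leggedP; split.
  - by apply: perm_on_setD1 => //; apply: perm_on_tperm_mul.
  - by apply: perm_on_setD1 => //; apply: perm_on_tperm_mul.
  - by apply/subsetP=> x; rewrite !inE => /orP[]/eqP->; rewrite ?rA ?e'A ?re // eq_sym ee'.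
  - exact: tperm_mul_involution.
  - move=> x; rewrite !inE => /andP[xe xA].
    have [->|xe'] := eqVneq x e'; first by rewrite a'e' eqxx orbT.
    by rewrite a'o // af // inE orbF.
  - apply/connP=> D; rewrite subUset !sub1set => /andP[rD e'D] sD aD.
    rewrite subDset; move/connP: C; apply.
    + by rewrite sub1set !inE rD orbT.
    + move=> x; rewrite !inE Es permM; case: tpermP => [_ _|_ _|nr ne].
      * by rewrite s'e eqxx.
      * by rewrite sD ?orbT.
      * by case/orP=> [/eqP//|xD]; rewrite sD ?orbT.
    + move=> x; rewrite !inE Ea permM; case: tpermP => [_ _|_ _|ne ne'].
      * by rewrite a'e' e'D orbT.
      * by rewrite a'e eqxx.
      * by case/orP=> [/eqP//|xD]; rewrite aD ?orbT.
have cs : c s' = (c s).+1 by apply: card_porbits_split => //; apply: porbit_step.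
have ca : c a' = (c a).+1 by apply: card_porbits_split => //; apply: porbit_step.
have cf : (c (a * s)).+1 = c (tperm r e' * (a' * s')).
  rewrite {1}Ea {1}Es face_of_deletion //; apply: card_porbits_insert => //.
  by rewrite permM tpermD 1?eq_sym // 1?eq_sym // permM a'e.
rewrite card_setCD1 //; move: E cs ca cf; clear; lia.
Qed.

Lemma deletion_bwd A r e e' s a : e != r -> e \in A -> birooted (A :\ e) r e' s a ->
  [/\ rooted A r (tperm r e * s) (tperm e e' * a), (tperm r e * s) r = e
     & (tperm e e' * a) e = e'].
Proof.
move=> er eA /and3P[re' /leggedP[sA aA RA aK af C] /eqP E].
have re : r != e by rewrite eq_sym.
move: RA; rewrite subUset !sub1set !inE => /andP[/andP[_ rA] /andP[e'e e'A]].
have ee' : e != e' by rewrite eq_sym.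
have se : s e = e by rewrite (out_perm sA) // !inE eqxx.
have ae : a e = e by rewrite (out_perm aA) // !inE eqxx.
have ar : a r = r by apply/eqP; rewrite af !inE ?eqxx ?re.
have ae' : a e' = e' by apply/eqP; rewrite af !inE ?eqxx ?orbT ?e'e.
set s0 := tperm r e * s; set a0 := tperm e e' * a.
have Es : s = tperm r e * s0 by rewrite tpermKg.
have Ea : a = tperm e e' * a0 by rewrite tpermKg.
have s0r : s0 r = e by rewrite permM tpermL.
have a0e : a0 e = e' by rewrite permM tpermL.
have a0e' : a0 e' = e by rewrite permM tpermR.
have a0o h : h != e -> h != e' -> a0 h = a h by apply: tperm_mul_other.
split=> //; apply/andP; split.
  apply/leggedP; split.
  - by apply: perm_on_tperm_mul => //; apply: perm_on_sub sA; apply: subD1set.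
  - by apply: perm_on_tperm_mul => //; apply: perm_on_sub aA; apply: subD1set.
  - by rewrite sub1set.
  - move=> x; rewrite permM [a0 x]permM.
    case: (tpermP e e' x) => [->|->|/eqP xe /eqP xe']; first by rewrite ae' tpermR ae.
      by rewrite ae tpermL ae'.
    rewrite tpermD ?aK //; first by apply: contra xe => /eqP E1; rewrite -(inj_eq (@perm_inj _ a)) ae E1.
    by apply: contra xe' => /eqP E1; rewrite -(inj_eq (@perm_inj _ a)) ae' E1.
  - move=> x xA; rewrite inE.
    have [->|xe] := eqVneq x e; first by rewrite a0e (negbTE e'e) eq_sym (negbTE re).
    have [->|xe'] := eqVneq x e'; first by rewrite a0e' (negbTE ee') eq_sym (negbTE re').
    by rewrite a0o // af !inE ?xe //= (negbTE xe') orbF.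
  - apply/connP=> D; rewrite sub1set => rD sD aD.
    have eD : e \in D by rewrite -s0r sD.
    have e'D : e' \in D by rewrite -a0e aD.
    suff : A :\ e \subset D by rewrite subDset => /subset_trans->//; rewrite subUset sub1set eD subxx.
    move/connP: C; apply.
    + by rewrite subUset !sub1set rD.
    + by move=> x xD; rewrite Es permM; case: tpermP => [_|_|_ _]; apply: sD.
    + by move=> x xD; rewrite Ea permM; case: tpermP => [_|_|_ _]; apply: aD.
have cs : (c s0).+1 = c s by apply: card_porbits_insert.
have ca : (c a0).+1 = c a by apply: card_porbits_insert.
have cf : (c (a0 * s0)).+1 = c (tperm r e' * (a * s)).
  rewrite face_of_deletion //; apply: card_porbits_insert => //.
  by rewrite permM tpermD // permM ae.
move: E cs ca cf; rewrite card_setCD1 //; clear; lia.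
Qed.

(** An equality of conditions, because it serves to reindex sums along the involution that
    multiplies by the two transpositions. *)
Lemma deletion A r e e' s a : e != r ->
  [&& rooted A r (tperm r e * s) (tperm e e' * a), (tperm r e * s) r == e
     & (tperm e e' * a) e == e'] =
  (e \in A) && birooted (A :\ e) r e' s a.
Proof.
move=> er; apply/and3P/andP => [[M /eqP sr /eqP ae]|[eA N]].
  have := @deletion_fwd A r (tperm r e * s) (tperm e e' * a); cbv zeta.
  by rewrite sr ae !tpermKg => /(_ er M).
by have [-> -> ->] := deletion_bwd er eA N.
Qed.

End LeggedMaps.

(** * Two legs in one face, and duality *)

Section MoreMaps.
Import GroupScope.
Variable T : finType.
Implicit Types (s a : {perm T}) (x y z r e : T) (A B D R : {set T}).
Notation c s := (#|porbits s|).

Lemma face_of_insertion s a q e' : a e' = e' ->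
  a * (tperm (a q) e' * s) = tperm q e' * (a * s).
Proof.
move=> ae'; rewrite !mulgA; congr (_ * _).
by have := conjgC (tperm q e') a; rewrite tpermJ ae'.
Qed.

(** [q] is the predecessor of [e'] in the root face. Taking [e'] out of the rotation leaves a map
    with one leg, and [q] becomes a marked corner of its root face, from which the second leg can be
    restored. *)
Lemma insertion_fwd A r e' q s a : birooted A r e' s a -> e' \in porbit (a * s) r ->
  (a * s) q = e' ->
  [/\ q \in porbit (a * (tperm (a q) e' * s)) r, e' != r, e' \in A
    & rooted (A :\ e') r (tperm (a q) e' * s) a].
Proof.
case/and3P=> re' /leggedP[sA aA RA aK af C] /eqP E e'r fq.
move: RA; rewrite subUset !sub1set => /andP[rA e'A].
have ae' : a e' = e' by apply/eqP; rewrite af // !inE eqxx orbT.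
have qe' : q != e'.
  apply: contraTneq e'r => qe.
  have fe : (a * s) e' = e' by rewrite -{1}qe.
  by rewrite porbit_sym (porbit_fix fe) inE.
have aqe' : a q != e' by rewrite (perm_fix_eq _ ae').
set s' := tperm (a q) e' * s.
have s'e : s' e' = e' by rewrite permM tpermR -permM.
have f'e : (a * s') e' = e' by rewrite permM ae'.
have Ef : a * s = tperm q e' * (a * s') by rewrite face_of_insertion // tpermKg.
have qr : q \in porbit (a * s') r.
  have e'q : e' \in porbit (a * s) q by rewrite -fq porbit_step.
  have : r \in porbit (a * s) q.
    by rewrite -(porbit_eqP _ _ _ e'q) porbit_sym.
  rewrite Ef porbit_tperm_insert // !inE (negbTE re') /=.
  by rewrite porbit_sym.
split=> //; first by rewrite eq_sym.
have aqA : a q \in A.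
  rewrite perm_closed //; apply: contraT => qA.
  by have := fq; rewrite permM (out_perm aA qA) (out_perm sA qA) => E1; rewrite E1 e'A in qA.
apply/andP; split.
  apply/leggedP; split=> //.
  - by apply: perm_on_setD1 => //; apply: perm_on_tperm_mul.
  - exact: perm_on_setD1.
  - by rewrite sub1set !inE re'.
  - by move=> x; rewrite !inE => /andP[xe xA]; rewrite af // !inE (negbTE xe) orbF.
  apply/connP=> D; rewrite sub1set => rD sD aD.
  (* The successor of [e'] under [s] is [s' (a q)], so adding [e'] to [D] keeps it closed only if
     [q] is in [D]; this holds because [q] lies in the root face. *)
  have fD : porbit (a * s') r \subset D :\ e'.
    apply: porbit_sub; first by rewrite !inE re'.
    move=> y; rewrite !inE => /andP[ye yD]; rewrite permM sD ?aD // andbT.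
    by rewrite (perm_fix_eq _ s'e) (perm_fix_eq _ ae').
  have qD : q \in D by have := subsetP fD _ qr; rewrite !inE => /andP[].
  rewrite subDset; move/connP: C; apply.
  - by rewrite subUset !sub1set !inE rD eqxx orbT.
  - move=> x; rewrite !inE -[s](tpermKg (a q) e') permM -/s'.
    case: tpermP => [_ _|_ _|_ ne]; first by rewrite s'e eqxx.
      by rewrite (sD _ (aD _ qD)) orbT.
    by case/orP=> [/eqP//|xD]; rewrite sD ?orbT.
  - by move=> x; rewrite !inE => /orP[/eqP->|/aD->]; rewrite ?ae' ?eqxx ?orbT.
have cs : c s' = (c s).+1.
  by apply: card_porbits_split => //; rewrite -{1}fq permM porbit_step.
have cf : c (a * s') = (c (a * s)).+1.
  rewrite face_of_insertion //.
  by apply: card_porbits_split => //; rewrite -{1}fq porbit_step.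
have ct : c (tperm r e' * (a * s)) = (c (a * s)).+1 by apply: card_porbits_split.
rewrite card_setCD1 //; move: E cs cf ct; clear; lia.
Qed.

Lemma insertion_bwd A r e' q s a : e' != r -> e' \in A -> q \in porbit (a * s) r ->
  rooted (A :\ e') r s a ->
  [/\ birooted A r e' (tperm (a q) e' * s) a, e' \in porbit (a * (tperm (a q) e' * s)) r
    & (a * (tperm (a q) e' * s)) q = e'].
Proof.
move=> e'r e'A qr /andP[/leggedP[sA aA RA aK af C] /eqP E].
have re' : r != e' by rewrite eq_sym.
move: RA; rewrite sub1set !inE => /andP[_ rA].
have se' : s e' = e' by rewrite (out_perm sA) // !inE eqxx.
have ae' : a e' = e' by rewrite (out_perm aA) // !inE eqxx.
have /subsetP/(_ q qr) : porbit (a * s) r \subset A :\ e'.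
  apply: porbit_sub; first by rewrite !inE re'.
  by move=> y yA; rewrite permM !perm_closed.
rewrite !inE => /andP[qe' qA].
have aqe' : a q != e' by rewrite (perm_fix_eq _ ae').
have aqA : a q \in A by have := perm_closed q aA; rewrite !inE qe' qA => /andP[].
set s' := tperm (a q) e' * s.
have Ef : a * s' = tperm q e' * (a * s) by rewrite face_of_insertion.
have fe' : (a * s) e' = e' by rewrite permM ae'.
have s'q : s' (a q) = e' by rewrite permM tpermL.
have e'r' : e' \in porbit (a * s') r.
  have /porbit_eqP -> : r \in porbit (a * s') q.
    by rewrite Ef porbit_tperm_insert // !inE porbit_sym qr orbT.
  by rewrite Ef porbit_tperm_insert // !inE eqxx.
split=> //; last by rewrite permM.
apply/and3P; split=> //.
  apply/leggedP; split=> //.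
  - by apply: perm_on_tperm_mul => //; apply: perm_on_sub sA; apply: subD1set.
  - by apply: perm_on_sub aA; apply: subD1set.
  - by rewrite subUset !sub1set rA.
  - move=> x xA; rewrite !inE; have [->|xe] := eqVneq x e'; first by rewrite ae' eqxx orbT.
    by rewrite orbF af ?inE ?xe.
  apply/connP=> D; rewrite subUset !sub1set => /andP[rD e'D] sD aD.
  suff : A :\ e' \subset D :\ e'.
    rewrite subDset => /subset_trans->//; rewrite subUset sub1set e'D; exact: subD1set.
  move/connP: C; apply.
  - by rewrite sub1set !inE re'.
  - move=> x; rewrite !inE => /andP[xe xD]; apply/andP; split.
      by rewrite (perm_fix_eq _ se').
    rewrite -[s](tpermKg (a q) e') permM -/s'; case: tpermP => [_|_|_ _]; rewrite ?s'q //; exact: sD.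
  - move=> x; rewrite !inE => /andP[xe xD]; rewrite aD // andbT.
    by rewrite (perm_fix_eq _ ae').
have cs : (c s').+1 = c s by apply: card_porbits_insert.
have cf : (c (a * s')).+1 = c (a * s) by rewrite Ef; apply: card_porbits_insert.
have ct : c (tperm r e' * (a * s')) = (c (a * s')).+1 by apply: card_porbits_split.
move: E cs cf ct; rewrite card_setCD1 //; clear; lia.
Qed.

Lemma insertion A r e' q s a :
  [&& birooted A r e' (tperm (a q) e' * s) a, e' \in porbit (a * (tperm (a q) e' * s)) r
    & (a * (tperm (a q) e' * s)) q == e'] =
  [&& q \in porbit (a * s) r, e' != r, e' \in A & rooted (A :\ e') r s a].
Proof.
apply/and3P/and4P => [[N P /eqP Q]|[qr e'r e'A M]].
  by have := insertion_fwd N P Q; rewrite tpermKg.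
by have [-> -> ->] := insertion_bwd e'r e'A qr M.
Qed.

Lemma rooted_dual A r s a : rooted A r (a * s) a = rooted A r s a.
Proof.
suff H u : rooted A r u a -> rooted A r (a * u) a.
  apply/idP/idP => M; last exact: H.
  case/andP: (M) => /leggedP[_ _ _ aK _ _] _.
  by have := H _ M; rewrite mulgA (perm_involution aK) mul1g.
case/andP=> /leggedP[sA aA RA aK af C] E; apply/andP; split.
  apply/leggedP; split=> //; first exact: perm_onM.
  apply/connP=> D rD sD aD; move/connP: C; apply=> // x xD.
  by have := sD _ (aD _ xD); rewrite permM aK.
by rewrite mulgA (perm_involution aK) mul1g; apply/eqP; move/eqP: E; lia.
Qed.

End MoreMaps.

(** * Two legs in different components *)

Section Split.
Import GroupScope.
Variable T : finType.
Implicit Types (s a : {perm T}) (x y z r e : T) (A B D R : {set T}).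
Notation c s := (#|porbits s|).

Definition component s a r := \bigcap_(D : {set T} | (r \in D) && closed2 s a D) D.

Lemma component_root s a r : r \in component s a r.
Proof. by apply/bigcapP=> D /andP[]. Qed.

Lemma component_sub s a r D : r \in D -> (forall x, x \in D -> s x \in D) ->
  (forall x, x \in D -> a x \in D) -> component s a r \subset D.
Proof.
move=> rD sD aD; apply: bigcap_inf; rewrite rD /=; exact/closed2P.
Qed.

Lemma component_closed s a r x : x \in component s a r -> (s x \in component s a r) /\ (a x \in component s a r).
Proof.
move/bigcapP=> H; split; apply/bigcapP=> D HD; have xD := H D HD.
  by case/andP: HD => _ /closed2P[sD _]; apply: sD.
by case/andP: HD => _ /closed2P[_ aD]; apply: aD.
Qed.

Lemma component_mem_s s a r x : (s x \in component s a r) = (x \in component s a r).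
Proof. by apply: (@perm_closed_mem T s (component s a r) x) => y yD; case: (component_closed yD). Qed.

Lemma component_mem_a s a r x : (a x \in component s a r) = (x \in component s a r).
Proof. by apply: perm_closed_mem => y yD; case: (component_closed yD). Qed.

Lemma stable_astabs s B : (forall x, (s x \in B) = (x \in B)) -> s \in 'N(B | 'P).
Proof.
move=> H; apply/astabsP=> x /=; exact: H.
Qed.

Lemma restr_permEin s B x : (forall x, (s x \in B) = (x \in B)) -> x \in B ->
  restr_perm B s x = s x.
Proof. by move=> H xB; apply: restr_permE => //; apply: stable_astabs. Qed.

Lemma restr_perm_split s B : (forall x, (s x \in B) = (x \in B)) ->
  restr_perm B s * restr_perm (~: B) s = s.
Proof.
move=> H; have HC x : (s x \in ~: B) = (x \in ~: B) by rewrite !inE H.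
apply/permP=> x; rewrite permM; have [xB|xB] := boolP (x \in B).
  rewrite (restr_permEin H) // (out_perm (restr_perm_on _ _)) //.
  by rewrite inE negbK H.
by rewrite (out_perm (restr_perm_on _ _) xB) (restr_permEin HC) // inE.
Qed.

Lemma restr_perm_setD s A B : perm_on A s -> (forall x, (s x \in B) = (x \in B)) ->
  perm_on (A :\: B) (restr_perm (~: B) s).
Proof.
move=> sA sB; apply/subsetP=> x /[!inE] nx.
have xB : x \notin B.
  by apply: contra nx => xB; rewrite (out_perm (restr_perm_on _ _)) // inE negbK.
rewrite xB; apply: contraR nx => xA.
by rewrite restr_permEin ?(out_perm sA) // => [y|]; rewrite !inE ?sB.
Qed.

Lemma mul_perm_on B s1 s2 x : perm_on B s1 -> perm_on (~: B) s2 -> x \in B -> (s1 * s2) x = s1 x.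
Proof.
by move=> o1 o2 xB; rewrite permM (out_perm o2) // inE negbK perm_closed.
Qed.

Lemma mul_perm_out B s1 s2 x : perm_on B s1 -> x \notin B -> (s1 * s2) x = s2 x.
Proof. by move=> o1 xB; rewrite permM (out_perm o1). Qed.

Lemma mul_perm_mem B s1 s2 x : perm_on B s1 -> perm_on (~: B) s2 ->
  ((s1 * s2) x \in B) = (x \in B).
Proof.
move=> o1 o2; have [xB|xB] := boolP (x \in B).
  by rewrite (mul_perm_on o1 o2) // perm_closed.
rewrite (mul_perm_out _ o1) //; have := perm_closed x o2; rewrite !inE xB.
by move/negbTE.
Qed.

Lemma restr_perm_mul_on B s1 s2 : perm_on B s1 -> perm_on (~: B) s2 ->
  restr_perm B (s1 * s2) = s1.
Proof.
move=> o1 o2; apply/permP=> x; have [xB|xB] := boolP (x \in B).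
  by rewrite restr_permEin // ?(mul_perm_on o1 o2) // => y; apply: mul_perm_mem.
by rewrite (out_perm o1 xB) (out_perm (restr_perm_on _ _) xB).
Qed.

Lemma restr_perm_mul_out B s1 s2 : perm_on B s1 -> perm_on (~: B) s2 ->
  restr_perm (~: B) (s1 * s2) = s2.
Proof.
move=> o1 o2; apply/permP=> x; have [xB|xB] := boolP (x \in ~: B).
  rewrite restr_permEin // ?(mul_perm_out _ o1) //; first by move: xB; rewrite inE.
  by move=> y; rewrite !inE (mul_perm_mem _ o1 o2).
by rewrite (out_perm o2 xB) (out_perm (restr_perm_on _ _) xB).
Qed.

Lemma face_disjoint B s1 a1 s2 a2 : perm_on B s1 -> perm_on B a1 ->
  perm_on (~: B) s2 -> perm_on (~: B) a2 ->
  (a1 * a2) * (s1 * s2) = (a1 * s1) * (a2 * s2).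
Proof.
move=> o1 o1' o2 o2'.
have C : commute a2 s1.
  by apply/commute_sym/(perm_onC o1 o2'); rewrite disjoints_subset setCK.
by rewrite -!mulgA; congr (_ * _); rewrite !mulgA C.
Qed.

(** If [e'] were in the component of [r], the map would be connected from [r] and exceed Euler's
    bound by two. So there are two components, and since their Euler bounds add up to the known
    total, both are equalities. *)
Lemma split_fwd A r e' s a : birooted A r e' s a -> e' \notin porbit (a * s) r ->
  let B := component s a r in
  [/\ B \subset A, e' \notin B,
      rooted B r (restr_perm B s) (restr_perm B a) &
      rooted (A :\: B) e' (restr_perm (~: B) s) (restr_perm (~: B) a)].
Proof.
case/and3P=> re' /leggedP[sA aA RA aK af C] /eqP E e'r B.
move: RA; rewrite subUset !sub1set => /andP[rA e'A].
have BA : B \subset A by apply: component_sub => // x xA; rewrite perm_closed.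
have rB : r \in B by apply: component_root.
have cf : (c (tperm r e' * (a * s))).+1 = c (a * s) by apply: card_porbits_merge.
have sB x : (s x \in B) = (x \in B) by apply: component_mem_s.
have aB x : (a x \in B) = (x \in B) by apply: component_mem_a.
have sC x : (s x \in ~: B) = (x \in ~: B) by rewrite !inE sB.
have aC x : (a x \in ~: B) = (x \in ~: B) by rewrite !inE aB.
have e'B : e' \notin B.
  apply: contraL (isT) => e'B; have : conn A [set r] s a.
    apply/connP=> D; rewrite sub1set => rD sD aD; move/connP: C; apply=> //.
    by rewrite subUset !sub1set rD (subsetP (component_sub rD sD aD)).
  by move/(euler_conn rA); have := cardsC A; move: E cf; clear; lia.
set s1 := restr_perm B s; set a1 := restr_perm B a.
set s2 := restr_perm (~: B) s; set a2 := restr_perm (~: B) a.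
have os1 : perm_on B s1 by apply: restr_perm_on.
have oa1 : perm_on B a1 by apply: restr_perm_on.
have os2 : perm_on (~: B) s2 by apply: restr_perm_on.
have oa2 : perm_on (~: B) a2 by apply: restr_perm_on.
have Es : s1 * s2 = s by apply: restr_perm_split.
have Ea : a1 * a2 = a by apply: restr_perm_split.
have s1E x : x \in B -> s1 x = s x by apply: restr_permEin.
have a1E x : x \in B -> a1 x = a x by apply: restr_permEin.
have s2E x : x \notin B -> s2 x = s x by move=> xB; apply: restr_permEin; rewrite ?inE.
have a2E x : x \notin B -> a2 x = a x by move=> xB; apply: restr_permEin; rewrite ?inE.
have L1 : legged B [set r] s1 a1.
  apply/leggedP; split=> //.
  - by rewrite sub1set.
  - move=> x; have [xB|xB] := boolP (x \in B); first by rewrite !a1E ?aB ?aK.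
    by rewrite !(out_perm oa1 xB).
  - move=> x xB; rewrite a1E // af ?(subsetP BA) // !inE orbC.
    by have [xe|//] := eqVneq x e'; rewrite -xe xB in e'B.
  apply/connP=> D; rewrite sub1set => rD sD aD.
  have : B \subset D :&: B; last by rewrite subsetI => /andP[].
  apply: component_sub; rewrite ?inE ?rD // => x; rewrite !inE => /andP[xD xB].
    by rewrite -{1}s1E // sD //= sB.
  by rewrite -{1}a1E // aD //= aB.
have CA : A :\: B \subset ~: B by apply/subsetP=> x; rewrite !inE => /andP[].
have L2 : legged (A :\: B) [set e'] s2 a2.
  apply/leggedP; split=> //.
  - exact: restr_perm_setD.
  - exact: restr_perm_setD.
  - by rewrite sub1set !inE e'B.
  - move=> x; have [xB|xB] := boolP (x \in B); first by rewrite !(out_perm oa2) ?inE ?xB.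
    by rewrite !a2E ?aB ?aK.
  - move=> x; rewrite !inE => /andP[xB xA]; rewrite a2E // af // !inE.
    by have [xr|//] := eqVneq x r; rewrite xr rB in xB.
  apply/connP=> D; rewrite sub1set => e'D sD aD.
  rewrite subDset; move/connP: C; apply.
  - by rewrite subUset !sub1set !inE rB e'D orbT.
  - move=> x; rewrite !inE sB; have [//|xB /= xD] := boolP (x \in B).
    by rewrite -s2E // sD.
  - move=> x; rewrite !inE aB; have [//|xB /= xD] := boolP (x \in B).
    by rewrite -a2E // aD.
have := euler_conn rB (lg_conn (elimT (leggedP _ _ _ _) L1)).
have e'C : e' \in A :\: B by rewrite !inE e'B.
have := euler_conn e'C (lg_conn (elimT (leggedP _ _ _ _) L2)).
have := card_porbits_disjoint os1 os2; have := card_porbits_disjoint oa1 oa2.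
have := card_porbits_disjoint (perm_onM oa1 os1) (perm_onM oa2 os2).
rewrite -(face_disjoint os1 oa1 os2 oa2) Es Ea.
have := cardsC A; have := cardsC B; have := cardsC (A :\: B); have := cardsID B A.
rewrite (setIidPr BA) => h1 h2 h3 h4 h5 h6 h7 h8 h9.
split=> //; apply/andP; split=> //; apply/eqP; move: E cf h1 h2 h3 h4 h5 h6 h7 h8 h9; clear.
  lia.
lia.
Qed.

Lemma split_bwd A B r e' s1 a1 s2 a2 : B \subset A ->
    rooted B r s1 a1 -> rooted (A :\: B) e' s2 a2 ->
  [/\ birooted A r e' (s1 * s2) (a1 * a2), e' \notin porbit ((a1 * a2) * (s1 * s2)) r &
      component (s1 * s2) (a1 * a2) r = B].
Proof.
move=> BA /andP[/leggedP[os1 oa1 /[!sub1set] rB a1K a1f C1] /eqP E1].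
move=> /andP[/leggedP[os2' oa2' /[!sub1set] e'C a2K a2f C2] /eqP E2].
have CA : A :\: B \subset ~: B by apply/subsetP=> x; rewrite !inE => /andP[].
have os2 : perm_on (~: B) s2 by apply: subset_trans os2' CA.
have oa2 : perm_on (~: B) a2 by apply: subset_trans oa2' CA.
have : e' \in A :\: B by []. rewrite inE => /andP[e'B e'A].
have rA : r \in A by apply: (subsetP BA).
set s := s1 * s2; set a := a1 * a2.
have sB x : (s x \in B) = (x \in B) by apply: mul_perm_mem.
have aB x : (a x \in B) = (x \in B) by apply: mul_perm_mem.
have s1E x : x \in B -> s x = s1 x by apply: mul_perm_on.
have a1E x : x \in B -> a x = a1 x by apply: mul_perm_on.
have s2E x : x \notin B -> s x = s2 x by apply: mul_perm_out.
have a2E x : x \notin B -> a x = a2 x by apply: mul_perm_out.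
have aK x : a (a x) = x.
  have [xB|xB] := boolP (x \in B); first by rewrite (a1E _ xB) a1E ?perm_closed // a1K.
  by have := aB x; rewrite (a2E _ xB) (negbTE xB) => /negbT/a2E->; rewrite a2K.
have re' : r != e' by apply: contraNneq e'B => <-.
have out : e' \notin porbit (a * s) r.
  apply: contra e'B; apply: (subsetP (porbit_sub rB _)) => y yB.
  by rewrite permM sB aB.
have sD1 x : x \in A :\: B -> s x = s2 x.
  by rewrite inE => /andP[xB _]; apply: s2E.
have aD1 x : x \in A :\: B -> a x = a2 x.
  by rewrite inE => /andP[xB _]; apply: a2E.
split=> //; last first.
  apply/eqP; rewrite eqEsubset; apply/andP; split.
    by apply: component_sub => // x xB; rewrite ?sB ?aB.
  have : B \subset component s a r :&: B; last by rewrite subsetI => /andP[].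
  move/connP: C1; apply.
  - by rewrite sub1set inE component_root.
  - by move=> x; rewrite !inE => /andP[xD xB]; rewrite -s1E // component_mem_s xD sB.
  - by move=> x; rewrite !inE => /andP[xD xB]; rewrite -a1E // component_mem_a xD aB.
apply/and3P; split=> //.
  apply/leggedP; split.
  - apply: perm_onM; first exact: subset_trans os1 BA.
    by apply: subset_trans os2' _; apply: subsetDl.
  - apply: perm_onM; first exact: subset_trans oa1 BA.
    by apply: subset_trans oa2' _; apply: subsetDl.
  - by rewrite subUset !sub1set rA.
  - exact: aK.
  - move=> x xA; rewrite !inE; have [xB|xB] := boolP (x \in B).
      rewrite a1E // a1f // inE.
      by have [xe|] := eqVneq x e'; rewrite ?orbF // -xe xB in e'B *.
    rewrite a2E // a2f ?inE ?xB //.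
    by have [xr|//] := eqVneq x r; rewrite xr rB in xB.
  apply/connP=> D; rewrite subUset !sub1set => /andP[rD e'D] sD aD.
  have D1 : B \subset D :&: B.
    move/connP: C1; apply.
    - by rewrite sub1set inE rD.
    - by move=> x; rewrite !inE => /andP[xD xB]; rewrite -s1E // sD //= sB.
    - by move=> x; rewrite !inE => /andP[xD xB]; rewrite -a1E // aD //= aB.
  have D2 : A :\: B \subset D :&: ~: B.
    move/connP: C2; apply.
    - by rewrite sub1set !inE e'D.
    - by move=> x; rewrite !inE => /andP[xD xB]; rewrite -s2E // sD //= sB.
    - by move=> x; rewrite !inE => /andP[xD xB]; rewrite -a2E // aD //= aB.
  apply/subsetP=> x xA; have [xB|xB] := boolP (x \in B).
    by have := subsetP D1 _ xB; rewrite inE => /andP[].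
  have xC : x \in A :\: B by rewrite inE xB.
  by have := subsetP D2 _ xC; rewrite inE => /andP[].
have cf : (c (tperm r e' * (a * s))).+1 = c (a * s) by apply: card_porbits_merge.
have := card_porbits_disjoint os1 os2; have := card_porbits_disjoint oa1 oa2.
have := card_porbits_disjoint (perm_onM oa1 os1) (perm_onM oa2 os2).
rewrite -(face_disjoint os1 oa1 os2 oa2) -/s -/a.
have := cardsC A; have := cardsC B; have := cardsC (A :\: B); have := cardsID B A.
rewrite (setIidPr BA) => h1 h2 h3 h4 h5 h6 h7; apply/eqP; move: E1 E2 cf h1 h2 h3 h4 h5 h6 h7; clear.
lia.
Qed.

End Split.

Import GRing.Theory.
Local Open Scope ring_scope.

(** * Sums over rooted maps *)

Section Sums.
Variables (V : nmodType) (T : finType).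
Implicit Types (s a : {perm T}) (x y z r e : T) (A B D R : {set T}).
Implicit Types (p : {perm T} * {perm T}) (G : {perm T} -> {perm T} -> V).
Notation c s := (#|porbits s|).

(** As a leg satisfies [a r = r], the dart [s r] lies in the root face and at the root vertex. The
    root edge is an isthmus if its other dart is in the same face, and a loop if it is at the same
    vertex; duality exchanges the two. *)
Definition isthmus r s a := a (s r) \in porbit (a * s)%g r.
Definition loop r s a := a (s r) \in porbit s r.

Lemma tperm_split_out s x y : x != y -> y \in porbit s x ->
  y \notin porbit (tperm x y * s)%g x.
Proof.
move=> xy yx; apply/negP=> H; have := card_porbits_split xy H.
rewrite tpermKg (card_porbits_split xy yx); lia.
Qed.

Lemma rooted_root_moves A r s a : (1 < #|A|)%N -> rooted A r s a -> s r != r.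
Proof.
move=> A1 /andP[/leggedP[sA aA /[!sub1set] rA aK af C] _].
apply/eqP=> sr; have ar : a r = r by apply/eqP; rewrite af // inE.
have : A \subset [set r].
  by move/connP: C; apply=> // x /[!inE] /eqP->; rewrite ?sr ?ar.
by move/subset_leq_card; rewrite cards1 leqNgt A1.
Qed.

Lemma dual_sum A r G :
  \sum_(p | rooted A r p.1 p.2) G p.1 p.2 = \sum_(p | rooted A r p.1 p.2) G (p.2 * p.1)%g p.2.
Proof.
pose h p := ((p.2 * p.1)%g, p.2).
have hM p : rooted A r p.1 p.2 -> h (h p) = p.
  case: p => s a /andP[/leggedP[_ _ _ aK _ _] _]; rewrite /h /= mulgA.
  by rewrite (perm_involution aK) mul1g.
rewrite (reindex_onto h h) => [|p]; last exact: hM.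
apply: eq_bigl => p; rewrite rooted_dual; apply/andP/idP => [[]//|M].
by rewrite hM.
Qed.

Lemma loop_dual r s a : a r = r -> loop r (a * s)%g a = isthmus r s a.
Proof. by move=> ar; rewrite /isthmus /loop permM ar. Qed.

(** If the two legs share a face after deletion, the inner transposition of [face_of_deletion] cuts
    this face, so that the two sides of the edge differ; otherwise it joins two faces into one. *)
Lemma isthmus_deletion A r e e' s a : e != r -> birooted (A :\ e) r e' s a ->
  isthmus r (tperm r e * s)%g (tperm e e' * a)%g = (e' \notin porbit (a * s)%g r).
Proof.
move=> er /and3P[re' /leggedP[sA aA RA aK af C] _].
move: RA; rewrite subUset !sub1set !inE => /andP[/andP[re rA] /andP[e'e e'A]].
have ee' : e != e' by rewrite eq_sym.
have se : s e = e by rewrite (out_perm sA) // !inE eqxx.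
have ae : a e = e by rewrite (out_perm aA) // !inE eqxx.
have ar : a r = r by apply/eqP; rewrite af !inE ?eqxx ?re.
have ae' : a e' = e' by apply/eqP; rewrite af !inE ?eqxx ?orbT ?e'e.
rewrite /isthmus face_of_deletion //.
have -> : (tperm e e' * a)%g ((tperm r e * s)%g r) = e'.
  by rewrite [(tperm r e * s)%g r]permM tpermL se permM tpermL.
rewrite porbit_tperm_insert //; last first.
  by rewrite permM tpermD // 1?eq_sym // permM ae.
rewrite !inE (negbTE e'e) /=; have [inn|out] := boolP (e' \in porbit (a * s) r).
  by apply/negbTE/tperm_split_out.
by rewrite porbit_tperm_merge // inE porbit_id orbT.
Qed.

Lemma deletion_sum (P : bool) A r G : r \in A -> (1 < #|A|)%N ->
  \sum_(p | rooted A r p.1 p.2 && (isthmus r p.1 p.2 == P)) G p.1 p.2 =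
  \sum_(e in A :\ r) \sum_(e' in A :\ r :\ e)
    \sum_(p | birooted (A :\ e) r e' p.1 p.2 && ((e' \notin porbit (p.2 * p.1)%g r) == P))
      G (tperm r e * p.1)%g (tperm e e' * p.2)%g.
Proof.
move=> rA A1.
rewrite (partition_big (fun p => p.1 r) (fun e => e \in A :\ r)) /=; last first.
  move=> p /andP[M _]; rewrite !inE (rooted_root_moves A1 M) /=.
  by case/andP: M => /leggedP[sA _ _ _ _ _] _; rewrite perm_closed.
apply: eq_bigr => e; rewrite !inE => /andP[er eA].
rewrite (partition_big (fun p => p.2 e) (fun e' => e' \in A :\ r :\ e)) /=; last first.
  move=> p /andP[/andP[M _] /eqP sr].
  have [_ N] := @deletion_fwd _ A r p.1 p.2 (rooted_root_moves A1 M) M.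
  move: N; rewrite sr => /and3P[re' /leggedP[_ _ RA _ _ _] _].
  move: RA; rewrite subUset !sub1set !inE => /andP[_ /andP[-> ->]].
  by rewrite eq_sym re'.
apply: eq_bigr => e' _.
pose h p := ((tperm r e * p.1)%g, (tperm e e' * p.2)%g).
have hK : involutive h by case=> s a; rewrite /h /= !tpermKg.
rewrite (reindex_inj (inv_inj hK)) /=; apply: eq_bigl => p.
have := deletion A e' p.1 p.2 er; rewrite eA /=.
have [N|N] := boolP (birooted _ _ _ _ _) => /=.
  case/and3P=> -> -> ->; rewrite (isthmus_deletion er N) !andbT //.
by move=> H; apply/negP=> /andP[/andP[/andP[M _] sr] se]; rewrite M sr se in H.
Qed.

Lemma insertion_sum A r e' G : e' != r -> e' \in A ->
  \sum_(p | birooted A r e' p.1 p.2 && (e' \in porbit (p.2 * p.1)%g r)) G p.1 p.2 =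
  \sum_(p | rooted (A :\ e') r p.1 p.2) \sum_(q in porbit (p.2 * p.1)%g r)
     G (tperm (p.2 q) e' * p.1)%g p.2.
Proof.
move=> e'r e'A.
(* [q] is determined as the preimage of [e'] under the face permutation. Making it a summation index
   prepares the exchange of sums. *)
transitivity (\sum_(p | birooted A r e' p.1 p.2 && (e' \in porbit (p.2 * p.1)%g r))
   \sum_(q | (p.2 * p.1)%g q == e') G p.1 p.2).
  apply: eq_bigr => p _; rewrite (big_pred1 ((p.2 * p.1)^-1 e'))%g // => q /=.
  by rewrite -(inj_eq (@perm_inj _ (p.2 * p.1)^-1)%g) permK.
rewrite (exchange_big_dep xpredT) //= [RHS](exchange_big_dep xpredT) //=.
apply: eq_bigr => q _.
pose h p := ((tperm (p.2 q) e' * p.1)%g, p.2).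
have hK : involutive h by case=> s a; rewrite /h /= !tpermKg.
rewrite (reindex_inj (inv_inj hK)) /=; apply: eq_bigl => p.
have := insertion A r e' q p.1 p.2; rewrite e'r e'A /= => H.
by rewrite -andbA H andbC.
Qed.

Lemma split_sum A r e' G : e' \in A ->
  \sum_(p | birooted A r e' p.1 p.2 && (e' \notin porbit (p.2 * p.1)%g r)) G p.1 p.2 =
  \sum_(B : {set T} | [&& B \subset A, r \in B & e' \notin B])
    \sum_(p1 | rooted B r p1.1 p1.2) \sum_(p2 | rooted (A :\: B) e' p2.1 p2.2)
      G (p1.1 * p2.1)%g (p1.2 * p2.2)%g.
Proof.
move=> e'A.
rewrite (partition_big (fun p => component p.1 p.2 r)
  (fun B : {set T} => [&& B \subset A, r \in B & e' \notin B])) /=; last first.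
  move=> p /andP[N out]; have [-> -> _ _] := split_fwd N out.
  by rewrite component_root.
apply: eq_bigr => B /and3P[BA rB e'B].
rewrite pair_big /=.
pose h (pp : ({perm T} * {perm T}) * ({perm T} * {perm T})) :=
  ((pp.1.1 * pp.2.1)%g, (pp.1.2 * pp.2.2)%g).
pose h' p := ((restr_perm B p.1, restr_perm B p.2),
              (restr_perm (~: B) p.1, restr_perm (~: B) p.2)).
rewrite (reindex_onto h h') /=; last first.
  case=> s a /andP[_ /eqP /= EB]; rewrite /h /=.
  by rewrite !restr_perm_split -?EB // => x; rewrite ?component_mem_s ?component_mem_a.
apply: eq_bigl => -[[s1 a1] [s2 a2]] /=.
apply/andP/andP => [[/andP[/andP[N out] /eqP EB] /eqP E]|[M1 M2]].
  have [_ _] := split_fwd N out; rewrite EB.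
  by move: E; rewrite /h /h' /= => -[-> -> -> ->].
have [N out EB] := split_bwd BA M1 M2.
rewrite N out EB eqxx; split=> //; rewrite /h /h' /=.
have CA : A :\: B \subset ~: B by apply/subsetP=> x; rewrite !inE => /andP[].
case/andP: M1 => /leggedP[os1 oa1 _ _ _ _] _.
case/andP: M2 => /leggedP[os2 oa2 _ _ _ _] _.
have {}os2 := subset_trans os2 CA; have {}oa2 := subset_trans oa2 CA.
by rewrite (restr_perm_mul_on os1 os2) (restr_perm_mul_on oa1 oa2)
  (restr_perm_mul_out os1 os2) (restr_perm_mul_out oa1 oa2).
Qed.

Lemma nonisthmus_sum A r G : r \in A -> (1 < #|A|)%N ->
  \sum_(p | rooted A r p.1 p.2 && ~~ isthmus r p.1 p.2) G p.1 p.2 =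
  \sum_(e in A :\ r) \sum_(e' in A :\ r :\ e) \sum_(p | rooted (A :\ e :\ e') r p.1 p.2)
     \sum_(q in porbit (p.2 * p.1)%g r)
      G (tperm r e * (tperm (p.2 q) e' * p.1))%g (tperm e e' * p.2)%g.
Proof.
move=> rA A1.
have := @deletion_sum false A r G rA A1; under eq_bigl do rewrite eqbF_neg.
move=> ->; apply: eq_bigr => e; rewrite !inE => /andP[er eA].
apply: eq_bigr => e'; rewrite !inE => /and3P[e'e e'r e'A].
under eq_bigl do rewrite eqbF_neg negbK.
by rewrite (insertion_sum (fun s a => G (tperm r e * s)%g (tperm e e' * a)%g)) // !inE e'e.
Qed.

Lemma isthmus_sum A r G : r \in A -> (1 < #|A|)%N ->
  \sum_(p | rooted A r p.1 p.2 && isthmus r p.1 p.2) G p.1 p.2 =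
  \sum_(e in A :\ r) \sum_(e' in A :\ r :\ e)
    \sum_(B : {set T} | [&& B \subset A :\ e, r \in B & e' \notin B])
      \sum_(p1 | rooted B r p1.1 p1.2) \sum_(p2 | rooted (A :\ e :\: B) e' p2.1 p2.2)
      G (tperm r e * (p1.1 * p2.1))%g (tperm e e' * (p1.2 * p2.2))%g.
Proof.
move=> rA A1.
have := @deletion_sum true A r G rA A1; under eq_bigl do rewrite eqb_id.
move=> ->; apply: eq_bigr => e; rewrite !inE => /andP[er eA].
apply: eq_bigr => e'; rewrite !inE => /and3P[e'e e'r e'A].
under eq_bigl do rewrite eqb_id.
by rewrite (split_sum r (fun s a => G (tperm r e * s)%g (tperm e e' * a)%g)) // !inE e'e.
Qed.

End Sums.

Lemma sum_porbit (V : nmodType) (T : finType) (f : {perm T}) (r : T) (g : T -> V) :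
  \sum_(z in porbit f r) g z = \sum_(i < #|porbit f r|) g ((f ^+ i)%g r).
Proof.
rewrite (eq_bigl _ _ (porbit_traject f r)) -big_uniq ?uniq_traject_porbit //=.
rewrite (big_nth r) size_traject big_mkord; apply: eq_bigr => i _.
by rewrite nth_traject // permX.
Qed.

Lemma porbit_mul_on (T : finType) (B : {set T}) (u1 u2 : {perm T}) x :
  perm_on B u1 -> perm_on (~: B) u2 -> x \in B -> porbit (u1 * u2)%g x = porbit u1 x.
Proof.
move=> o1 o2 xB.
have H i : ((u1 * u2) ^+ i)%g x = (u1 ^+ i)%g x /\ (u1 ^+ i)%g x \in B.
  elim: i => [|i [IH xi]]; first by rewrite !expg0 perm1.
  by rewrite !expgSr !permM IH (out_perm o2) ?inE ?negbK perm_closed.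
by apply/setP=> z; apply/porbitP/porbitP => -[i ->]; exists i; have [-> _] := H i.
Qed.

Lemma porbit_mul_out (T : finType) (B : {set T}) (u1 u2 : {perm T}) x :
  perm_on B u1 -> perm_on (~: B) u2 -> x \notin B -> porbit (u1 * u2)%g x = porbit u2 x.
Proof.
move=> o1 o2 xB; have -> : (u1 * u2 = u2 * u1)%g.
  by apply: (perm_onC o1 o2); rewrite disjoints_subset setCK.
by apply: (porbit_mul_on o2); rewrite ?setCK // inE.
Qed.

(** Source of the divided differences in Tutte's equation: [i] runs over the corners of the root
    face, and closing the root edge at corner [i] gives root face degree [n - i]. *)
Lemma geometric_sum_shift (R : comNzRingType) (y : R) n :
  (y - 1) * \sum_(i < n) y ^+ (n - i) = y * (y ^+ n - 1).
Proof.
rewrite subrX1 mulrCA; congr (_ * _); rewrite mulr_sumr.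
rewrite [RHS](reindex_inj rev_ord_inj) /=; apply: eq_bigr => i _.
by rewrite -exprS; congr (_ ^+ _); have := ltn_ord i; lia.
Qed.

(** * An isthmus as root edge: degrees, numbers of cycles, Potts values *)

Section SplitFacts.
Variable T : finType.
Variables (A B : {set T}) (r e e' : T) (s1 a1 s2 a2 : {perm T}).
Hypotheses (BA : B \subset A :\ e) (rB : r \in B) (e'B : e' \notin B) (er : e != r)
  (e'e : e' != e).
Hypotheses (M1 : rooted B r s1 a1) (M2 : rooted (A :\ e :\: B) e' s2 a2).
Notation c s := (#|porbits s|).
Let s' := (s1 * s2)%g.
Let a' := (a1 * a2)%g.
Let s := (tperm r e * s')%g.
Let a := (tperm e e' * a')%g.

Let CB : A :\ e :\: B \subset ~: B. Proof. by apply/subsetP=> x /[!inE] /andP[]. Qed.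
Let L1 : legged_spec B [set r] s1 a1. Proof. by case/andP: M1 => /leggedP. Qed.
Let L2 : legged_spec (A :\ e :\: B) [set e'] s2 a2. Proof. by case/andP: M2 => /leggedP. Qed.
Let os1 : perm_on B s1 := lg_s L1.
Let oa1 : perm_on B a1 := lg_a L1.
Let os2 : perm_on (~: B) s2. Proof. exact: subset_trans (lg_s L2) CB. Qed.
Let oa2 : perm_on (~: B) a2. Proof. exact: subset_trans (lg_a L2) CB. Qed.
Let eB : e \notin B. Proof. by apply/negP=> /(subsetP BA); rewrite !inE eqxx. Qed.
Let eC : e \notin A :\ e :\: B. Proof. by rewrite !inE eqxx andbF. Qed.
Let re : r != e. Proof. by rewrite eq_sym. Qed.
Let ee' : e != e'. Proof. by rewrite eq_sym. Qed.
Let re' : r != e'. Proof. by apply: contraNneq e'B => <-. Qed.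

Let s'e : s' e = e.
Proof. by rewrite permM (out_perm os1 eB) (out_perm (lg_s L2) eC). Qed.
Let a'e : a' e = e.
Proof. by rewrite permM (out_perm oa1 eB) (out_perm (lg_a L2) eC). Qed.
Let a'r : a' r = r.
Proof.
rewrite (mul_perm_on oa1 oa2 rB); apply/eqP; rewrite (lg_fix L1) ?inE //.
Qed.
Let a'e' : a' e' = e'.
Proof.
rewrite (mul_perm_out _ oa1 e'B); apply/eqP; rewrite (lg_fix L2) ?inE //.
by have := lg_R L2; rewrite sub1set !inE.
Qed.
Let N : birooted (A :\ e) r e' s' a'.
Proof. by have [] := split_bwd BA M1 M2. Qed.
Let out : e' \notin porbit (a' * s')%g r.
Proof. by have [] := split_bwd BA M1 M2. Qed.

Lemma split_root : s r = e. Proof. by rewrite permM tpermL. Qed.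
Lemma split_edge : a e = e'. Proof. by rewrite permM tpermL. Qed.

Lemma split_face : (a * s)%g = (tperm r e * (tperm r e' * (a' * s')))%g.
Proof. exact: face_of_deletion. Qed.

Lemma split_card_vertex : #|porbit s r| = #|porbit s1 r|.+1.
Proof. by rewrite card_porbit_insert // (porbit_mul_on os1 os2). Qed.

Lemma split_card_face :
  #|porbit (a * s)%g r| = (#|porbit (a1 * s1)%g r| + #|porbit (a2 * s2)%g e'|).+1.
Proof.
rewrite split_face card_porbit_insert //; last by rewrite permM tpermD // 1?eq_sym // permM a'e.
rewrite card_porbit_merge // (face_disjoint os1 oa1 os2 oa2).
by rewrite (porbit_mul_on (perm_onM oa1 os1) (perm_onM oa2 os2) rB)
  (porbit_mul_out (perm_onM oa1 os1) (perm_onM oa2 os2) e'B).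
Qed.

Lemma split_vertices : ((c s).+1 + #|T| = c s1 + c s2)%N.
Proof.
rewrite (card_porbits_disjoint os1 os2); congr (_ + _)%N.
exact: card_porbits_insert.
Qed.

Lemma split_faces : ((c (a * s)%g).+2 + #|T| = c (a1 * s1)%g + c (a2 * s2)%g)%N.
Proof.
rewrite (card_porbits_disjoint (perm_onM oa1 os1) (perm_onM oa2 os2)).
rewrite -(face_disjoint os1 oa1 os2 oa2) -/a' -/s'; congr (_ + _)%N.
rewrite -(card_porbits_merge out) split_face; congr (_.+1).
apply: card_porbits_insert => //.
by rewrite permM tpermD // 1?eq_sym // permM a'e.
Qed.

Lemma split_shape :
  [/\ s r = e, a e = e', #|porbit s r| = #|porbit s1 r|.+1 &
      #|porbit (a * s)%g r| = (#|porbit (a1 * s1)%g r| + #|porbit (a2 * s2)%g e'|).+1] /\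
  ((c s).+1 + #|T| = c s1 + c s2)%N /\
  ((c (a * s)%g).+2 + #|T| = c (a1 * s1)%g + c (a2 * s2)%g)%N.
Proof.
split; last by split; [apply: split_vertices|apply: split_faces].
by split; [exact: split_root|exact: split_edge|exact: split_card_vertex|exact: split_card_face].
Qed.

Section Pot.
Variables (F : fieldType) (nu q : F).
Hypothesis ch0 : forall n, n.+1%:R != 0 :> F.

Let a'K x : a' (a' x) = x.
Proof. by case/and3P: N => _ /leggedP[]. Qed.

Lemma split_potts1 : pottsval nu q s a' * q ^+ #|T|.+1 = pottsval nu q s1 a1 * pottsval nu q s2 a2.
Proof.
rewrite (potts_disjoint nu q ch0 (lg_aK L1) (lg_aK L2) a'K os1 oa1 os2 oa2) exprS mulrA.
by congr (_ * _); rewrite mulrC; apply: potts_insert.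
Qed.

Lemma potts_merge2 (u1 u2 : {perm T}) : perm_on B u1 -> perm_on (~: B) u2 ->
  u1 e = e -> u2 e = e ->
  pottsval nu q (tperm r e * (tperm r e' * (u1 * u2)))%g a' * q ^+ #|T|.+2 =
  pottsval nu q u1 a1 * pottsval nu q u2 a2.
Proof.
move=> o1 o2 u1e u2e.
rewrite (potts_disjoint nu q ch0 (lg_aK L1) (lg_aK L2) a'K o1 oa1 o2 oa2) !exprS !mulrA.
congr (_ * _).
rewrite -(potts_merge nu q ch0 a'K (B := B) (r := r) (e := e') (s := (u1 * u2)%g)) //; first last.
- by move=> x; apply: mul_perm_mem.
- by move=> x; apply: mul_perm_mem.
have fe : (tperm r e' * (u1 * u2))%g e = e by rewrite !permM tpermD // 1?eq_sym // u1e.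
by rewrite -(potts_insert nu q ch0 a'K fe a'e re) mulrC mulrA [_ * q]mulrC mulrA.
Qed.

Let s1e : s1 e = e. Proof. exact: out_perm os1 eB. Qed.
Let a1e : a1 e = e. Proof. exact: out_perm oa1 eB. Qed.
Let s2e : s2 e = e. Proof. exact: out_perm (lg_s L2) eC. Qed.
Let a2e : a2 e = e. Proof. exact: out_perm (lg_a L2) eC. Qed.

Lemma split_potts_face : pottsval nu q (a * s)%g a' * q ^+ #|T|.+2 =
  pottsval nu q (a1 * s1)%g a1 * pottsval nu q (a2 * s2)%g a2.
Proof.
rewrite split_face (face_disjoint os1 oa1 os2 oa2) potts_merge2 //; try exact: perm_onM.
  by rewrite permM a1e.
by rewrite permM a2e.
Qed.

(** Contracting the isthmus glues the vertex of [e'] to the root vertex, where [e] remains as a dart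
    without edge. Gluing and inserting [e] cost one factor [q] each, in addition to [#|T|] factors
    for the disjoint product. *)
Lemma split_contr : contr e e' s = (tperm r e * (tperm r e' * s'))%g.
Proof.
have nin : e' \notin porbit s e.
  have -> : porbit s e = porbit s r by apply/porbit_eqP; rewrite -split_root porbit_step.
  rewrite porbit_tperm_insert // !inE (negbTE e'e) /= (porbit_mul_on os1 os2) //.
  by apply: contra e'B; apply: (subsetP (porbit_sub rB _)) => y; rewrite perm_closed.
rewrite /contr (negbTE nin) /s !mulgA; congr (_ * _)%g.
have := conjgC (tperm e e') (tperm r e); by rewrite tpermJ tpermR tpermD // => ->.
Qed.

Lemma split_potts_contr : pottsval nu q (contr e e' s) a' * q ^+ #|T|.+2 =
  pottsval nu q s1 a1 * pottsval nu q s2 a2.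
Proof. by rewrite split_contr potts_merge2. Qed.

End Pot.
End SplitFacts.

(** * A root edge that is not an isthmus *)

Section InsertFacts.
Variable T : finType.
Variables (A : {set T}) (r e e' k : T) (s a : {perm T}).
Hypotheses (eA : e \in A :\ r) (e'A : e' \in A :\ r :\ e).
Hypotheses (M : rooted (A :\ e :\ e') r s a) (kr : k \in porbit (a * s)%g r).
Notation c s := (#|porbits s|).
Let s' := (tperm (a k) e' * s)%g.
Let s0 := (tperm r e * s')%g.
Let a0 := (tperm e e' * a)%g.
Let f := (a * s)%g.

Let re : r != e. Proof. by move: eA; rewrite !inE eq_sym => /andP[]. Qed.
Let re' : r != e'. Proof. by move: e'A; rewrite !inE [r == _]eq_sym => /and3P[]. Qed.
Let ee' : e != e'. Proof. by move: e'A; rewrite !inE eq_sym => /and3P[]. Qed.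
Let e'A' : e' \in A :\ e. Proof. by move: e'A; rewrite !inE => /and3P[-> _ ->]. Qed.
Let L : legged_spec (A :\ e :\ e') [set r] s a. Proof. by case/andP: M => /leggedP. Qed.
Let se : s e = e. Proof. by apply: (out_perm (lg_s L)); rewrite !inE eqxx andbF. Qed.
Let ae : a e = e. Proof. by apply: (out_perm (lg_a L)); rewrite !inE eqxx andbF. Qed.
Let se' : s e' = e'. Proof. by apply: (out_perm (lg_s L)); rewrite !inE eqxx. Qed.
Let ae' : a e' = e'. Proof. by apply: (out_perm (lg_a L)); rewrite !inE eqxx. Qed.
Let fe : f e = e. Proof. by rewrite permM ae. Qed.
Let fe' : f e' = e'. Proof. by rewrite permM ae'. Qed.
Let ar : a r = r.
Proof. by apply/eqP; rewrite (lg_fix L) ?inE //; have := lg_R L; rewrite sub1set !inE. Qed.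
Let kA : k \in A :\ e :\ e'.
Proof.
apply: (subsetP (porbit_sub _ _)) kr; first by have := lg_R L; rewrite sub1set.
by move=> y yA; rewrite permM !perm_closed ?(lg_s L) ?(lg_a L).
Qed.
Let ke : k != e. Proof. by move: kA; rewrite !inE => /and3P[]. Qed.
Let ke' : k != e'. Proof. by move: kA; rewrite !inE => /and3P[]. Qed.
Let ake' : a k != e'. Proof. by rewrite (perm_fix_eq _ ae'). Qed.
Let ake : a k != e. Proof. by rewrite (perm_fix_eq _ ae). Qed.
Let N : birooted (A :\ e) r e' s' a.
Proof. by have [] := insertion_bwd _ e'A' kr M; rewrite // eq_sym. Qed.
Let e'r : e' \in porbit (a * s')%g r.
Proof. by have [] := insertion_bwd _ e'A' kr M; rewrite // eq_sym. Qed.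
Let s'e : s' e = e.
Proof. by rewrite permM tpermD // 1?eq_sym //. Qed.
Let Ef : (a * s')%g = (tperm k e' * f)%g.
Proof. exact: face_of_insertion. Qed.

Let e's : e' \notin porbit s r.
Proof. by rewrite porbit_sym (porbit_fix se') inE. Qed.

Lemma insert_root : s0 r = e. Proof. by rewrite permM tpermL. Qed.
Lemma insert_edge : a0 e = e'. Proof. by rewrite permM tpermL. Qed.

Lemma insert_face : (a0 * s0)%g = (tperm r e * (tperm r e' * (a * s')))%g.
Proof. exact: face_of_deletion. Qed.

Lemma insert_loop : loop r s0 a0 = (a k \in porbit s r).
Proof.
rewrite /loop insert_root insert_edge porbit_tperm_insert // !inE eq_sym (negbTE ee') /=.
have [inn|out] := boolP (a k \in porbit s r).
  have /porbit_eqP -> : r \in porbit s' (a k).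
    by rewrite porbit_tperm_insert // !inE porbit_sym inn orbT.
  by rewrite porbit_tperm_insert // !inE eqxx.
by rewrite porbit_tperm_other // (negbTE e's).
Qed.

Lemma insert_card_vertex : #|porbit s0 r| = (#|porbit s r| + (a k \in porbit s r)).+1.
Proof.
rewrite card_porbit_insert //; congr (_.+1).
have [inn|out] := boolP (a k \in porbit s r); last first.
  by rewrite porbit_tperm_other ?addn0.
rewrite addn1.
have /porbit_eqP -> : r \in porbit s' (a k).
  by rewrite porbit_tperm_insert // !inE porbit_sym inn orbT.
rewrite card_porbit_insert //; congr (#|pred_of_set _|.+1).
by apply/porbit_eqP.
Qed.

Lemma insert_vertices : (c s0).+2 = c s.
Proof.
by rewrite !card_porbits_insert.
Qed.

Lemma insert_faces : (c (a0 * s0)%g).+1 = c f.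
Proof.
have f'e : (tperm r e' * (a * s'))%g e = e by rewrite permM tpermD // 1?eq_sym // permM ae.
by rewrite insert_face card_porbits_insert // card_porbits_split // Ef card_porbits_insert.
Qed.

Lemma insert_card_face i : (i < #|porbit f r|)%N -> k = (f ^+ i)%g r ->
  #|porbit (a0 * s0)%g r| = (#|porbit f r| - i).+1.
Proof.
move=> li ki; rewrite insert_face Ef.
have [kr'|nkr] := eqVneq k r.
  rewrite kr' tpermKg card_porbit_insert //.
  have -> : i = 0%N; last by rewrite subn0.
  have L0 : (0 < #|porbit f r|)%N by apply: leq_ltn_trans li.
  apply/eqP; rewrite -(nth_uniq r _ _ (uniq_traject_porbit f r)) ?size_traject //.
  by rewrite !nth_traject // -permX -ki kr' /=.
(* For [k] other than [r], conjugation turns the cut between [r] and [e'] into a cut between [r] and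
   [k], two points of one cycle of [f], where [card_porbit_split] applies. *)
have E : (tperm r e' * tperm k e' = tperm k e' * tperm r k)%g.
  have := conjgC (tperm r e') (tperm k e').
  by rewrite tpermJ tpermR (tpermD nkr _) // eq_sym.
set f0 := (tperm r k * f)%g.
have f0e' : f0 e' = e' by rewrite permM tpermD // 1?eq_sym // eq_sym.
have f1e : (tperm k e' * f0)%g e = e.
  by rewrite permM (tpermD ke) 1?eq_sym // permM (tpermD re ke).
rewrite [(tperm r e' * _)%g]mulgA E -mulgA card_porbit_insert //; congr (_.+1).
rewrite porbit_tperm_other //.
- rewrite /f0 {1}ki card_porbit_split // li andbT lt0n.
  by apply: contra nkr => /eqP i0; rewrite ki i0 expg0 perm1.
- by apply: tperm_split_out; rewrite // eq_sym.
- by rewrite porbit_sym (porbit_fix f0e') inE.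
Qed.

Lemma insert_shape :
  [/\ s0 r = e, a0 e = e', loop r s0 a0 = (a k \in porbit s r) &
      #|porbit s0 r| = (#|porbit s r| + (a k \in porbit s r)).+1] /\
  (c s0).+2 = c s /\ (c (a0 * s0)%g).+1 = c f.
Proof.
split; last by split; [apply: insert_vertices|apply: insert_faces].
by split; [exact: insert_root|exact: insert_edge|exact: insert_loop|exact: insert_card_vertex].
Qed.

Section Pot.
Variables (F : fieldType) (nu q : F).
Hypothesis ch0 : forall n, n.+1%:R != 0 :> F.

Lemma potts_insert2 (u : {perm T}) y : u e = e -> u e' = e' -> y != e' -> y != e ->
  pottsval nu q (tperm r e * (tperm y e' * u))%g a * q ^+ 2 = pottsval nu q u a.
Proof.
move=> ue ue' ye' ye.
have H := @potts_insert _ nu q ch0 T _ a _ _ (lg_aK L).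
rewrite mulrC expr2 -mulrA H // ?H //.
by rewrite permM tpermD // 1?eq_sym.
Qed.

Lemma insert_potts : pottsval nu q s0 a * q ^+ 2 = pottsval nu q s a.
Proof. exact: potts_insert2. Qed.

(** The transposition of [e] and [e'] used for contracting cancels the one that cut the root face.
    What remains are the cycles of [f] with [e] and [e'] inserted: contraction in the dual undoes
    the edge as deletion does in the map. *)
Lemma insert_contr : contr e e' (a0 * s0)%g = (tperm r e * (tperm k e' * f))%g.
Proof.
have nin : e' \notin porbit (a0 * s0)%g e.
  have er : e \in porbit (a0 * s0)%g r.
    rewrite -[X in X \in _](_ : (a0 * s0)%g r = e) ?porbit_step //.
    by rewrite permM /a0 [(tperm e e' * a)%g r]permM tpermD 1?eq_sym // ar insert_root.
  rewrite (porbit_eqP _ _ _ er) insert_face porbit_tperm_insert //; last first.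
    by rewrite permM tpermD // 1?eq_sym // permM ae.
  by rewrite !inE eq_sym (negbTE ee') /= tperm_split_out.
rewrite /contr (negbTE nin) insert_face -Ef mulgA.
have -> : (tperm e e' * tperm r e = tperm r e * tperm r e')%g.
  by have := conjgC (tperm e e') (tperm r e); rewrite tpermJ tpermR tpermD // => ->.
by rewrite -mulgA tpermKg.
Qed.

Lemma insert_potts_contr :
  pottsval nu q (contr e e' (a0 * s0)%g) a * q ^+ 2 = pottsval nu q f a.
Proof. by rewrite insert_contr; apply: potts_insert2. Qed.
End Pot.
End InsertFacts.

Lemma sum_sets_between (V : nmodType) (T : finType) (A : {set T}) (r : T) (g : nat -> V) :
  r \in A ->
  \sum_(B : {set T} | (B \subset A) && (r \in B)) g #|B| =
  \sum_(k < #|A|) g k.+1 *+ 'C(#|A|.-1, k).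
Proof.
move=> rA.
rewrite (reindex_onto (fun D => r |: D) (fun B => B :\ r)) /=; last first.
  by move=> B /andP[_ rB]; rewrite setD1K.
have cA : #|A| = #|A :\ r|.+1 by rewrite (cardsD1 r) rA.
rewrite cA /= (eq_bigl (fun D : {set T} => D \subset A :\ r)); last first.
  move=> D; rewrite subUset sub1set rA !inE eqxx /= andbT subsetD1.
  congr (_ && _); apply/eqP/idP => [<-|rD]; first by rewrite !inE eqxx.
  by rewrite setU1K.
rewrite (partition_big (fun D : {set T} => inord #|D| : 'I_#|A :\ r|.+1) predT) //=.
apply: eq_bigr => k _.
have H (D : {set T}) : D \subset A :\ r -> (inord #|D| == k) = (#|D| == k).
  by move/subset_leq_card => le; rewrite -val_eqE /= inordK // ltnS.
transitivity (\sum_(D : {set T} | (D \subset A :\ r) && (#|D| == k)) g k.+1).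
  apply: eq_big => D; first by case: (boolP (D \subset _)) => //= /H.
  case/andP=> sD; rewrite H // => /eqP <-; congr g; rewrite cardsU1.
  by have := subsetP sD r; rewrite !inE eqxx; case: (r \in D) => // /(_ isT).
rewrite sumr_const -cards_draws; congr (_ *+ _).
by apply: eq_card => D; rewrite !inE.
Qed.

Lemma addn_pred m n : (0 < m)%N -> (0 < n)%N -> (m + n = 2 + (m.-1 + n.-1))%N.
Proof. by case: m n => [|m] [|n] //= _ _; rewrite addSn addnS. Qed.

Lemma addn_pred1 m n : (0 < m)%N -> (0 < n)%N -> ((m + n).-1 = (m.-1 + n.-1).+1)%N.
Proof. by move=> m0 n0; rewrite (addn_pred m0 n0). Qed.

(** * The recursion for sums over labelled maps *)

Section Recursion.
Variables (F : fieldType) (nu q w : F).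
Hypothesis ch0 : forall n, n.+1%:R != 0 :> F.
Hypotheses (q0 : q != 0) (w0 : w != 0).
Variable T : finType.
Implicit Types (s a : {perm T}) (r e : T) (A B D R : {set T}).
Implicit Types (p : {perm T} * {perm T}).
Notation c s := (#|porbits s|).
Notation pot := (pottsval nu q).

(* The leg r is not counted in the degrees. *)
Definition mapwt (x y : F) r s a : F :=
  x ^+ #|porbit s r|.-1 * y ^+ #|porbit (a * s)%g r|.-1 * w ^+ c s * pot s a.

Definition mapsum x y A r : F := \sum_(p | rooted A r p.1 p.2) mapwt x y r p.1 p.2.

(** The quadratic term of the recursion. The second piece has its leg at [e'] and separate
    parameters, because one of its two root degrees is not counted in the whole map. *)
Definition mapsum_pairs x y x' y' A r : F :=
  \sum_(e in A :\ r) \sum_(e' in A :\ r :\ e)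
    \sum_(B : {set T} | [&& B \subset A :\ e, r \in B & e' \notin B])
      mapsum x y B r * mapsum x' y' (A :\ e :\: B) e'.

Section OneSet.
Variables (A : {set T}) (r : T).
Hypotheses (rA : r \in A) (A1 : (1 < #|A|)%N).

(** Only the involution changes: the two darts stay at their vertices as fixed points, which the
    Potts value does not see. *)
Definition cut s a := (tperm (s r) (a (s r)) * a)%g.
Definition ctr s a := contr (s r) (a (s r)) s.

Lemma mapsum_edge x y : mapsum x y A r =
  \sum_(p | rooted A r p.1 p.2) x ^+ #|porbit p.1 r|.-1 * y ^+ #|porbit (p.2 * p.1)%g r|.-1 *
    w ^+ c p.1 * pot p.1 (cut p.1 p.2) +
  (nu - 1) * \sum_(p | rooted A r p.1 p.2)
    x ^+ #|porbit p.1 r|.-1 * y ^+ #|porbit (p.2 * p.1)%g r|.-1 *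
    w ^+ c p.1 * pot (ctr p.1 p.2) (cut p.1 p.2).
Proof.
rewrite mulr_sumr -big_split; apply: eq_bigr => -[s a] /= M; rewrite /mapwt.
have sr := rooted_root_moves A1 M.
case/andP: (M) => /leggedP[sA aA RA aK af _] _.
rewrite (potts_edge nu q ch0 s aK (e := s r) (e' := a (s r))) //; last first.
  have srA : s r \in A by rewrite perm_closed.
  by rewrite eq_sym (af _ srA) inE.
by rewrite mulrDr; congr (_ + _); rewrite mulrCA.
Qed.

Lemma rooted_involution s a : rooted A r s a -> (forall x, a (a x) = x) /\ a r = r.
Proof.
case/andP=> /leggedP[_ _ _ aK af _] _; split=> //.
by apply/eqP; rewrite af // inE.
Qed.

Lemma dual_sum_cond (P Q : T -> {perm T} -> {perm T} -> bool) (G : {perm T} -> {perm T} -> F) :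
  (forall s a, (forall x, a (a x) = x) -> a r = r -> P r (a * s)%g a = Q r s a) ->
  \sum_(p | rooted A r p.1 p.2 && P r p.1 p.2) G p.1 p.2 =
  \sum_(p | rooted A r p.1 p.2 && Q r p.1 p.2) G (p.2 * p.1)%g p.2.
Proof.
move=> PQ; rewrite big_mkcondr [RHS]big_mkcondr /=.
rewrite (dual_sum A r (fun s a => if P r s a then G s a else 0)).
apply: eq_bigr => p M; have [aK ar] := rooted_involution M.
by rewrite PQ.
Qed.

(** Deleting an isthmus separates [e'] from the component of [r], whereas a loop has [e'] at the
    vertex of [r]. *)
Lemma loop_not_isthmus s a : rooted A r s a -> loop r s a -> ~~ isthmus r s a.
Proof.
move=> M lp; have sr := rooted_root_moves A1 M.
have [eA N] := deletion_fwd sr M.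
set e := s r in sr eA N *; set e' := a e in N.
have I := isthmus_deletion sr N; rewrite !tpermKg in I; rewrite I negbK.
apply: contraLR lp => out; have [_ nB _ _] := split_fwd N out.
rewrite /loop -/e -/e'.
have se : (tperm r e * s)%g e = e by rewrite permM tpermR.
rewrite -(tpermKg r e s) porbit_tperm_insert // 1?eq_sym // !inE.
have -> /= : (e' == e) = false.
  case/and3P: N => _ /leggedP[_ _ /[!subUset] /andP[_]]; rewrite sub1set !inE.
  by case/andP=> /negbTE.
apply: contra nB; apply: (subsetP (porbit_sub (component_root _ _ _) _)) => y.
by rewrite component_mem_s.
Qed.

(** Reduces the evaluations over isthmuses to pointwise identities. With [k] true the pieces are
    read on their duals, which leaves [mapsum] unchanged; the factor [u] avoids dividing by powers
    of [w] and [q]. *)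
Lemma isthmus_eval x y x' y' k (G : {perm T} -> {perm T} -> F) (u v : F) :
  (forall e e' B s1 a1 s2 a2, B \subset A :\ e -> r \in B -> e' \notin B -> e != r -> e' != e ->
    rooted B r s1 a1 -> rooted (A :\ e :\: B) e' s2 a2 ->
    G (tperm r e * (s1 * s2))%g (tperm e e' * (a1 * a2))%g * u =
    v * mapwt x y r (if k then (a1 * s1)%g else s1) a1 *
      mapwt x' y' e' (if k then (a2 * s2)%g else s2) a2) ->
  (\sum_(p | rooted A r p.1 p.2 && isthmus r p.1 p.2) G p.1 p.2) * u =
  v * mapsum_pairs x y x' y' A r.
Proof.
move=> H; rewrite isthmus_sum // /mapsum_pairs mulr_suml mulr_sumr; apply: eq_bigr => e /[!inE] /andP[er eA].
rewrite mulr_suml mulr_sumr; apply: eq_bigr => e' /[!inE] /and3P[e'e e'r e'A].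
rewrite mulr_suml mulr_sumr; apply: eq_bigr => B /and3P[BA rB e'B].
pose V x y r s a := mapwt x y r (if k then (a * s)%g else s) a.
have ms z z' C t : mapsum z z' C t = \sum_(p | rooted C t p.1 p.2) V z z' t p.1 p.2.
  by rewrite /mapsum /V; case: (k) => //; rewrite (dual_sum C t (mapwt z z' t)).
rewrite !ms big_distrlr /= mulr_suml mulr_sumr; apply: eq_bigr => p1 M1.
by rewrite mulr_suml mulr_sumr; apply: eq_bigr => p2 M2; rewrite (H _ _ _ _ _ _ _ BA rB e'B er e'e M1 M2) mulrA.
Qed.

Lemma isthmus_del x y :
  (\sum_(p | rooted A r p.1 p.2 && isthmus r p.1 p.2)
    x ^+ #|porbit p.1 r|.-1 * y ^+ #|porbit (p.2 * p.1)%g r|.-1 *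
    w ^+ c p.1 * pot p.1 (cut p.1 p.2)) * (w * q) ^+ #|T|.+1 =
  (x * y ^+ 2) * mapsum_pairs x y 1 y A r.
Proof.
apply: (isthmus_eval (k := false) (G := fun s a => x ^+ #|porbit s r|.-1 *
  y ^+ #|porbit (a * s)%g r|.-1 * w ^+ c s * pot s (cut s a))).
move=> e e' B s1 a1 s2 a2 BA rB e'B er e'e M1 M2.
have P := split_potts1 BA er M1 M2 nu q ch0.
have [[R E X Y] [V _]] := split_shape BA rB e'B er e'e M1 M2.
rewrite /cut R E tpermKg X Y /mapwt /= expr1n.
have V' : w ^+ c (tperm r e * (s1 * s2))%g * w ^+ #|T|.+1 = w ^+ c s1 * w ^+ c s2.
  by rewrite -!exprD addnS -addSn V.
rewrite exprMn.
rewrite (addn_pred (card_porbit_gt0 _ _) (card_porbit_gt0 _ _)) -{1}(prednK (card_porbit_gt0 s1 r)) exprS 2!exprD.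
move: (_ ^+ #|porbit s1 r|.-1) (_ ^+ #|porbit (a1 * s1)%g r|.-1) => X1 Y1.
move: (_ ^+ #|porbit (a2 * s2)%g e'|.-1) => Y2.
move: (pot _ (a1 * a2)%g) (pot s1 a1) (pot s2 a2) P => P0 P1 P2 P.
move: (w ^+ c (tperm r e * (s1 * s2))%g) (w ^+ c s1) (w ^+ c s2) (w ^+ #|T|.+1) V' => W0 W1 W2 W V'.
move: (q ^+ #|T|.+1) P => Q P.
transitivity (x * X1 * (y ^+ 2 * (Y1 * Y2)) * (W0 * W) * (P0 * Q)); first by ring.
by rewrite V' P; ring.
Qed.

Lemma rooted_dualK B t s a : rooted B t s a -> (a * (a * s) = s)%g.
Proof.
by case/andP=> /leggedP[_ _ _ aK _ _] _; rewrite mulgA (perm_involution aK) mul1g.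
Qed.

(** An isthmus of the dual is a loop of the map and counts twice in the degree of the root vertex;
    the exponent [.-2] leaves out the leg and one end of the loop. *)
Lemma isthmus_face_pred x y :
  (\sum_(p | rooted A r p.1 p.2 && isthmus r p.1 p.2)
    x ^+ #|porbit (p.2 * p.1)%g r|.-2 * y ^+ #|porbit p.1 r|.-1 *
    w ^+ c (p.2 * p.1)%g * pot (p.2 * p.1)%g (cut p.1 p.2)) * (w * q) ^+ #|T|.+2 =
  (x * y) * mapsum_pairs x y x 1 A r.
Proof.
apply: (isthmus_eval (k := true) (G := fun s a => x ^+ #|porbit (a * s)%g r|.-2 *
  y ^+ #|porbit s r|.-1 * w ^+ c (a * s)%g * pot (a * s)%g (cut s a))).
move=> e e' B s1 a1 s2 a2 BA rB e'B er e'e M1 M2.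
have P := split_potts_face BA rB e'B er e'e M1 M2 nu q ch0.
have [[R E X Y] [_ V]] := split_shape BA rB e'B er e'e M1 M2.
rewrite /cut R E tpermKg X Y /mapwt /= expr1n (rooted_dualK M1).
set f := (_ * (tperm r e * _))%g in V P *.
have V' : w ^+ c f * w ^+ #|T|.+2 = w ^+ c (a1 * s1)%g * w ^+ c (a2 * s2)%g.
  by rewrite -!exprD !addnS -!addSn V.
rewrite exprMn.
rewrite (addn_pred1 (card_porbit_gt0 _ _) (card_porbit_gt0 _ _)) -{1}(prednK (card_porbit_gt0 s1 r)) /= !exprS exprD.
move: (_ ^+ #|porbit s1 r|.-1) (_ ^+ #|porbit (a1 * s1)%g r|.-1) => X1 Y1.
move: (_ ^+ #|porbit (a2 * s2)%g e'|.-1) => Y2.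
move: (pot _ (a1 * a2)%g) (pot (a1 * s1)%g a1) (pot (a2 * s2)%g a2) P => P0 P1 P2 P.
rewrite -!exprS.
move: (w ^+ c f) (w ^+ c (a1 * s1)%g) (w ^+ c (a2 * s2)%g) (w ^+ #|T|.+2) V' => W0 W1 W2 W V'.
move: (q ^+ #|T|.+2) P => Q P.
transitivity (x * (Y1 * Y2) * (y * X1) * (W0 * W) * (P0 * Q)); first by ring.
by rewrite V' P; ring.
Qed.

Lemma rooted_card_vertex s a : rooted A r s a -> (0 < #|porbit s r|.-1)%N.
Proof.
move=> M; have sr := rooted_root_moves A1 M.
rewrite (cardsD1 r (porbit s r)) porbit_id /=; apply/card_gt0P; exists (s r).
by rewrite !inE sr porbit_step.
Qed.

Lemma isthmus_face x y :
  (\sum_(p | rooted A r p.1 p.2 && isthmus r p.1 p.2)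
    x ^+ #|porbit (p.2 * p.1)%g r|.-1 * y ^+ #|porbit p.1 r|.-1 *
    w ^+ c (p.2 * p.1)%g * pot (p.2 * p.1)%g (cut p.1 p.2)) * (w * q) ^+ #|T|.+2 =
  (x ^+ 2 * y) * mapsum_pairs x y x 1 A r.
Proof.
transitivity (x * ((\sum_(p | rooted A r p.1 p.2 && isthmus r p.1 p.2)
    x ^+ #|porbit (p.2 * p.1)%g r|.-2 * y ^+ #|porbit p.1 r|.-1 *
    w ^+ c (p.2 * p.1)%g * pot (p.2 * p.1)%g (cut p.1 p.2)) * (w * q) ^+ #|T|.+2)); last first.
  by rewrite isthmus_face_pred expr2 !mulrA.
rewrite mulrA mulr_sumr; congr (_ * _); apply: eq_bigr => -[s a] /= /andP[M _].
by rewrite -{1}(prednK (rooted_card_vertex (etrans (rooted_dual A r s a) M))) exprS !mulrA.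
Qed.

Lemma isthmus_ctr_pred x y :
  (\sum_(p | rooted A r p.1 p.2 && isthmus r p.1 p.2)
    x ^+ #|porbit p.1 r|.-1 * y ^+ #|porbit (p.2 * p.1)%g r|.-2 *
    w ^+ c p.1 * pot (ctr p.1 p.2) (cut p.1 p.2)) * (w ^+ #|T|.+1 * q ^+ #|T|.+2) =
  (x * y) * mapsum_pairs x y 1 y A r.
Proof.
apply: (isthmus_eval (k := false) (G := fun s a => x ^+ #|porbit s r|.-1 *
  y ^+ #|porbit (a * s)%g r|.-2 * w ^+ c s * pot (ctr s a) (cut s a))).
move=> e e' B s1 a1 s2 a2 BA rB e'B er e'e M1 M2.
have P := split_potts_contr BA rB e'B er e'e M1 M2 nu q ch0.
have [[R E X Y] [V _]] := split_shape BA rB e'B er e'e M1 M2.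
rewrite /cut /ctr R E tpermKg X Y /mapwt /= expr1n.
have V' : w ^+ c (tperm r e * (s1 * s2))%g * w ^+ #|T|.+1 = w ^+ c s1 * w ^+ c s2.
  by rewrite -!exprD addnS -addSn V.
rewrite (addn_pred1 (card_porbit_gt0 _ _) (card_porbit_gt0 _ _)) -{1}(prednK (card_porbit_gt0 s1 r))
  (exprS x) (exprS y) (exprD y).
move: (_ ^+ #|porbit s1 r|.-1) (_ ^+ #|porbit (a1 * s1)%g r|.-1) => X1 Y1.
move: (_ ^+ #|porbit (a2 * s2)%g e'|.-1) => Y2.
move: (pot _ (a1 * a2)%g) (pot s1 a1) (pot s2 a2) P => P0 P1 P2 P.
move: (w ^+ c (tperm r e * (s1 * s2))%g) (w ^+ c s1) (w ^+ c s2) (w ^+ #|T|.+1) V' => W0 W1 W2 W V'.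
move: (q ^+ #|T|.+2) P => Q P.
transitivity (x * X1 * (y * (Y1 * Y2)) * (W0 * W) * (P0 * Q)); first by ring.
by rewrite V' P; ring.
Qed.

Lemma sum_face_pos x f (g : F) : (x - 1) *
    (\sum_(i < #|porbit f r|) g * x ^+ (#|porbit f r| - i)) =
  g * x * (x * x ^+ #|porbit (f : {perm T}) r|.-1 - 1).
Proof.
rewrite -mulr_sumr mulrCA geometric_sum_shift -exprS prednK ?mulrA //.
exact: card_porbit_gt0.
Qed.

Lemma nonisthmus_del x y : (y - 1) *
  (\sum_(p | rooted A r p.1 p.2 && ~~ isthmus r p.1 p.2)
    x ^+ (#|porbit p.1 r|.-1 - loop r p.1 p.2) * y ^+ #|porbit (p.2 * p.1)%g r|.-1 *
    w ^+ c p.1 * pot p.1 (cut p.1 p.2)) * (w * q) ^+ 2 =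
  (x * y) * \sum_(e in A :\ r) \sum_(e' in A :\ r :\ e)
    (y * mapsum x y (A :\ e :\ e') r - mapsum x 1 (A :\ e :\ e') r).
Proof.
rewrite (nonisthmus_sum (fun s a => x ^+ (#|porbit s r|.-1 - loop r s a) *
   y ^+ #|porbit (a * s)%g r|.-1 * w ^+ c s * pot s (cut s a)) rA A1).
rewrite [LHS]mulrAC [LHS]mulr_sumr [RHS]mulr_sumr; apply: eq_bigr => e eA.
rewrite [LHS]mulr_sumr [RHS]mulr_sumr; apply: eq_bigr => e' e'A.
rewrite [y * mapsum _ _ _ _]mulr_sumr -sumrB [LHS]mulr_sumr [RHS]mulr_sumr.
apply: eq_bigr => -[s a] /= M.
pose g := x ^+ #|porbit s r| * w ^+ c s * pot s a.
(* The correction by [loop] in the exponent of [x] cancels the second end of a root loop, so the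
   summand depends on the corner [i] only through the face degree. *)
transitivity ((y - 1) * \sum_(i < #|porbit (a * s)%g r|) g * y ^+ (#|porbit (a * s)%g r| - i)).
  rewrite -mulrA; congr (_ * _); rewrite sum_porbit mulr_sumr; apply: eq_bigr => i _.
  set k := ((a * s) ^+ i)%g r.
  have kr : k \in porbit (a * s)%g r by apply: mem_porbit.
  have [[R E L X] [V _]] := insert_shape eA e'A M kr.
  have P := insert_potts eA e'A M kr nu q ch0.
  have Y := insert_card_face eA e'A M kr (ltn_ord i) erefl.
  rewrite L X Y /cut R E tpermKg /= addnK /g -P -V !exprS expr0.
  set P0 := pot _ _; set W0 := w ^+ _; set X0 := x ^+ _; set Y0 := y ^+ _; ring.
rewrite sum_face_pos /mapwt /g expr1n.
rewrite -[in x ^+ #|porbit s r|](prednK (card_porbit_gt0 s r)) exprS.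
set P0 := pot _ _; set W0 := w ^+ _; set X0 := x ^+ _; set Y0 := y ^+ _; ring.
Qed.

Lemma nonisthmus_ctr x y : (x - 1) *
  (\sum_(p | rooted A r p.1 p.2 && ~~ isthmus r p.1 p.2)
    x ^+ #|porbit (p.2 * p.1)%g r|.-1 * y ^+ (#|porbit p.1 r|.-1 - loop r p.1 p.2) *
    w ^+ c (p.2 * p.1)%g * pot (contr (p.1 r) (p.2 (p.1 r)) (p.2 * p.1)%g) (cut p.1 p.2)) *
   (w * q ^+ 2) =
  (x * y) * \sum_(e in A :\ r) \sum_(e' in A :\ r :\ e)
    (x * mapsum x y (A :\ e :\ e') r - mapsum 1 y (A :\ e :\ e') r).
Proof.
rewrite (nonisthmus_sum (fun s a => x ^+ #|porbit (a * s)%g r|.-1 *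
   y ^+ (#|porbit s r|.-1 - loop r s a) * w ^+ c (a * s)%g *
   pot (contr (s r) (a (s r)) (a * s)%g) (cut s a)) rA A1).
rewrite [LHS]mulrAC [LHS]mulr_sumr [RHS]mulr_sumr; apply: eq_bigr => e eA.
rewrite [LHS]mulr_sumr [RHS]mulr_sumr; apply: eq_bigr => e' e'A.
rewrite /mapsum 2!(dual_sum _ r (mapwt _ _ r)).
rewrite [x * \sum_(_ | _) _]mulr_sumr -sumrB [LHS]mulr_sumr [RHS]mulr_sumr.
apply: eq_bigr => -[s a] /= M; rewrite /mapwt (rooted_dualK M).
pose g := y ^+ #|porbit s r| * w ^+ c (a * s)%g * pot (a * s)%g a.
transitivity ((x - 1) * \sum_(i < #|porbit (a * s)%g r|) g * x ^+ (#|porbit (a * s)%g r| - i)).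
  rewrite -mulrA; congr (_ * _); rewrite sum_porbit mulr_sumr; apply: eq_bigr => i _.
  set k := ((a * s) ^+ i)%g r.
  have kr : k \in porbit (a * s)%g r by apply: mem_porbit.
  have [[R E L X] [_ V]] := insert_shape eA e'A M kr.
  have P := insert_potts_contr eA e'A M kr nu q ch0.
  have Y := insert_card_face eA e'A M kr (ltn_ord i) erefl.
  rewrite L X /cut R E tpermKg Y /= addnK /g -P -V (exprS w).
  set P0 := pot _ _; set W0 := w ^+ _; set X0 := x ^+ _; set Y0 := y ^+ _; ring.
rewrite sum_face_pos /g expr1n.
rewrite -[in y ^+ #|porbit s r|](prednK (card_porbit_gt0 s r)) exprS.
set P0 := pot _ _; set W0 := w ^+ _; set X0 := x ^+ _; set Y0 := y ^+ _; ring.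
Qed.

(* d and c stand for deletion and contraction of the root edge, f for sums over root loops read on the
   dual map; I and N for isthmuses and other edges.  A loop counts twice in the degree of the root vertex: the
   terms P correct the formula that is valid for the other edges, the loops being the isthmuses of
   the dual map. *)
Lemma mapsum_decomposition x y : exists dI fP dN fI cP cN : F,
  [/\ mapsum x y A r = dI + (dN + (x - 1) * fP) + (nu - 1) * (fI + (cN + (y - 1) * cP)),
   dI * (w * q) ^+ #|T|.+1 =
    (x * y ^+ 2) * mapsum_pairs x y 1 y A r,
   (y - 1) * dN * (w * q) ^+ 2 =
    (x * y) * \sum_(e in A :\ r) \sum_(e' in A :\ r :\ e)
      (y * mapsum x y (A :\ e :\ e') r - mapsum x 1 (A :\ e :\ e') r) &
   (x - 1) * cN * (w * q ^+ 2) =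
    (x * y) * \sum_(e in A :\ r) \sum_(e' in A :\ r :\ e)
      (x * mapsum x y (A :\ e :\ e') r - mapsum 1 y (A :\ e :\ e') r)] /\
  [/\ fP * (w * q) ^+ #|T|.+2 =
    (x * y) * mapsum_pairs x y x 1 A r,
   fI * (w * q) ^+ #|T|.+2 =
    (x ^+ 2 * y) * mapsum_pairs x y x 1 A r &
   cP * (w ^+ #|T|.+1 * q ^+ #|T|.+2) =
    (x * y) * mapsum_pairs x y 1 y A r].
Proof.
have dual_pt s a : rooted A r s a -> (a * (a * s) = s)%g /\ (a * s)%g r = s r.
  by move=> M; have [aK ar] := rooted_involution M; rewrite (rooted_dualK M) permM ar.
(* The evaluations proved above determine the six values; the comparison of their combination with
   [mapsum] comes last. *)
do 6!eexists; split; last split; [split| | |]; last first.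
- exact: isthmus_ctr_pred.
- exact: isthmus_face.
- exact: isthmus_face_pred.
- exact: nonisthmus_ctr.
- exact: nonisthmus_del.
- exact: isthmus_del.
(* Loops are never isthmuses, and they are the isthmuses of the dual map. *)
have loop_sum (h : {perm T} -> {perm T} -> F) :
    \sum_(p | rooted A r p.1 p.2 && ~~ isthmus r p.1 p.2) (if loop r p.1 p.2 then h p.1 p.2 else 0) =
    \sum_(p | rooted A r p.1 p.2 && isthmus r p.1 p.2) h (p.2 * p.1)%g p.2.
  rewrite -(dual_sum_cond (P := @loop T) (Q := @isthmus T)); last by move=> s a _; apply: loop_dual.
  rewrite -big_mkcondr; apply: eq_bigl => -[s a] /=.
  case M: (rooted A r s a) => //=; case L: (loop r s a); rewrite ?andbF //.
  by rewrite (loop_not_isthmus M L).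
rewrite mapsum_edge; congr (_ + _ * _).
  rewrite (bigID (fun p => isthmus r p.1 p.2)) /=; congr (_ + _).
  pose h s a := x ^+ #|porbit s r|.-2 * y ^+ #|porbit (a * s)%g r|.-1 * w ^+ c s * pot s (cut s a).
  transitivity (\sum_(p | rooted A r p.1 p.2 && ~~ isthmus r p.1 p.2)
     (x ^+ (#|porbit p.1 r|.-1 - loop r p.1 p.2) * y ^+ #|porbit (p.2 * p.1)%g r|.-1 *
      w ^+ c p.1 * pot p.1 (cut p.1 p.2) + (x - 1) * (if loop r p.1 p.2 then h p.1 p.2 else 0))).
    apply: eq_bigr => -[s a] /= /andP[M _]; case: ifP => _; last by rewrite mulr0 addr0 subn0.
    rewrite /h subn1 -{1}(prednK (rooted_card_vertex M)) exprS.
    by move: (_ ^+ _) (_ ^+ _) (_ ^+ _) (pot _ _) => X0 Y0 W0 P0; ring.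
  rewrite big_split /= -mulr_sumr loop_sum; congr (_ + _ * _).
  apply: eq_bigr => -[s a] /= /andP[M _]; have [E1 E2] := dual_pt _ _ M.
  by rewrite /h /cut E1 E2.
(* At a loop, contraction leaves the rotation as it is. The other edges are those that are not
   isthmuses in the dual, where the correction affects [y]. *)
rewrite (bigID (fun p => loop r p.1 p.2)) /=; congr (_ + _).
  rewrite (dual_sum_cond (P := @loop T) (Q := @isthmus T)
    (fun s a => x ^+ #|porbit s r|.-1 * y ^+ #|porbit (a * s)%g r|.-1 *
    w ^+ c s * pot (ctr s a) (cut s a))); last by move=> s a _; apply: loop_dual.
  apply: eq_bigr => -[s a] /= /andP[M I]; have [E1 E2] := dual_pt _ _ M.
  suff -> : ctr (a * s)%g a = (a * s)%g by rewrite /cut E1 E2.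
  have in1 : s r \in porbit (a * s)%g r by rewrite -E2 porbit_step.
  by rewrite /ctr E2 /contr (porbit_eqP _ _ _ in1) (I : a (s r) \in porbit (a * s)%g r).
rewrite (dual_sum_cond (P := fun t u v => ~~ loop t u v) (Q := fun t u v => ~~ isthmus t u v)
    (fun s a => x ^+ #|porbit s r|.-1 * y ^+ #|porbit (a * s)%g r|.-1 *
    w ^+ c s * pot (ctr s a) (cut s a))); last by move=> s a _ ar; rewrite loop_dual.
pose h s a := x ^+ #|porbit (a * s)%g r|.-1 * y ^+ #|porbit s r|.-2 * w ^+ c (a * s)%g *
   pot (contr (s r) (a (s r)) (a * s)%g) (cut s a).
transitivity (\sum_(p | rooted A r p.1 p.2 && ~~ isthmus r p.1 p.2)
   (x ^+ #|porbit (p.2 * p.1)%g r|.-1 * y ^+ (#|porbit p.1 r|.-1 - loop r p.1 p.2) *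
    w ^+ c (p.2 * p.1)%g * pot (contr (p.1 r) (p.2 (p.1 r)) (p.2 * p.1)%g) (cut p.1 p.2)
     + (y - 1) * (if loop r p.1 p.2 then h p.1 p.2 else 0))).
  apply: eq_bigr => -[s a] /= /andP[M _]; have [E1 E2] := dual_pt _ _ M.
  rewrite /ctr /cut E1 E2; case: ifP => _; last by rewrite mulr0 addr0 subn0.
  rewrite /h /cut subn1 -{1}(prednK (rooted_card_vertex M)) (exprS y).
  by move: (_ ^+ _) (_ ^+ _) (_ ^+ _) (pot _ _) => X0 Y0 W0 P0; ring.
rewrite big_split /= -mulr_sumr loop_sum; congr (_ + _ * _).
apply: eq_bigr => -[s a] /= /andP[M _]; have [E1 E2] := dual_pt _ _ M.
by rewrite /h /cut /ctr E1 E2.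
Qed.

End OneSet.

(* Each dart outside A contributes an isolated vertex of weight w q; one more factor w q turns
   w^(v-1) P / q into w^v P. *)
Variable mu : F -> F -> nat -> F.
Hypothesis mapsum_mu : forall x y A r, r \in A ->
  mapsum x y A r = #|A|.-1`!%:R * (w * q) ^+ #|~: A|.+1 * mu x y #|A|.

(** Both indices are at least 1, since a piece contains its leg, and they add up to [n.+1]. *)
Definition conv (u v : nat -> F) n := \sum_(k < n) u k.+1 * v (n - k)%N.

(** There are (n+2)(n+1) choices of [e] and [e'], and the remaining n labels can be distributed in
    C(n,k) ways. Together with the factors k! and (n-k)! of the pieces this gives (n+2)!, so that a
    plain convolution is left. *)
Lemma sum_isthmus_mu A r x y x' y' n : r \in A -> #|A| = n.+3 ->
  mapsum_pairs x y x' y' A r =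
  n.+2`!%:R * (w * q) ^+ (#|T| + #|~: A|.+3) * conv (mu x y) (mu x' y') n.+1.
Proof.
move=> rA cA.
rewrite /mapsum_pairs; have cT := cardsC A.
transitivity (\sum_(e in A :\ r) \sum_(e' in A :\ r :\ e)
   (n`!%:R * (w * q) ^+ (#|T| + #|~: A|.+3) * conv (mu x y) (mu x' y') n.+1)).
  apply: eq_bigr => e /[!inE] /andP[er eA].
  apply: eq_bigr => e' /[!inE] /and3P[e'e e'r e'A].
  have cA' : #|A :\ e :\ e'| = n.+1.
    move: cA; rewrite (cardsD1 e) eA (cardsD1 e' (A :\ e)) !inE e'e e'A /=; lia.
  pose g b := (b.-1`!%:R * (w * q) ^+ (#|T| - b).+1 * mu x y b) *
    ((n.+2 - b).-1`!%:R * (w * q) ^+ (#|T| - (n.+2 - b)).+1 * mu x' y' (n.+2 - b)%N).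
  transitivity (\sum_(B : {set T} | (B \subset A :\ e :\ e') && (r \in B)) g #|B|).
    apply: eq_big => [B|B /and3P[BA rB e'B]].
      by rewrite [in RHS]subsetD1 -andbA; congr (_ && _); rewrite andbC.
    have e'C : e' \in A :\ e :\: B by rewrite !inE e'B e'e e'A.
    have cC : #|A :\ e :\: B| = (n.+2 - #|B|)%N.
      rewrite cardsD (setIidPr BA); congr (_ - _)%N.
      by move: cA; rewrite (cardsD1 e) eA => -[].
    have compl (D : {set T}) : #|~: D| = (#|T| - #|D|)%N by rewrite -(cardsC D) addKn.
    by rewrite !mapsum_mu // !compl cC.
  rewrite (sum_sets_between g) ?cA'; last by rewrite !inE eq_sym e'r eq_sym er.
  rewrite /conv mulr_sumr; apply: eq_bigr => k _; rewrite /g /=.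
  have lk := ltn_ord k.
  rewrite !subSS.
  have E1 : ((#|T| - k.+1).+1 + (#|T| - (n.+1 - k)).+1 = #|T| + #|~: A|.+3)%N.
    by move: cT cA lk; clear; move: #|T| #|~: A| #|A| (k : nat) => t u v m; lia.
  have E2 : (n`! = 'C(n, k) * (k`! * (n.+1 - k).-1`!))%N.
    by rewrite (_ : (n.+1 - k).-1 = n - k)%N ?bin_fact // subSn.
  rewrite -E1 E2 !natrM exprD -mulr_natr.
  move: (_ ^+ _) (_ ^+ _) => X0 Y0; ring.
rewrite [LHS](eq_bigr (fun=> (n`!%:R * (w * q) ^+ (#|T| + #|~: A|.+3) *
   conv (mu x y) (mu x' y') n.+1) *+ n.+1)); last first.
  move=> e /[!inE] /andP[er eA]; rewrite sumr_const; congr (_ *+ _).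
  move: cA; rewrite (cardsD1 r) rA (cardsD1 e (A :\ r)) !inE er eA; lia.
rewrite sumr_const; have -> : #|A :\ r| = n.+2 by move: cA; rewrite (cardsD1 r) rA; lia.
rewrite -mulrnA -[LHS]mulr_natr !factS !natrM; ring.
Qed.

Lemma sum_nonisthmus_mu A r x y n (G : F -> F -> F) : r \in A -> #|A| = n.+3 ->
  (forall k u v, k * G u v = G (k * u) (k * v)) ->
  forall x' y', \sum_(e in A :\ r) \sum_(e' in A :\ r :\ e)
    G (mapsum x y (A :\ e :\ e') r) (mapsum x' y' (A :\ e :\ e') r) =
  n.+2`!%:R * (w * q) ^+ #|~: A|.+3 * G (mu x y n.+1) (mu x' y' n.+1).
Proof.
move=> rA cA hG x' y'.
transitivity (\sum_(e in A :\ r) \sum_(e' in A :\ r :\ e)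
   (n`!%:R * (w * q) ^+ #|~: A|.+3 * G (mu x y n.+1) (mu x' y' n.+1))).
  apply: eq_bigr => e /[!inE] /andP[er eA].
  apply: eq_bigr => e' /[!inE] /and3P[e'e e'r e'A].
  have rA' : r \in A :\ e :\ e' by rewrite !inE eq_sym e'r eq_sym er.
  have cA' : #|A :\ e :\ e'| = n.+1.
    by move: cA; rewrite (cardsD1 e) eA (cardsD1 e' (A :\ e)) !inE e'e e'A /= => -[].
  by rewrite !mapsum_mu // hG cA' /= !card_setCD1 // !inE e'e.
rewrite [LHS](eq_bigr (fun=> (n`!%:R * (w * q) ^+ #|~: A|.+3 *
   G (mu x y n.+1) (mu x' y' n.+1)) *+ n.+1)); last first.
  move=> e /[!inE] /andP[er eA]; rewrite sumr_const; congr (_ *+ _).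
  move: cA; rewrite (cardsD1 r) rA (cardsD1 e (A :\ r)) !inE er eA; lia.
rewrite sumr_const; have -> : #|A :\ r| = n.+2 by move: cA; rewrite (cardsD1 r) rA; lia.
rewrite -mulrnA -[LHS]mulr_natr !factS !natrM; ring.
Qed.

End Recursion.

(** * Relabelling of darts *)

Lemma card_porbits_involution (T : finType) (a : {perm T}) :
  (forall x, a (a x) = x) -> (forall x, a x != x) -> (2 * #|porbits a| = #|T|)%N.
Proof.
move=> aK af.
rewrite -[RHS]sum1_card (partition_big_imset (porbit a)) /=.
transitivity (\sum_(B in porbits a) 2)%N; first by rewrite sum_nat_const mulnC.
apply: eq_bigr => B /imsetP[x _ ->]; apply/esym.
rewrite sum1dep_card (_ : [set y | _] = [set x; a x]); first by rewrite cards2 eq_sym af.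
apply/setP=> y; rewrite !inE eq_porbit_mem; apply/porbitP/orP => [[i ->]|[]/eqP ->].
- elim: i => [|i [] /eqP IH]; first by left; rewrite expg0 perm1.
    by right; rewrite expgSr permM IH.
  by left; rewrite expgSr permM IH aK.
- by exists 0%N; rewrite expg0 perm1.
- by exists 1%N; rewrite expg1.
Qed.

Section Extension.
Variables (T0 T : finType) (iota : T0 -> T).
Hypothesis iota_inj : injective iota.
Implicit Types (s a : {perm T0}).
Notation c s := (#|porbits s|).
Notation img := [set iota z | z in setT].

Definition ext_fun s (x : T) := if [pick z | iota z == x] is Some z then iota (s z) else x.

Lemma ext_fun_in s z : ext_fun s (iota z) = iota (s z).
Proof.
by rewrite /ext_fun; case: pickP => [z' /eqP/iota_inj->|/(_ z)] //; rewrite eqxx.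
Qed.

Lemma ext_fun_out s x : x \notin img -> ext_fun s x = x.
Proof.
rewrite /ext_fun; case: pickP => // z /eqP <- /negP[]; exact: imset_f.
Qed.

Lemma ext_inj s : injective (ext_fun s).
Proof.
move=> x y; have [/imsetP[z _ ->]|nx] := boolP (x \in img);
have [/imsetP[z' _ ->]|ny] := boolP (y \in img).
- by rewrite !ext_fun_in => /iota_inj/perm_inj->.
- by rewrite ext_fun_in ext_fun_out // => E; rewrite -E imset_f in ny.
- by rewrite ext_fun_in ext_fun_out // => E; rewrite E imset_f in nx.
- by rewrite !ext_fun_out.
Qed.

Definition ext_perm s : {perm T} := perm (@ext_inj s).

Lemma extE s z : ext_perm s (iota z) = iota (s z).
Proof. by rewrite permE ext_fun_in. Qed.

Lemma ext_out s x : x \notin img -> ext_perm s x = x.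
Proof. by move=> nx; rewrite permE ext_fun_out. Qed.

Lemma ext_on s : perm_on img (ext_perm s).
Proof. by apply/subsetP=> x; rewrite inE; apply: contraR => /ext_out->. Qed.

Lemma extM s a : ext_perm (s * a) = (ext_perm s * ext_perm a)%g.
Proof.
apply/permP=> x; have [/imsetP[z _ ->]|nx] := boolP (x \in img).
  by rewrite permM !extE permM.
by rewrite permM !ext_out.
Qed.

Lemma ext1 : ext_perm 1 = 1%g.
Proof.
apply/permP=> x; have [/imsetP[z _ ->]|nx] := boolP (x \in img).
  by rewrite !extE !perm1.
by rewrite !ext_out // perm1.
Qed.

Lemma ext_injective : injective ext_perm.
Proof.
move=> s a /permP E; apply/permP=> z; apply: iota_inj; by rewrite -!extE E.
Qed.

Lemma ext_onto (u : {perm T}) : perm_on img u -> exists s, u = ext_perm s.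
Proof.
move=> uo.
have ex z : exists z', iota z' == u (iota z).
  have : u (iota z) \in img by rewrite perm_closed // imset_f.
  by case/imsetP=> z' _ ->; exists z'.
pose v z := xchoose (ex z).
have vE z : iota (v z) = u (iota z) by apply/eqP/(xchooseP (ex z)).
have vi : injective v by move=> z z' E; apply/iota_inj/(@perm_inj _ u); rewrite -!vE E.
exists (perm vi); apply/permP=> x.
have [/imsetP[z _ ->]|nx] := boolP (x \in img).
  by rewrite extE permE vE.
by rewrite (out_perm uo) // ext_out.
Qed.

Lemma porbit_ext s z : porbit (ext_perm s) (iota z) = [set iota z' | z' in porbit s z].
Proof.
have H i : (ext_perm s ^+ i)%g (iota z) = iota ((s ^+ i)%g z).
  by elim: i => [|i IH]; rewrite ?expg0 ?perm1 // !expgSr !permM IH extE.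
apply/setP=> x; apply/porbitP/imsetP => [[i ->]|[z' /porbitP[i ->] ->]].
  by exists ((s ^+ i)%g z); rewrite ?mem_porbit.
by exists i; rewrite H.
Qed.

Section Col.
Variables (F : fieldType) (nu : F) (I : finType).

Lemma colsum_ext s a :
  colsum nu I (ext_perm s) (ext_perm a) * #|I|%:R ^+ #|T0| = #|I|%:R ^+ #|T| * colsum nu I s a.
Proof.
have N (A : finType) : (#|I|%:R ^+ #|A| : F) = \sum_(g : {ffun A -> I}) 1.
  by rewrite sumr_const -natrX card_ffun.
rewrite [RHS]mulrC !N /colsum !big_distrlr /= !pair_big /=.
pose h (p : {ffun T -> I} * {ffun T0 -> I}) : {ffun T -> I} * {ffun T0 -> I} :=
  ([ffun x => if [pick z | iota z == x] is Some z then p.2 z else p.1 x],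
   [ffun z => p.1 (iota z)]).
have pk z : [pick z' | iota z' == iota z] = Some z.
  by case: pickP => [z' /eqP/iota_inj->|/(_ z)] //; rewrite eqxx.
have hK : involutive h.
  case=> f g; rewrite /h /=; congr (_, _); apply/ffunP=> x; rewrite !ffunE ?pk //.
  by case: pickP => [z /eqP <-|//]; rewrite ffunE.
have E1 (p : {ffun T -> I} * {ffun T0 -> I}) : vcol (ext_perm s) p.1 = vcol s (h p).2.
  apply/vcolP/vcolP => [H z|H x].
    by rewrite !ffunE -extE H.
  have [/imsetP[z _ ->]|nx] := boolP (x \in img).
    by have := H z; rewrite !ffunE -extE.
  by rewrite ext_out.
have E2 (p : {ffun T -> I} * {ffun T0 -> I}) : wcol nu (ext_perm a) p.1 = wcol nu a (h p).2.
  rewrite /wcol -(card_imset _ iota_inj); congr (_ ^+ #|pred_of_set _|./2).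
  apply/setP=> x; apply/idP/imsetP => [|[z]].
    rewrite inE; have [/imsetP[z _ ->]|nx] := boolP (x \in img).
      by rewrite extE (inj_eq iota_inj) => Hz; exists z => //; rewrite !inE !ffunE.
    by rewrite ext_out // eqxx.
  by rewrite !inE !ffunE => Hz ->; rewrite extE (inj_eq iota_inj).
rewrite [RHS](reindex_onto (fun p : {ffun T -> I} * {ffun T0 -> I} => (p.2, p.1))
   (fun p => (p.2, p.1))) /=; last by case.
rewrite [LHS](reindex_inj (inv_inj hK)); apply: eq_big => [p|p _].
  rewrite -[LHS]/(vcol (ext_perm s) (h p).1 && true) E1 hK.
  by case: p => f g /=; rewrite eqxx !andbT.
by rewrite -[LHS]/(wcol nu (ext_perm a) (h p).1 * 1) E2 hK.
Qed.
End Col.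

Lemma card_porbits_ext s : (c (ext_perm s) + #|T0| = #|T| + c s)%N.
Proof.
have := @colsum_ext rat 1 bool s 1%g.
rewrite ext1 !colsum1 card_bool -!exprD -!natrX => /eqP; rewrite Num.Theory.eqr_nat.
by rewrite eqn_exp2l // => /eqP.
Qed.

Lemma potts_ext (F : fieldType) (nu q : F) (ch0 : forall n, n.+1%:R != 0 :> F) s a :
  (forall h, a (a h) = h) ->
  pottsval nu q (ext_perm s) (ext_perm a) * q ^+ #|T0| = q ^+ #|T| * pottsval nu q s a.
Proof.
move=> aK; have eK x : ext_perm a (ext_perm a x) = x.
  have [/imsetP[z _ ->]|nx] := boolP (x \in img).
    by rewrite !extE aK.
  by rewrite !ext_out.
have [p pE ->] := potts_spec nu q ch0 (ext_perm s) eK; have [p1 pE1 ->] := potts_spec nu q ch0 s aK.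
suff E : p * 'X^#|T0| = 'X^#|T| * p1.
  by rewrite -[q ^+ #|T0|](hornerXn) -hornerM E hornerM hornerXn.
apply: (poly_nat_eq ch0) => j; rewrite !hornerM !hornerXn -pE1 -pE.
by have := colsum_ext nu 'I_j s a; rewrite card_ord.
Qed.

End Extension.

Lemma KK_natr_neq0 n : n.+1%:R != 0 :> KK.
Proof.
by rewrite -(rmorph_nat (@tofrac {poly {poly {poly rat}}})) tofrac_eq0 -!polyC_natr !polyC_eq0 Num.Theory.pnatr_eq0.
Qed.

Section InverseTperm.
Variable T : finType.
Implicit Types (s a : {perm T}) (r e : T).
Notation c s := (#|porbits s|).

Lemma invMtperm s r e : (s * tperm r e)%g = (tperm r e * s^-1)^-1%g.
Proof. by rewrite invMg invgK tpermV. Qed.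

Lemma fix_inv s r : s r = r -> s^-1%g r = r.
Proof. by move=> sr; rewrite -{1}sr permK. Qed.

(** Multiplication on the right places [r] just before [e], so that [e] is the dart following the
    leg. Passing to inverses reduces it to multiplication on the left. *)
Lemma porbit_insert_right s r e : s r = r -> r != e ->
  #|porbit (s * tperm r e)%g r| = #|porbit s e|.+1.
Proof.
move=> sr re; have s'r := fix_inv sr; have er : e != r by rewrite eq_sym.
rewrite invMtperm porbitV tpermC.
have /porbit_eqP -> : r \in porbit (tperm e r * s^-1)%g e.
  by rewrite porbit_tperm_insert // !inE eqxx.
by rewrite card_porbit_insert // porbitV.
Qed.

Lemma porbits_insert_right s r e : s r = r -> r != e -> (c (s * tperm r e)%g).+1 = c s.
Proof.
move=> sr re; have s'r := fix_inv sr.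
rewrite invMtperm porbitsV -(porbitsV s) tpermC; by apply: card_porbits_insert; rewrite // eq_sym.
Qed.

Lemma pottsval_inv (F : fieldType) (nu q : F) s a : pottsval nu q s^-1 a = pottsval nu q s a.
Proof.
rewrite /pottsval porbitsV /interp; apply: eq_bigr => j _; congr (_ * _).
apply: eq_bigl => f; apply/vcolP/vcolP => H h.
  by rewrite -{2}(permK s h) H.
by rewrite -{2}(permKV s h) H.
Qed.

Lemma pottsval_insert_right (F : fieldType) (nu q : F) (ch0 : forall n, n.+1%:R != 0 :> F) s a r e :
  (forall x, a (a x) = x) -> s r = r -> a r = r -> r != e ->
  q * pottsval nu q (s * tperm r e)%g a = pottsval nu q s a.
Proof.
move=> aK sr ar re; have s'r := fix_inv sr.
rewrite invMtperm pottsval_inv tpermC -(pottsval_inv _ _ s).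
by apply: potts_insert; rewrite // eq_sym.
Qed.
End InverseTperm.

(** * Maps with one leg and rooted maps without legs *)

Section Transfer.
Variables (n : nat) (T : finType) (iota : dart n -> T) (A : {set T}) (r : T).
Hypotheses (iota_inj : injective iota) (rA : r \in A)
  (imA : [set iota z | z in setT] = A :\ r).
Let e := iota ord0.
Implicit Types (s a : {perm dart n}).
Notation c s := (#|porbits s|).
Notation img := [set iota z | z in setT].
Notation ext_perm := (ext_perm iota_inj).

Let r_out : r \notin img.
Proof. by rewrite imA !inE eqxx. Qed.
Let ext_r s : ext_perm s r = r. Proof. exact: ext_out. Qed.
Let re : r != e.
Proof. by apply: contraNneq r_out => ->; apply: imset_f. Qed.
Let sub_A : img \subset A.
Proof. by rewrite imA subD1set. Qed.
Let iota_A z : iota z \in A.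
Proof. by apply: (subsetP sub_A); apply: imset_f. Qed.
Let cardA : #|A| = n.*2.+3.
Proof.
by rewrite (cardsD1 r) rA -imA card_imset // cardsT card_ord.
Qed.
Let cardT : #|T| = (#|~: A| + n.*2.+3)%N.
Proof. by rewrite -cardA addnC cardsC. Qed.

Lemma porbits_ext_compl s : (c (ext_perm s) = #|~: A| + 1 + c s)%N.
Proof.
apply/eqP; rewrite -(eqn_add2r #|dart n|) card_porbits_ext cardT card_ord.
by rewrite !addnS addn0 !addSn addnAC.
Qed.

Let A_cases x : x \in A -> x = r \/ exists z, x = iota z.
Proof.
move=> xA; have [->|xr] := eqVneq x r; [by left|right].
have : x \in A :\ r by rewrite !inE xr.
by rewrite -imA => /imsetP[z _ ->]; exists z.
Qed.

Lemma face_ext s a : (ext_perm a * (ext_perm s * tperm r e))%g = (ext_perm (a * s)%g * tperm r e)%g.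
Proof. by rewrite mulgA -extM. Qed.

(* The root leg r is attached at the corner of the root dart [iota ord0]. *)
Lemma rooted_transfer s a : rooted A r (ext_perm s * tperm r e)%g (ext_perm a) = map_valid (s, a).
Proof.
pose E := fun x y : dart n => (y == s x) || (y == a x).
have Ec z z' : connect E ord0 z -> E z z' -> connect E ord0 z'.
  by move=> H1 H2; apply: connect_trans H1 (connect1 H2).
apply/andP/and4P => [[/leggedP[_ _ _ aK af C] /eqP eul]|[aK af cn eul]] /=.
  have aK' h : a (a h) = h by apply: iota_inj; rewrite -(extE iota_inj a (a h)) -(extE iota_inj a h) aK.
  have af' h : a h != h.
    rewrite -(inj_eq iota_inj) -(extE iota_inj) af // inE.
    by apply: contraNneq r_out => <-; apply: imset_f.
  split; [by apply/forallP=> h; rewrite aK'|by apply/forallP| |].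
    pose D := r |: [set iota z | z in [set z | connect E ord0 z]].
    have AD : A \subset D.
      move/connP: C; apply.
      - by rewrite sub1set !inE eqxx.
      - move=> x; rewrite !inE => /orP[/eqP->|/imsetP[z]].
          rewrite permM ext_r tpermL; apply/orP; right; apply/imsetP; exists ord0 => //.
          by rewrite inE connect0.
        rewrite inE => cz ->; rewrite permM extE; case: tpermP => [_|_|_ _].
        + by apply/orP; right; apply/imsetP; exists ord0 => //; rewrite inE connect0.
        + by rewrite eqxx.
        + apply/orP; right; apply/imsetP; exists (s z) => //.
          by rewrite inE; apply: Ec cz _; rewrite /E eqxx.
      - move=> x; rewrite !inE => /orP[/eqP->|/imsetP[z]]; first by rewrite ext_r eqxx.
        rewrite inE => cz ->; rewrite extE; apply/orP; right; apply/imsetP; exists (a z) => //.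
        by rewrite inE; apply: Ec cz _; rewrite /E eqxx orbT.
    apply/forallP=> h; have := subsetP AD _ (iota_A h); rewrite !inE.
    case/orP=> [/eqP hr|/imsetP[z]]; last by rewrite inE => cz /iota_inj->.
    by case/negP: r_out; rewrite -hr imset_f.
  have ca := card_porbits_involution aK' af'; rewrite card_ord in ca.
  have h1 := porbits_insert_right (ext_r s) re.
  have h2 := porbits_insert_right (ext_r (a * s)%g) re.
  rewrite face_ext in eul.
  rewrite !porbits_ext_compl in h1 h2 eul.
  apply/eqP; move: cardT ca h1 h2 eul; clear.
  move: #|T| #|~: A| (c s) (c a) (c (a * s)%g) (c (ext_perm s * _)%g) (c (ext_perm (a * s)%g * _)%g).
  by move=> t u v1 v2 v3 v4 v5; rewrite -!muln2; lia.
have aK' h : a (a h) = h by apply/eqP/(forallP aK).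
have af' h : a h != h by apply: (forallP af).
split.
  apply/leggedP; split.
  - apply: perm_onM; first by apply: subset_trans (ext_on _ _) sub_A.
    apply: subset_trans (tperm_on _ _) _; rewrite subUset !sub1set rA /=; exact: iota_A.
  - by apply: subset_trans (ext_on _ _) sub_A.
  - by rewrite sub1set.
  - move=> x; have [/imsetP[z _ ->]|nx] := boolP (x \in img).
      by rewrite !extE aK'.
    by rewrite !ext_out.
  - move=> x /A_cases[->|[z ->]]; first by rewrite ext_r inE !eqxx.
    rewrite extE (inj_eq iota_inj) inE (negbTE (af' z)); apply/esym/negbTE.
    by apply: contraNneq r_out => <-; apply: imset_f.
  apply/connP=> D; rewrite sub1set => rD sD aD.
  have eD : e \in D by have := sD _ rD; rewrite permM ext_r tpermL.
  have sD' z : iota z \in D -> iota (s z) \in D.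
    by move/sD; rewrite permM extE; case: tpermP => [->|->|].
  have aD' z : iota z \in D -> iota (a z) \in D by move/aD; rewrite extE.
  apply/subsetP=> x /A_cases[->//|[z ->]].
  have /connectP[p pth ->] : connect E ord0 z by apply: (forallP cn).
  elim/last_ind: p pth => [_|p t IH] //=.
  rewrite rcons_path last_rcons => /andP[/IH lD /orP[]/eqP->]; [exact: sD'|exact: aD'].
have ca := card_porbits_involution aK' af'; rewrite card_ord in ca.
have h1 := porbits_insert_right (ext_r s) re.
have h2 := porbits_insert_right (ext_r (a * s)%g) re.
rewrite face_ext; rewrite !porbits_ext_compl in h1 h2 *.
move/eqP: eul => /= eul.
apply/eqP; move: cardT ca h1 h2 eul; clear.
  move: #|T| #|~: A| (c s) (c a) (c (a * s)%g) (c (ext_perm s * _)%g) (c (ext_perm (a * s)%g * _)%g).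
  by move=> t u v1 v2 v3 v4 v5; rewrite -!muln2; lia.
Qed.

Section Weights.
Variables (F : fieldType) (nu q w x y : F).
Hypothesis ch0 : forall n, n.+1%:R != 0 :> F.
Hypothesis q0 : q != 0.

Definition cmap_weight (p : cmap n) : F := x ^+ deg_root_vertex p * y ^+ deg_root_face p *
  w ^+ (nvert p).-1 * pottsval nu q p.1 p.2 / q.

Lemma mapwt_transfer s a : map_valid (s, a) ->
  mapwt nu q w x y r (ext_perm s * tperm r e)%g (ext_perm a) =
  (w * q) ^+ #|~: A|.+1 * cmap_weight (s, a).
Proof.
move=> mv; have M : rooted A r (ext_perm s * tperm r e)%g (ext_perm a) by rewrite rooted_transfer.
have aK h : a (a h) = h by case/and4P: mv => /forallP/(_ h)/eqP.
have eaK h : ext_perm a (ext_perm a h) = h by case/andP: M => /leggedP[].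
rewrite /mapwt face_ext !porbit_insert_right //= !porbit_ext !(card_imset _ iota_inj).
rewrite /cmap_weight /deg_root_vertex /deg_root_face /nvert /=.
have cs : (0 < c s)%N.
  by apply/card_gt0P; exists (porbit s ord0); apply: imset_f.
have -> : c (ext_perm s * tperm r e)%g = ((c s).-1 + #|~: A|.+1)%N.
  have := porbits_insert_right (ext_r s) re; rewrite porbits_ext_compl.
  by move: cs; clear; lia.
have := pottsval_insert_right nu q ch0 eaK (ext_r s) (ext_r a) re.
have := potts_ext iota_inj nu q ch0 s aK.
rewrite card_ord cardT; set P1 := pottsval _ _ _ _; set P2 := pottsval _ _ s a => E1 E2.
have -> : pottsval nu q (ext_perm s * tperm r e)%g (ext_perm a) = q ^+ #|~: A|.+1 * P2 / q.
  apply: (mulfI q0); rewrite E2.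
  apply: (mulIf (expf_neq0 n.*2.+2 q0)); rewrite E1.
  rewrite addnS -addSn exprD; move: (q ^+ #|~: A|.+1) (q ^+ n.*2.+2) => X0 X1.
  by field.
rewrite exprD exprMn; move: (_ ^+ _) (_ ^+ _) (_ ^+ _) (_ ^+ _) (_ ^+ _) => X0 X1 X2 X3 X4.
by field.
Qed.

Lemma sum_transfer :
  \sum_(p | rooted A r p.1 p.2 && (p.1 r == e)) mapwt nu q w x y r p.1 p.2 =
  (w * q) ^+ #|~: A|.+1 * \sum_(p : cmap n | map_valid p) cmap_weight p.
Proof.
pose h (p : cmap n) := ((ext_perm p.1 * tperm r e)%g, ext_perm p.2).
have hinj : injective h.
  case=> s a [s' a'] [] /mulIg E1 E2.
  by rewrite (ext_injective E1) (ext_injective E2).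
(* An inverse of [h]; the default is never reached on the maps of the sum, all of which come from
   [cmap n]. *)
pose g (p : {perm T} * {perm T}) : cmap n := odflt (1%g, 1%g) [pick z | h z == p].
rewrite (reindex h); last first.
  exists g => [p _|p].
    by rewrite /g; case: pickP => [z /eqP/hinj//|/(_ p)]; rewrite eqxx.
  rewrite !inE => /andP[M /eqP pe].
  case/andP: (M) => /leggedP[sA aA _ aK af _] _.
  have ar : p.2 r = r by apply/eqP; rewrite af // inE.
  have [a Ea] : exists a, p.2 = ext_perm a.
    apply: ext_onto; rewrite imA; apply/subsetP=> z; rewrite inE => nz.
    rewrite !inE (subsetP aA) ?inE // andbT.
    by apply: contra nz => /eqP->; rewrite ar.
  have [s Es] : exists s, (p.1 * tperm r e)%g = ext_perm s.
    have fr : (p.1 * tperm r e)%g r = r by rewrite permM pe tpermR.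
    apply: ext_onto; rewrite imA; apply/subsetP=> z; rewrite inE => nz.
    rewrite !inE; apply/andP; split; first by apply: contra nz => /eqP->; rewrite fr.
    apply: contraR nz => zA; rewrite permM (out_perm sA zA) tpermD //.
      by apply: contraNneq zA => <-.
    by apply: contraNneq zA => <-; apply: iota_A.
  have hp : h (s, a) = p.
    by case: p Es Ea {M pe sA aA aK af ar} => s0 a0 /= Es Ea; rewrite /h /= -Es -Ea -mulgA tperm2 mulg1.
  by rewrite /g; case: pickP => [z /eqP //|/(_ (s, a))]; rewrite hp eqxx.
rewrite mulr_sumr; apply: eq_big => [[s a]|[s a]] /=.
  by rewrite rooted_transfer permM ext_r tpermL eqxx andbT.
by rewrite rooted_transfer => /andP[mv _]; rewrite mapwt_transfer.
Qed.

End Weights.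
End Transfer.

(** * Tutte's equation *)

(** Relabellings that fix the root act freely: two with the same effect on a connected map agree on
    every dart reached from the root. So the class is as large as the group. *)
Lemma card_map_class n (p : cmap n) : map_valid p -> #|map_class p| = n.*2.+1`!.
Proof.
case: p => s a /and4P[_ _ /forallP cn _].
rewrite /map_class card_in_imset.
  have -> : [set tau : {perm dart n} | tau ord0 == ord0] = [set tau | perm_on [set~ ord0] tau].
    apply/setP=> tau; rewrite !inE; apply/eqP/subsetP => [t0 z|H].
      by rewrite !inE; apply: contra => /eqP ->; rewrite t0.
    by apply: contraTeq isT => t0; have := H ord0; rewrite !inE t0 eqxx => /(_ isT).
  by rewrite cardsE card_perm cardsC1 card_ord.
move=> t t' /[!inE] /eqP t0 /eqP t'0 /= [E1 E2]; apply/permP=> z.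
have /connectP[p pth ->] := cn z.
elim/last_ind: p pth => [_|p u IH] /=; first by rewrite t0 t'0.
rewrite rcons_path last_rcons => /andP[/IH lD /orP[]/eqP->].
  by rewrite -permJ lD E1 permJ.
by rewrite -permJ lD E2 permJ.
Qed.

Lemma sum_odd_even (V : nmodType) (f : nat -> V) n :
  \sum_(k < n.*2.+1) f k = \sum_(i < n.+1) f i.*2 + \sum_(i < n) f i.*2.+1.
Proof.
elim: n => [|n IH]; first by rewrite !big_ord_recr !big_ord0 /= !addr0.
rewrite doubleS 2!big_ord_recr IH /= [in RHS]big_ord_recr [X in _ = _ + X]big_ord_recr /=.
by rewrite -!addrA; congr (_ + _); rewrite [in RHS]addrCA; congr (_ + _); rewrite addrC.
Qed.

Lemma pottsval_map (K F : fieldType) (f : {rmorphism K -> F}) (nu q : K) (T : finType)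
    (s a : {perm T}) :
  f (pottsval nu q s a) = pottsval (f nu) (f q) s a.
Proof.
rewrite /pottsval /interp rmorph_sum; apply: eq_bigr => j _.
rewrite rmorphM rmorph_prod; congr (_ * _); last first.
  by apply: eq_bigr => i _; rewrite fmorph_div !rmorphB !rmorph_nat.
by rewrite rmorph_sum; apply: eq_bigr => g _; rewrite rmorphXn.
Qed.

Lemma potts_pottsval n (p : cmap n) : map_valid p ->
  Defs.potts p = pottsval nuK qK p.1 p.2.
Proof.
case: p => s a /and4P[_ /forallP af _ _].
apply: eq_bigr => j _; congr (_ * _); apply: eq_bigr => g _.
rewrite /wcol divn2; congr (nuK ^+ #|pred_of_set _|./2).
by apply/setP=> h; rewrite !inE (af h).
Qed.

(** The coefficient of t^k in M(x,y), over a commutative ring: Tutte's equation is proved at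
    elements of a field and used at power series. *)
Definition mcoef (R : comNzRingType) (f : {rmorphism KK -> R}) (x y : R) (k : nat) : R :=
  if k is n.+1 then \sum_(p : cmap n | map_valid p)
    f (map_weight p) * x ^+ deg_root_vertex p * y ^+ deg_root_face p
  else 1.

Section MapSeries.
Variables (F : fieldType) (f : {rmorphism KK -> F}).
Notation nu := (f nuK).
Notation q := (f qK).
Notation w := (f wK).

Lemma natr_neq0 n : n.+1%:R != 0 :> F.
Proof. by rewrite -(rmorph_nat f) fmorph_eq0 KK_natr_neq0. Qed.

Lemma q_neq0 : q != 0.
Proof. by rewrite fmorph_eq0 tofrac_eq0 !polyC_eq0 polyX_eq0. Qed.

Lemma w_neq0 : w != 0.
Proof. by rewrite fmorph_eq0 tofrac_eq0 polyX_eq0. Qed.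

Lemma potts_map n (p : cmap n) : map_valid p ->
  f (Defs.potts p) = pottsval nu q p.1 p.2.
Proof. by move=> mv; rewrite potts_pottsval // pottsval_map. Qed.

Variables x y : F.

Lemma mcoefS n : n.*2.+1`!%:R * mcoef f x y n.+1 =
  \sum_(p : cmap n | map_valid p) cmap_weight nu q w x y p.
Proof.
rewrite /= mulr_sumr; apply: eq_bigr => p mv.
rewrite /map_weight /cmap_weight !fmorph_div rmorphM rmorphXn rmorph_nat potts_map //.
rewrite card_map_class //.
have : n.*2.+1`!%:R != 0 :> F by rewrite -(prednK (fact_gt0 _)) natr_neq0.
move: (_ `!%:R) => d d0.
move: (x ^+ _) (y ^+ _) (w ^+ _) (pottsval _ _ _ _) => X0 Y0 W0 P0.
by field; rewrite q_neq0 d0.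
Qed.

(** The index is the number of darts including the leg, which is odd for every map by
    [rooted_odd]. *)
Definition mu (a : nat) : F := if odd a then mcoef f x y a./2 else 0.

Variable T : finType.
Implicit Types (A : {set T}) (r e : T).

Lemma rooted_odd A r s a : rooted A r s a -> odd #|A|.
Proof.
case/andP=> /leggedP[sA aA /[!sub1set] rA aK af _] _.
rewrite (cardsD1 r) rA /=; apply: (even_card_involution (a := a)) => z; rewrite ?aK // !inE.
  case/andP=> zr zA; rewrite perm_closed // zA andbT.
  have ar : a r = r by apply/eqP; rewrite af // inE.
  by rewrite (perm_fix_eq _ ar).
by case/andP=> zr zA; rewrite af // inE.
Qed.

Lemma mapsum_singleton r : mapsum nu q w x y [set r] r = (w * q) ^+ #|T|.
Proof.
rewrite /mapsum (big_pred1 (1%g, 1%g)) => [|[s a]] /=.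
  rewrite /mapwt mulg1 !(porbit_fix (perm1 _)) cards1 !expr0 !mul1r potts1 ?natr_neq0 //.
    by rewrite card_porbits1 exprMn.
  exact: natr_neq0.
apply/idP/eqP => [/andP[/leggedP[sA aA _ _ _ _] _]|[-> ->]].
  by congr (_, _); [apply: perm_on_id sA _|apply: perm_on_id aA _]; rewrite cards1.
apply/andP; split; last first.
  rewrite mulg1 !card_porbits1 cardsC1 prednK; last by apply/card_gt0P; exists r.
  by apply/eqP; rewrite mul2n -addnn addnA.
apply/leggedP; split; rewrite ?perm_on1 ?subxx //.
- by move=> z; rewrite !perm1.
- by move=> z; rewrite perm1 eqxx.
by apply/connP=> D rD _ _.
Qed.

Lemma mapsum_mu A r : r \in A ->
  mapsum nu q w x y A r = #|A|.-1`!%:R * (w * q) ^+ #|~: A|.+1 * mu #|A|.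
Proof.
move=> rA; rewrite /mu; case: ifPn => [oA|/negP nA]; last first.
  by rewrite mulr0 /mapsum big_pred0 // => p; apply: contra_notF nA => /rooted_odd.
case E : #|A|./2 => [|n] .
  have cA : #|A| = 1%N by have := odd_double_half #|A|; rewrite oA E.
  have EA : A = [set r].
    by apply/esym/eqP; rewrite eqEcard sub1set rA cards1 cA.
  rewrite mulr1 EA mapsum_singleton cards1 /= mul1r cardsC1 prednK //.
  by apply/card_gt0P; exists r.
have cA : #|A| = n.*2.+3 by have := odd_double_half #|A|; rewrite oA E.
set M0 := mcoef f x y n.+1.
have A1 : (1 < #|A|)%N by rewrite cA.
rewrite /mapsum (partition_big (fun p : {perm T} * {perm T} => p.1 r) (fun e => e \in A :\ r)) /=; last first.
  move=> p M; rewrite !inE (rooted_root_moves A1 M) /=.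
  by case/andP: M => /leggedP[sA _ _ _ _ _] _; rewrite perm_closed.
(* Maps are sorted by the dart [e] after the leg. All choices of [e] contribute equally, as the
   darts other than [r] can be numbered with [e] first, in the place of the root dart. *)
rewrite (eq_bigr (fun=> (w * q) ^+ #|~: A|.+1 * (n.*2.+1`!%:R * M0))); last first.
  move=> e /[!inE] /andP[er eA].
  pose l := e :: enum (A :\ r :\ e).
  have ul : uniq l by rewrite /= enum_uniq mem_enum !inE eqxx.
  have sl : size l = n.*2.+2.
    rewrite /= -cardE; have := cA.
    by rewrite (cardsD1 r) rA (cardsD1 e (A :\ r)) !inE er eA => -[<-].
  pose iota (z : dart n) := nth r l z.
  have iota_inj : injective iota.
    move=> z z' /eqP; rewrite /iota nth_uniq ?sl ?ltn_ord // => /eqP; exact: val_inj.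
  have memA z : iota z \in A :\ r.
    have : iota z \in l by rewrite mem_nth // sl.
    rewrite inE mem_enum !inE => /orP[/eqP->|/and3P[_ -> ->]//]; by rewrite er.
  have imA : [set iota z | z in setT] = A :\ r.
    apply/eqP; rewrite eqEcard; apply/andP; split.
      by apply/subsetP=> _ /imsetP[z _ ->].
    rewrite card_imset // cardsT card_ord.
    by have := cA; rewrite (cardsD1 r) rA => -[<-].
  have <- : iota ord0 = e by [].
  rewrite (sum_transfer iota_inj rA imA nu w x y natr_neq0 q_neq0).
  by rewrite /M0 mcoefS.
rewrite sumr_const -[LHS]mulr_natl.
have -> : #|A :\ r| = n.*2.+2 by have := cA; rewrite (cardsD1 r) rA => -[].
rewrite cA /= (factS n.*2.+1) natrM; move: (n.*2.+2%:R) (n.*2.+1`!%:R) (_ ^+ _) => d d' X0.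
by ring.
Qed.

End MapSeries.

Section Tutte.
Variables (F : fieldType) (f : {rmorphism KK -> F}).
Notation nu := (f nuK).
Notation q := (f qK).
Notation w := (f wK).
Notation m := (mcoef f).

Lemma conv_mu x y x' y' n : conv (mu f x y) (mu f x' y') n.*2.+1 =
  \sum_(i < n.+1) m x y i * m x' y' (n - i)%N.
Proof.
rewrite /conv (sum_odd_even (fun k => mu f x y k.+1 * mu f x' y' (n.*2.+1 - k)%N)).
rewrite [X in _ + X]big1 ?addr0 => [|i _]; last first.
  by rewrite /mu /= odd_double /= mul0r.
apply: eq_bigr => -[i /= li] _; rewrite /mu /= odd_double /= uphalf_double.
have -> : (n.*2.+1 - i.*2 = (n - i).*2.+1)%N by rewrite subSn ?leq_double // doubleB.
by rewrite /= odd_double /= uphalf_double.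
Qed.

Lemma tutte x y n :
  (x - 1) * (y - 1) * m x y n.+1 =
  (x - 1) * (y - 1) *
    (x * y * w * (q * y + (nu - 1) * (y - 1)) * \sum_(i < n.+1) m x y i * m 1 y (n - i)%N +
     x * y * (x * nu - 1) * \sum_(i < n.+1) m x y i * m x 1 (n - i)%N) +
  (x - 1) * x * y * (y * m x y n - m x 1 n) +
  (nu - 1) * (y - 1) * x * y * w * (x * m x y n - m 1 y n).
Proof.
(* A map with [n.+1] edges and a leg has [n.*2.+3] darts; taking all of them for [A] leaves no
   isolated dart. *)
pose T : finType := 'I_(n.*2.+3); pose r : T := ord0; pose A := [set: T].
have rA : r \in A by rewrite inE.
have cA : #|A| = n.*2.+3 by rewrite cardsT card_ord.
have cC : #|~: A| = 0%N by rewrite setCT cards0.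
have cT : #|T| = n.*2.+3 by rewrite card_ord.
have A1 : (1 < #|A|)%N by rewrite cA.
have MU x' y' (B : {set T}) t (tB : t \in B) := mapsum_mu f x' y' tB.
have q0 := q_neq0 f; have w0 := w_neq0 f.
have [dI [fP [dN [fI [cP [cN [[E0 E1 E2 E3] [E4 E5 E6]]]]]]]] :=
  mapsum_decomposition nu q w (natr_neq0 f) rA A1 x y.
have wq0 : w * q != 0 by rewrite mulf_neq0.
have fa0 : n.*2.+2`!%:R != 0 :> F by rewrite -(prednK (fact_gt0 _)) natr_neq0.
have SI x1 y1 x2 y2 := sum_isthmus_mu q0 w0 MU x1 y1 x2 y2 rA cA.
have SN := sum_nonisthmus_mu q0 w0 MU x y rA cA.
rewrite !SI !conv_mu cC cT in E1 E4 E5 E6.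
rewrite (SN (fun u v => y * u - v)) in E2; last by move=> k u v; rewrite mulrBr mulrCA.
rewrite (SN (fun u v => x * u - v)) in E3; last by move=> k u v; rewrite mulrBr mulrCA.
rewrite MU // cA cC in E0; rewrite cC in E2 E3.
have MO x' y' : mu f x' y' n.*2.+1 = m x' y' n by rewrite /mu /= odd_double /= uphalf_double.
have MS : mu f x y n.*2.+3 = m x y n.+1 by rewrite /mu /= odd_double /= uphalf_double.
rewrite MS -[n.*2.+3.-1]/(n.*2.+2) in E0; rewrite !MO in E2 E3.
set S1 := \sum_(i < _) _ * m 1 y _ in E1 E6 *; set S2 := \sum_(i < _) _ * m x 1 _ in E4 E5 *.
move: (m x y n) (m x 1 n) (m 1 y n) (m x y n.+1) E0 E2 E3 => M0 M1 M2 M3 E0 E2 E3.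
move: (n.*2.+2`!%:R) fa0 E0 E1 E2 E3 E4 E5 E6 => d d0 E0 E1 E2 E3 E4 E5 E6.
(* The isthmus identities carry powers of [w * q] that depend on the number of darts. Cancelling [Z]
   or [ZZ] leaves the common factor [d * (w * q)] in all six terms. *)
pose Z := (w * q) ^+ n.*2.+4; pose ZZ := (w * q) ^+ n.*2.+4.+1.
have Z0 : Z != 0 by rewrite expf_neq0.
have ZZ0 : ZZ != 0 by rewrite expf_neq0.
have EZ : (w * q) ^+ (n.*2.+3 + 3) = Z * (w * q) ^+ 2 by rewrite -exprD; congr (_ ^+ _); rewrite addnS addSn.
have EZZ : (w * q) ^+ (n.*2.+3 + 3) = ZZ * (w * q) by rewrite -exprSr; congr (_ ^+ _); rewrite !addnS addn0.
have EW : ZZ = w * (w ^+ n.*2.+4 * q ^+ n.*2.+4.+1) by rewrite /ZZ exprMn exprS mulrA.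
have D1 : dI = d * (w * q) * (x * y ^+ 2 * (w * q) * S1).
  by apply: (mulIf Z0); rewrite [LHS]E1 EZ; ring.
have D4 : fP = d * (w * q) * (x * y * S2).
  by apply: (mulIf ZZ0); rewrite [LHS]E4 EZZ; ring.
have D5 : fI = d * (w * q) * (x ^+ 2 * y * S2).
  by apply: (mulIf ZZ0); rewrite [LHS]E5 EZZ; ring.
have D6 : cP = d * (w * q) * (x * y * w * S1).
  by apply: (mulIf ZZ0); rewrite [in LHS]EW mulrCA E6 EZZ; ring.
have D2 : (y - 1) * dN = d * (w * q) * (x * y * (y * M0 - M1)).
  by apply: (mulIf (expf_neq0 2 wq0)); rewrite E2; ring.
have D3 : (x - 1) * cN = d * (w * q) * (x * y * w * (x * M0 - M2)).
  by apply: (mulIf (mulf_neq0 w0 (expf_neq0 2 q0))); rewrite E3; ring.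
apply: (mulfI (mulf_neq0 d0 wq0)).
have -> : d * (w * q) * ((x - 1) * (y - 1) * M3) = (x - 1) * (y - 1) * (d * (w * q) ^+ 1 * M3) by ring.
rewrite E0 D1 D4 D5 D6.
transitivity ((x - 1) * ((y - 1) * dN) + (y - 1) * (nu - 1) * ((x - 1) * cN) +
  (x - 1) * (y - 1) * (d * (w * q) * (x * y ^+ 2 * (w * q) * S1) +
  (x - 1) * (d * (w * q) * (x * y * S2)) +
  (nu - 1) * (d * (w * q) * (x ^+ 2 * y * S2) + (y - 1) * (d * (w * q) * (x * y * w * S1))))).
  by ring.
by rewrite D2 D3; ring.
Qed.
End Tutte.

(** * Formal power series *)

(** Convertible to [ps], but with a head of its own for the ring structure, whose operations are
    those of the statement by conversion. *)
Definition pser (F : Type) : Type := nat -> F.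

HB.instance Definition _ (F : Type) := gen_eqMixin (pser F).
HB.instance Definition _ (F : Type) := gen_choiceMixin (pser F).

Section PowerSeries.
Variable F : fieldType.
Implicit Types a b c : pser F.

Lemma pserP a b : (forall n, a n = b n) -> a = b.
Proof. by move=> E; apply: funext. Qed.

Definition pser_add a b : pser F := @ps_add F a b.
Definition pser_opp a : pser F := @ps_opp F a.
Definition pser_zero : pser F := fun=> 0.
Definition pser_mul a b : pser F := @ps_mul F a b.
Definition pser_one : pser F := @ps_c F 1.

Fact pser_addA : associative pser_add.
Proof. by move=> a b c; apply: pserP => n; apply: addrA. Qed.
Fact pser_addC : commutative pser_add.
Proof. by move=> a b; apply: pserP => n; apply: addrC. Qed.
Fact pser_add0 : left_id pser_zero pser_add.
Proof. by move=> a; apply: pserP => n; apply: add0r. Qed.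
Fact pser_addN : left_inverse pser_zero pser_opp pser_add.
Proof. by move=> a; apply: pserP => n; apply: addNr. Qed.

HB.instance Definition _ := @GRing.isZmodule.Build (pser F) pser_zero pser_opp pser_add
  pser_addA pser_addC pser_add0 pser_addN.

(* The ring laws are those of polynomials, read on truncations. *)
Definition agree n a (p : {poly F}) := forall i, (i < n)%N -> a i = p`_i.

Lemma agree_trunc n a : agree n a (\poly_(i < n) a i).
Proof. by move=> i li; rewrite coef_poly li. Qed.

Lemma agree_mul n a b p r : agree n a p -> agree n b r -> agree n (pser_mul a b) (p * r).
Proof.
move=> Ha Hb i li; rewrite /pser_mul /ps_mul coefM; apply: eq_bigr => -[j /= lj] _.
by rewrite Ha ?Hb //; lia.
Qed.

Lemma agree_eq a b : (forall n, exists2 p, agree n a p & agree n b p) -> a = b.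
Proof.
by move=> H; apply: pserP => n; have [p Ha Hb] := H n.+1; rewrite Ha ?Hb.
Qed.

Fact pser_mulA : associative pser_mul.
Proof.
move=> a b c; apply: agree_eq => n; have Ha := @agree_trunc n a.
have Hb := @agree_trunc n b; have Hc := @agree_trunc n c.
exists ((\poly_(i < n) a i) * ((\poly_(i < n) b i) * (\poly_(i < n) c i))).
  by do 2?[apply: agree_mul => //].
by rewrite mulrA; do 2?[apply: agree_mul => //].
Qed.
Fact pser_mulC : commutative pser_mul.
Proof.
move=> a b; apply: agree_eq => n; exists ((\poly_(i < n) a i) * (\poly_(i < n) b i)).
  by apply: agree_mul; apply: agree_trunc.
by rewrite mulrC; apply: agree_mul; apply: agree_trunc.
Qed.
Fact pser_mul1 : left_id pser_one pser_mul.
Proof.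
move=> a; apply: agree_eq => n; exists (\poly_(i < n) a i); last exact: agree_trunc.
rewrite -[X in agree _ _ X]mul1r; apply: agree_mul; last exact: agree_trunc.
by move=> [|i] _; rewrite coef1.
Qed.
Fact pser_mulD : left_distributive pser_mul pser_add.
Proof.
move=> a b c; apply: pserP => n; rewrite /pser_mul /pser_add /ps_mul /ps_add.
by rewrite -big_split; apply: eq_bigr => i _; apply: mulrDl.
Qed.
Fact pser_one_neq0 : pser_one != 0.
Proof.
apply/eqP => /(congr1 (fun a : pser F => a 0%N)) /= /eqP; exact/negP/oner_neq0.
Qed.

HB.instance Definition _ := @GRing.Zmodule_isComNzRing.Build (pser F) pser_one pser_mul
  pser_mulA pser_mulC pser_mul1 pser_mulD pser_one_neq0.

Lemma pserD a b n : (a + b) n = a n + b n. Proof. by []. Qed.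
Lemma pserN a n : (- a) n = - a n. Proof. by []. Qed.
Lemma pserM a b n : (a * b) n = \sum_(i < n.+1) a i * b (n - i)%N. Proof. by []. Qed.
Lemma pser1 n : (1 : pser F) n = if n is 0%N then 1 else 0. Proof. by []. Qed.
Lemma pser0 n : (0 : pser F) n = 0. Proof. by []. Qed.

(** The coefficients of an inverse depend on all earlier ones; the fuel makes this recursion
    structural. *)
Fixpoint pser_inv_fuel a m n : F := if m is m'.+1 then
  (a 0%N)^-1 * ((n == 0%N)%:R - \sum_(i < n) a (n - i)%N * pser_inv_fuel a m' i) else 0.

Definition pser_unit : {pred pser F} := fun a => a 0%N != 0.
Definition pser_inv a : pser F := if a 0%N != 0 then fun n => pser_inv_fuel a n.+1 n else a.

Lemma pser_inv_fuelE a m n : (n < m)%N -> pser_inv_fuel a m n = pser_inv_fuel a n.+1 n.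
Proof.
elim/ltn_ind: n m => n IH [//|m] lm /=; congr (_ * (_ - _)); apply: eq_bigr => i _.
have li := ltn_ord i.
rewrite IH //; last by apply: leq_trans li _.
by rewrite [in RHS]IH.
Qed.

Fact pser_mulVx : {in pser_unit, left_inverse 1 pser_inv *%R}.
Proof.
move=> a; rewrite unfold_in => a0; rewrite mulrC; apply: pserP => n; rewrite pserM /pser_inv a0.
rewrite big_ord_recl /= subn0 mulrA divff // mul1r.
case: n => [|n]; first by rewrite !big_ord0 addr0 subr0.
rewrite sub0r [X in _ + X](reindex_inj rev_ord_inj) /= addrC; apply/eqP; rewrite subr_eq0; apply/eqP.
apply: eq_bigr => -[i /= li] _; rewrite /bump /= add1n.
have E : (n.+1 - (n.+1 - i.+1).+1)%N = i by lia.
rewrite E (_ : (n.+1 - i.+1).+1 = n.+1 - i)%N; last by lia.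
congr (_ * _); exact: esym (@pser_inv_fuelE a n.+1 i li).
Qed.
Fact pser_unitPl a b : b * a = 1 -> pser_unit a.
Proof.
move/(congr1 (fun a : pser F => a 0%N)); rewrite pserM big_ord1 /= /pser_unit => E.
by apply/eqP=> a0; move/eqP: E; rewrite a0 mulr0 eq_sym oner_eq0.
Qed.
Fact pser_inv_out : {in [predC pser_unit], pser_inv =1 id}.
Proof.
move=> a aU; rewrite /pser_inv; case: ifP => // E.
by move: aU; rewrite inE unfold_in /= E.
Qed.

HB.instance Definition _ := @GRing.ComNzRing_hasMulInverse.Build (pser F) pser_unit pser_inv
  pser_mulVx pser_unitPl pser_inv_out.

Lemma pser_neq0 a : a != 0 -> exists n, a n != 0 /\ forall i, (i < n)%N -> a i = 0.
Proof.
move=> a0; have ex : exists n, a n != 0.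
  by apply: contrapT => H; case/eqP: a0; apply: pserP => n; apply: contrapT => /eqP E; apply: H; exists n.
exists (ex_minn ex); case: ex_minnP => m am mm; split=> // i li.
by apply/eqP; apply: contraTT li => /mm; rewrite -leqNgt.
Qed.

Fact pser_integral : GRing.integral_domain_axiom (pser F).
Proof.
move=> a b ab0; apply/norP => -[/pser_neq0 [m [am ml]] /pser_neq0 [n [bn nl]]].
have := congr1 (fun a : pser F => a (m + n)%N) ab0.
rewrite pserM pser0 (bigD1 (inord m)) //= inordK ?ltnS ?leq_addr // addKn big1 ?addr0.
  by move/eqP; rewrite mulf_eq0 (negbTE am) (negbTE bn).
move=> i; rewrite -val_eqE /= inordK ?ltnS ?leq_addr // => ni.
have [li|li] := ltnP i m; first by rewrite ml ?mul0r.
rewrite nl ?mulr0 //; have := ltn_ord i; lia.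
Qed.

HB.instance Definition _ := @GRing.ComUnitRing_isIntegral.Build (pser F) pser_integral.

Definition psc (c : F) : pser F := ps_c c.
Lemma psc_is_zmod : zmod_morphism psc.
Proof. by move=> c d; apply: pserP => -[|n]; rewrite /psc //= pserD pserN /= subr0. Qed.
Lemma psc_mulE (c : F) a n : (psc c * a) n = c * a n.
Proof.
by rewrite pserM big_ord_recl subn0 /= big1 ?addr0 // => i _; rewrite mul0r.
Qed.
Lemma psc_is_monoid : monoid_morphism psc.
Proof.
split; first by apply: pserP => -[|n].
by move=> c d; apply: pserP => n; rewrite psc_mulE; case: n => //= n; rewrite mulr0.
Qed.
HB.instance Definition _ := GRing.isZmodMorphism.Build F (pser F) psc psc_is_zmod.
HB.instance Definition _ := GRing.isMonoidMorphism.Build F (pser F) psc psc_is_monoid.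

Definition pst : pser F := ps_t F.

Lemma pstM a n : (pst * a) n = if n is m.+1 then a m else 0.
Proof.
rewrite pserM big_ord_recl /= mul0r add0r; case: n => [|n]; first by rewrite big_ord0.
rewrite big_ord_recl /= /bump /= mul1r subn1 /= big1 ?addr0 // => i _.
by rewrite /pst /ps_t /= mul0r.
Qed.

Lemma pstXM k a n : (pst ^+ k * a) n = if (k <= n)%N then a (n - k)%N else 0.
Proof.
elim: k n => [|k IH] n; first by rewrite mul1r subn0.
by rewrite exprS -mulrA pstM; case: n => [//|n]; rewrite IH.
Qed.

Lemma pst_neq0 : pst != 0.
Proof.
apply/eqP => /(congr1 (fun a : pser F => a 1%N)) /= /eqP; exact/negP/oner_neq0.
Qed.

Definition pscoef0 a : F := a 0%N.
Lemma pscoef0_is_zmod : zmod_morphism pscoef0. Proof. by []. Qed.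
Lemma pscoef0_is_monoid : monoid_morphism pscoef0.
Proof. by split=> // a b; rewrite /pscoef0 pserM big_ord1. Qed.
HB.instance Definition _ := GRing.isZmodMorphism.Build (pser F) F pscoef0 pscoef0_is_zmod.
HB.instance Definition _ := GRing.isMonoidMorphism.Build (pser F) F pscoef0 pscoef0_is_monoid.

Lemma pser_unitE a : (a \is a GRing.unit) = (a 0%N != 0).
Proof. by []. Qed.

(** The sum of t^m u_m over all m; the factor t^m makes each coefficient a finite sum. *)
Definition tsum (u : nat -> pser F) : pser F := fun k => \sum_(m < k.+1) u m (k - m)%N.

Lemma tsumD u v : tsum (fun n => u n + v n) = tsum u + tsum v.
Proof. by apply: pserP => k; rewrite pserD -big_split. Qed.

Lemma tsum_shift u : tsum u = u 0%N + pst * tsum (fun n => u n.+1).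
Proof.
apply: pserP => k; rewrite pserD pstM /tsum big_ord_recl subn0; congr (_ + _).
by case: k => [|k]; [rewrite big_ord0|apply: eq_bigr => i _; rewrite subSS].
Qed.

Lemma tsum_trunc u n : exists v, tsum u = \sum_(m < n) pst ^+ m * u m + pst ^+ n * v.
Proof.
elim: n u => [|n IH] u; first by exists (tsum u); rewrite big_ord0 add0r mul1r.
have [v E] := IH (fun n => u n.+1); exists v.
rewrite tsum_shift E big_ord_recl mul1r -addrA; congr (_ + _).
rewrite mulrDr mulr_sumr !exprS mulrA; congr (_ + _).
by apply: eq_bigr => i _; rewrite mulrA -exprS.
Qed.

Lemma eq_mod_t a b : (forall n, exists c, a = b + pst ^+ n * c) -> a = b.
Proof.
move=> H; apply: pserP => n; have [c ->] := H n.+1.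
by rewrite pserD pstXM ltnn addr0.
Qed.

Lemma tsumZ c u : tsum (fun n => c * u n) = c * tsum u.
Proof.
apply: eq_mod_t => n; have [v ->] := tsum_trunc u n.
have [v' ->] := tsum_trunc (fun n => c * u n) n.
exists (v' - c * v); rewrite mulrDr mulr_sumr mulrBr.
rewrite (eq_bigr (fun m : 'I_n => c * (pst ^+ m * u m))) => [|m _]; last by rewrite mulrCA.
by ring.
Qed.

(** Modulo t^n both factors are polynomials in t whose coefficients are series, and the inner sum is
    the coefficient of their product. *)
Lemma tsumM u v : tsum u * tsum v = tsum (fun n => \sum_(i < n.+1) u i * v (n - i)%N).
Proof.
apply: eq_mod_t => n.
have [u' Eu] := tsum_trunc u n; have [v' ev_ser] := tsum_trunc v n.
have [w' Ew] := tsum_trunc (fun n => \sum_(i < n.+1) u i * v (n - i)%N) n.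
pose pu := \poly_(i < n) u i; pose pv := \poly_(i < n) v i.
have Hu : pu.[pst] = \sum_(m < n) pst ^+ m * u m.
  by rewrite horner_poly; apply: eq_bigr => i _; rewrite mulrC.
have Hv : pv.[pst] = \sum_(m < n) pst ^+ m * v m.
  by rewrite horner_poly; apply: eq_bigr => i _; rewrite mulrC.
have Hw : (take_poly n (pu * pv)).[pst] =
    \sum_(m < n) pst ^+ m * (\sum_(i < m.+1) u i * v (m - i)%N).
  rewrite horner_poly; apply: eq_bigr => -[m /= lm] _; rewrite mulrC; congr (_ * _).
  rewrite coefM; apply: eq_bigr => -[i /= li] _; rewrite !coef_poly.
  by rewrite (_ : (i < n)%N = true) 1?(_ : (m - i < n)%N = true) //; lia.
have E : pu.[pst] * pv.[pst] = (take_poly n (pu * pv)).[pst] + (drop_poly n (pu * pv)).[pst] * pst ^+ n.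
  by rewrite -hornerM -{1}(poly_take_drop n (pu * pv)) hornerD hornerM hornerXn.
exists ((drop_poly n (pu * pv)).[pst] - w' + u' * tsum v + pu.[pst] * v').
rewrite Ew -Hw mulrDr mulrDr mulrBr.
have -> : tsum u * tsum v = pu.[pst] * pv.[pst] + pst ^+ n * (u' * tsum v) + pst ^+ n * (pu.[pst] * v').
  by rewrite Eu -Hu mulrDl {1}ev_ser -Hv mulrDr; ring.
by rewrite E; ring.
Qed.

End PowerSeries.

(** * Values of rational functions at power series *)

Section Evaluation.
Variable K : fieldType.
(* [Kx] stands for the field of rational functions; only an embedding of the polynomials is used,
   which keeps the unifier away from the quotient construction of [{fraction _}]. *)
Variables (Kx : fieldType) (iota : {rmorphism {poly K} -> Kx}).
Hypothesis iota_inj : injective iota.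
Notation R := (pser Kx).
Implicit Types (Y U u : R) (h : Kx) (p r : {poly K}).

Lemma iota_eq0 p : (iota p == 0) = (p == 0).
Proof. by rewrite -(rmorph0 iota) (inj_eq iota_inj). Qed.

Definition KtoX (k : K) : Kx := iota k%:P.
Lemma KtoX_is_zmod : zmod_morphism KtoX.
Proof. by move=> a b; rewrite /KtoX polyCB rmorphB. Qed.
Lemma KtoX_is_monoid : monoid_morphism KtoX.
Proof. by split=> [|a b]; rewrite /KtoX ?rmorph1 // polyCM rmorphM. Qed.
HB.instance Definition _ := GRing.isZmodMorphism.Build K Kx KtoX KtoX_is_zmod.
HB.instance Definition _ := GRing.isMonoidMorphism.Build K Kx KtoX KtoX_is_monoid.

Definition KtoPs (k : K) : R := psc (KtoX k).
Lemma KtoPs_is_zmod : zmod_morphism KtoPs. Proof. by move=> a b; rewrite /KtoPs !rmorphB. Qed.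
Lemma KtoPs_is_monoid : monoid_morphism KtoPs.
Proof. by split=> [|a b]; rewrite /KtoPs ?rmorph1 // !rmorphM. Qed.
HB.instance Definition _ := GRing.isZmodMorphism.Build K R KtoPs KtoPs_is_zmod.
HB.instance Definition _ := GRing.isMonoidMorphism.Build K R KtoPs KtoPs_is_monoid.

Definition ev Y p : R := (map_poly KtoPs p).[Y].
Lemma ev_is_zmod Y : zmod_morphism (ev Y).
Proof. by move=> p r; rewrite /ev rmorphB hornerD hornerN. Qed.
Lemma ev_is_monoid Y : monoid_morphism (ev Y).
Proof. by split=> [|p r]; rewrite /ev ?rmorph1 ?hornerC // rmorphM hornerM. Qed.
HB.instance Definition _ Y := GRing.isZmodMorphism.Build {poly K} R (ev Y) (ev_is_zmod Y).
HB.instance Definition _ Y := GRing.isMonoidMorphism.Build {poly K} R (ev Y) (ev_is_monoid Y).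

Lemma evM Y p r : ev Y (p * r) = ev Y p * ev Y r. Proof. exact: rmorphM. Qed.
Lemma evD Y p r : ev Y (p + r) = ev Y p + ev Y r. Proof. exact: rmorphD. Qed.
Lemma evB Y p r : ev Y (p - r) = ev Y p - ev Y r. Proof. exact: rmorphB. Qed.
Lemma ev0 Y : ev Y 0 = 0. Proof. exact: rmorph0. Qed.
Lemma ev_one Y : ev Y 1 = 1. Proof. exact: rmorph1. Qed.
Lemma pscoef0M (a b : R) : (a * b) 0%N = a 0%N * b 0%N.
Proof. exact: (rmorphM (@pscoef0 Kx)). Qed.
Lemma evX Y : ev Y 'X = Y. Proof. by rewrite /ev map_polyX hornerX. Qed.
Lemma evC Y c : ev Y c%:P = KtoPs c. Proof. by rewrite /ev map_polyC hornerC. Qed.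

Lemma ev_coef0 Y p : ev Y p 0%N = (map_poly KtoX p).[Y 0%N].
Proof.
rewrite -[LHS]/(pscoef0 (ev Y p)) /ev -horner_map /= -map_poly_comp.
by congr (_.[_]); apply: eq_map_poly => c.
Qed.

(** The value of [h] at [Y], as a relation. The denominator has to be a unit of the power series
    ring, so that values are again power series. *)
Definition ev_rat Y h u := exists p r,
  [/\ ev Y r 0%N != 0, h * iota r = iota p & u * ev Y r = ev Y p].

Lemma ev_neq0 Y r : ev Y r 0%N != 0 -> ev Y r != 0 /\ iota r != 0.
Proof.
move=> r0; split; first by apply: contraNneq r0 => ->.
by rewrite iota_eq0; apply: contraNneq r0 => ->; rewrite rmorph0.
Qed.

Lemma ev_mul_neq0 Y r r' : ev Y r 0%N != 0 -> ev Y r' 0%N != 0 -> ev Y (r * r') 0%N != 0.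
Proof.
move=> r0 r0'; rewrite evM pscoef0M.
exact: mulf_neq0.
Qed.

Lemma ev_rat_uniq Y h u u' : ev_rat Y h u -> ev_rat Y h u' -> u = u'.
Proof.
move=> [p [r [r0 hr ur]]] [p' [r' [r0' hr' ur']]].
have [e0 f0] := ev_neq0 r0; have [e0' f0'] := ev_neq0 r0'.
have E : p * r' = p' * r.
  by apply: iota_inj; rewrite !rmorphM -hr -hr'; ring.
have := congr1 (ev Y) E; rewrite !evM -ur -ur' => E'.
apply: (mulIf e0); apply: (mulIf e0'); rewrite E'; ring.
Qed.

Lemma ev_rat_poly Y p : ev_rat Y (iota p) (ev Y p).
Proof.
by exists p, 1; rewrite ev_one rmorph1 !mulr1 pser1 oner_neq0.
Qed.

Lemma ev_rat_const Y c : ev_rat Y (KtoX c) (KtoPs c).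
Proof. by rewrite -(evC Y); apply: ev_rat_poly. Qed.

Lemma ev_ratD Y h u h' u' : ev_rat Y h u -> ev_rat Y h' u' -> ev_rat Y (h + h') (u + u').
Proof.
move=> [p [r [r0 hr ur]]] [p' [r' [r0' hr' ur']]].
exists (p * r' + p' * r), (r * r'); split; first exact: ev_mul_neq0.
  by rewrite rmorphD !rmorphM -hr -hr'; ring.
by rewrite evD !evM -ur -ur'; ring.
Qed.

Lemma ev_ratM Y h u h' u' : ev_rat Y h u -> ev_rat Y h' u' -> ev_rat Y (h * h') (u * u').
Proof.
move=> [p [r [r0 hr ur]]] [p' [r' [r0' hr' ur']]].
exists (p * p'), (r * r'); split; first exact: ev_mul_neq0.
  by rewrite !rmorphM -hr -hr'; ring.
by rewrite !evM -ur -ur'; ring.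
Qed.

Lemma ev_rat_sum Y n (h : nat -> Kx) (u : nat -> R) : (forall i, ev_rat Y (h i) (u i)) ->
  ev_rat Y (\sum_(i < n) h i) (\sum_(i < n) u i).
Proof.
move=> H; elim: n => [|n IH]; last by rewrite !big_ord_recr; apply: ev_ratD.
by rewrite !big_ord0 -(rmorph0 iota) -(ev0 Y); apply: ev_rat_poly.
Qed.

Definition ev_ser Y (G : R) U := exists2 u : nat -> R, forall m, ev_rat Y (G m) (u m) & U = tsum u.

Lemma ev_ser_uniq Y G U U' : ev_ser Y G U -> ev_ser Y G U' -> U = U'.
Proof.
move=> [u H ->] [u' H' ->]; congr tsum; apply: funext => m; exact: ev_rat_uniq (H m) (H' m).
Qed.

Lemma ev_serD Y G U G' U' : ev_ser Y G U -> ev_ser Y G' U' -> ev_ser Y (G + G') (U + U').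
Proof.
move=> [u H ->] [u' H' ->]; exists (fun n => u n + u' n); last by rewrite tsumD.
by move=> m; rewrite pserD; apply: ev_ratD.
Qed.

Lemma ev_serM Y G U G' U' : ev_ser Y G U -> ev_ser Y G' U' -> ev_ser Y (G * G') (U * U').
Proof.
move=> [u H ->] [u' H' ->]; exists (fun n => \sum_(i < n.+1) u i * u' (n - i)%N).
  move=> m; rewrite pserM; apply: (@ev_rat_sum Y m.+1 (fun i => G i * G' (m - i)%N)
    (fun i => u i * u' (m - i)%N)) => i; exact: ev_ratM.
by rewrite tsumM.
Qed.

Lemma ev_ser_polys Y (P : nat -> {poly K}) :
  ev_ser Y (fun n => iota (P n)) (tsum (fun n => ev Y (P n))).
Proof. by exists (fun n => ev Y (P n)) => // m; apply: ev_rat_poly. Qed.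

Lemma tsum_psc (a : R) : tsum (fun n => psc (a n)) = a.
Proof.
apply: pserP => n; rewrite /tsum big_ord_recr /= subnn big1 ?add0r // => -[i /= li] _.
by rewrite /psc; case E: (n - i)%N => //; lia.
Qed.

Lemma ev_ser_const Y (a : pser K) : ev_ser Y (fun n => KtoX (a n)) (fun n => KtoX (a n)).
Proof.
exists (fun n => KtoPs (a n)); first by move=> m; apply: ev_rat_const.
by rewrite /KtoPs (tsum_psc (fun n => KtoX (a n))).
Qed.

Definition psmap (a : pser K) : R := fun n => KtoX (a n).

Lemma psmap_is_zmod : zmod_morphism psmap.
Proof. by move=> a b; apply: pserP => n; rewrite pserD pserN /psmap pserD pserN rmorphB. Qed.
Lemma psmap_is_monoid : monoid_morphism psmap.
Proof.
split; first by apply: pserP => -[|n]; rewrite /psmap pser1 ?rmorph1 ?rmorph0.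
move=> a b; apply: pserP => n; rewrite /psmap !pserM rmorph_sum; apply: eq_bigr => i _.
exact: rmorphM.
Qed.
HB.instance Definition _ := GRing.isZmodMorphism.Build (pser K) R psmap psmap_is_zmod.
HB.instance Definition _ := GRing.isMonoidMorphism.Build (pser K) R psmap psmap_is_monoid.

Lemma psmap_t : psmap (pst K) = pst Kx.
Proof. by apply: pserP => n; rewrite /psmap /pst /ps_t; case: ifP; rewrite ?rmorph1 ?rmorph0. Qed.

Lemma ev_ser_psmap Y a : ev_ser Y (psmap a) (psmap a). Proof. exact: ev_ser_const. Qed.

Lemma ev_ser_t Y : ev_ser Y (pst Kx) (pst Kx).
Proof. by rewrite -psmap_t; apply: ev_ser_psmap. Qed.

Lemma ev_ser_1 Y : ev_ser Y 1 1.
Proof. by rewrite -(rmorph1 psmap); apply: ev_ser_psmap. Qed.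

Lemma ev_serX Y G U n : ev_ser Y G U -> ev_ser Y (G ^+ n) (U ^+ n).
Proof.
move=> E; elim: n => [|n IH]; first exact: ev_ser_1.
by rewrite !exprS; apply: ev_serM.
Qed.

Lemma ev_serN Y G U : ev_ser Y G U -> ev_ser Y (- G) (- U).
Proof.
move=> E; rewrite -mulN1r -(mulN1r U) -(rmorph1 psmap) -rmorphN; apply: ev_serM => //.
exact: ev_ser_psmap.
Qed.

Definition psX : R := psc (iota 'X).

Lemma ev_ser_X Y : ev_ser Y psX Y.
Proof.
exists (fun n => if n is 0%N then Y else 0).
  move=> [|m]; rewrite /psX /psc /=; first by rewrite -[X in ev_rat _ _ X](evX Y); apply: ev_rat_poly.
  by rewrite -(rmorph0 iota) -(ev0 Y); apply: ev_rat_poly.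
apply: pserP => n; rewrite /tsum big_ord_recl /= subn0 big1 ?addr0 //.
Qed.

Lemma ev_ser_X1 Y : ev_ser Y (psX - 1) (Y - 1).
Proof. by apply: ev_serD; [apply: ev_ser_X|apply: ev_serN; apply: ev_ser_1]. Qed.

(** True at both roots, for different reasons: the constant term of [Y1] is 1, and that of [Y2] is
    transcendental over [K]. *)
Definition evaluable Y := forall r, r.[1] != 0 -> ev Y r 0%N != 0.
Definition regular1 h := exists p r, r.[1] != 0 /\ h * iota r = iota p.

Lemma ev_rat_exists Y h : evaluable Y -> regular1 h -> exists u, ev_rat Y h u.
Proof.
move=> gY [p [r [r1 hr]]]; exists (ev Y p / ev Y r), p, r; split=> //; first exact: gY.
by rewrite mulrVK // pser_unitE gY.
Qed.

Lemma ev_ser_exists Y (G : R) : evaluable Y -> (forall n, regular1 (G n)) -> exists U, ev_ser Y G U.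
Proof.
move=> gY rG; have [u Hu] := choice (fun n => ev_rat_exists gY (rG n)).
by exists (tsum u), u.
Qed.

Definition val1 h (c : K) := exists p r, [/\ r.[1] != 0, h * iota r = iota p & c * r.[1] = p.[1]].

Lemma regular1_val h : regular1 h -> exists c, val1 h c.
Proof. by move=> [p [r [r1 hr]]]; exists (p.[1] / r.[1]), p, r; rewrite divfK. Qed.

Lemma val1D h c h' c' : val1 h c -> val1 h' c' -> val1 (h + h') (c + c').
Proof.
move=> [p [r [r1 hr cr]]] [p' [r' [r1' hr' cr']]].
exists (p * r' + p' * r), (r * r'); split; first by rewrite hornerM mulf_neq0.
  by rewrite rmorphD !rmorphM -hr -hr'; ring.
by rewrite hornerD !hornerM -cr -cr'; ring.
Qed.

Lemma val1M h c h' c' : val1 h c -> val1 h' c' -> val1 (h * h') (c * c').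
Proof.
move=> [p [r [r1 hr cr]]] [p' [r' [r1' hr' cr']]].
exists (p * p'), (r * r'); split; first by rewrite hornerM mulf_neq0.
  by rewrite !rmorphM -hr -hr'; ring.
by rewrite !hornerM -cr -cr'; ring.
Qed.

Lemma val1_poly p : val1 (iota p) p.[1].
Proof. by exists p, 1; rewrite hornerC rmorph1 !mulr1 oner_neq0. Qed.

Lemma val1_const c : val1 (KtoX c) c.
Proof. by have := val1_poly c%:P; rewrite hornerC. Qed.

Definition val1_ser (G : R) (g : pser K) := forall n, val1 (G n) (g n).

Lemma val1_serD G g G' g' : val1_ser G g -> val1_ser G' g' -> val1_ser (G + G') (g + g').
Proof. by move=> H H' n; rewrite !pserD; apply: val1D. Qed.

Lemma val1_serM G g G' g' : val1_ser G g -> val1_ser G' g' -> val1_ser (G * G') (g * g').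
Proof.
move=> H H' n; rewrite !pserM.
have S m (h : nat -> Kx) (c : nat -> K) : (forall i, val1 (h i) (c i)) ->
    val1 (\sum_(i < m) h i) (\sum_(i < m) c i).
  move=> Hi; elim: m => [|m IH]; last by rewrite !big_ord_recr; apply: val1D.
  by rewrite !big_ord0 -(rmorph0 KtoX); apply: val1_const.
apply: (S n.+1 (fun i => G i * G' (n - i)%N) (fun i => g i * g' (n - i)%N)) => i.
exact: val1M.
Qed.

Lemma val1_ser_psmap a : val1_ser (psmap a) a. Proof. by move=> n; apply: val1_const. Qed.

Lemma val1_serX G g n : val1_ser G g -> val1_ser (G ^+ n) (g ^+ n).
Proof.
move=> E; elim: n => [|n IH]; last by rewrite !exprS; apply: val1_serM.
by rewrite !expr0 -(rmorph1 psmap); apply: val1_ser_psmap.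
Qed.

Lemma val1_zero h : val1 h 0 -> exists2 h', regular1 h' & (iota 'X - 1) * h' = h.
Proof.
move=> [p [r [r1 hr]]]; rewrite mul0r => /esym/eqP; rewrite -/(root p 1) => /factor_theorem[p' Ep].
have f0 : iota r != 0.
  by rewrite iota_eq0; apply: contraNneq r1 => ->; rewrite horner0.
exists (iota p' / iota r); first by exists p', r; rewrite divfK.
apply: (mulIf f0); rewrite hr Ep rmorphM rmorphB polyC1 rmorph1 -mulrA divfK //.
by rewrite mulrC.
Qed.

(** * Invariants without pole are constant; descent on the order of the pole *)

Section Invariants.
Variables Y1 Y2 J J1 J2 : R.
Hypothesis Y10 : Y1 0%N = 1.
Hypothesis Y20 : forall p, ev Y2 p 0%N = 0 -> p = 0.
Hypotheses (Y1n : Y1 - 1 != 0) (Y2n : Y2 - 1 != 0).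
Hypotheses (EJ1 : ev_ser Y1 J J1) (EJ2 : ev_ser Y2 J J2) (VJ : val1_ser J (pst K)).
Hypothesis inv : J1 * (Y2 - 1) = J2 * (Y1 - 1).

Lemma ev_Y1 p : ev Y1 p 0%N = KtoX p.[1].
Proof. by rewrite ev_coef0 Y10 -(rmorph1 KtoX) horner_map. Qed.

Lemma evaluable1 : evaluable Y1.
Proof. by move=> r r1; rewrite ev_Y1 fmorph_eq0. Qed.

Lemma evaluable2 : evaluable Y2.
Proof. by move=> r; apply: contraNneq => /Y20 ->; rewrite horner0. Qed.

Lemma constant_of_equal (G : R) U : ev_ser Y1 G U -> ev_ser Y2 G U -> exists a : pser K, G = psmap a.
Proof.
move=> [u1 H1 E1] [u2 H2 E2].
have C n : exists c, G n = KtoX c.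
  elim/ltn_ind: n => n IH.
  (* The terms of index below n are constants, with equal values at both roots; the coefficients of
     t^n thus leave only the constant terms of the n-th values. *)
  have eq0 : u1 n 0%N = u2 n 0%N.
    have := congr1 (fun u : R => u n) (etrans (esym E1) E2); rewrite /tsum !big_ord_recr /= subnn.
    have -> : \sum_(i < n) u1 i (n - i)%N = \sum_(i < n) u2 i (n - i)%N; last by move/addrI.
    apply: eq_bigr => i _; suff -> : u1 i = u2 i by [].
    have [c Ec] := IH i (ltn_ord i).
    have h1 := H1 i; have h2 := H2 i; rewrite Ec in h1 h2.
    by rewrite (ev_rat_uniq h1 (ev_rat_const _ c)) (ev_rat_uniq h2 (ev_rat_const _ c)).
  have [p [r [r0 _ ur]]] := H1 n; have [p' [r' [r0' hr' ur']]] := H2 n.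
  rewrite ev_Y1 fmorph_eq0 in r0.
  exists (p.[1] / r.[1]).
  have e1 : u1 n 0%N * KtoX r.[1] = KtoX p.[1].
    by rewrite -!ev_Y1 -ur pscoef0M.
  have uE : u1 n 0%N = KtoX (p.[1] / r.[1]).
    by apply: (mulIf (_ : KtoX r.[1] != 0)); rewrite ?fmorph_eq0 // e1 -rmorphM divfK.
  have e2 : u2 n 0%N * ev Y2 r' 0%N = ev Y2 p' 0%N.
    by rewrite -ur' pscoef0M.
  (* With c the value of [G n] at 1, [p' - c r'] vanishes at the transcendental constant term of
     [Y2], hence is zero. *)
  have /eqP : p' - (p.[1] / r.[1])%:P * r' = 0.
    apply: Y20; rewrite evB evM evC pserD pserN psc_mulE -e2 -eq0 uE.
    by rewrite subrr.
  rewrite subr_eq0 => /eqP Ep.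
  have [_ f0] := ev_neq0 r0'.
  by apply: (mulIf f0); rewrite hr' Ep rmorphM.
have [a Ha] := choice C; exists a; apply: pserP => n; exact: Ha.
Qed.

(* As J takes the value t at 1, t^(d+1) G - a J^(d+1) vanishes there if a is the value of G, and can be
   divided by X - 1. *)
Lemma invariant_decomposition d (G U1 U2 : R) :
  (forall n, regular1 (G n)) -> ev_ser Y1 G U1 -> ev_ser Y2 G U2 ->
  U1 * (Y2 - 1) ^+ d = U2 * (Y1 - 1) ^+ d ->
  exists e (a : nat -> pser K),
    pst Kx ^+ e * G = \sum_(i < d.+1) psmap (a i) * J ^+ i * (psX - 1) ^+ (d - i).
Proof.
elim: d G U1 U2 => [|d IH] G U1 U2 rG E1 E2.
  rewrite !expr0 !mulr1 => E; rewrite -E in E2; have [a ->] := constant_of_equal E1 E2.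
  by exists 0%N, (fun=> a); rewrite big_ord1 !expr0 !mulr1 mul1r.
move=> E.
have [a0 Ha] := choice (fun n => regular1_val (rG n)); pose a : pser K := a0.
pose D : R := pst Kx ^+ d.+1 * G - psmap a * J ^+ d.+1.
have VD : val1_ser D 0.
  have : val1_ser D (pst K ^+ d.+1 * a + (- a) * pst K ^+ d.+1).
    rewrite /D -mulNr -rmorphN; apply: val1_serD; apply: val1_serM => //.
    - by rewrite -psmap_t -rmorphXn; apply: val1_ser_psmap.
    - exact: val1_ser_psmap.
    - exact: val1_serX.
  by rewrite mulNr mulrC subrr.
have C n : exists h', regular1 h' /\ (iota 'X - 1) * h' = D n.
  by have [h' ? ?] := val1_zero (VD n); exists h'.
have [g' HG'] := choice C; pose G' : R := g'.
have rG' n : regular1 (G' n) by have [] := HG' n.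
have ED : (psX - 1) * G' = D.
  apply: pserP => n; have [_ <-] := HG' n.
  by rewrite /psX -(rmorph1 (@psc Kx)) -rmorphB psc_mulE.
have [U1' E1'] := ev_ser_exists evaluable1 rG'; have [U2' E2'] := ev_ser_exists evaluable2 rG'.
have D1 : (Y1 - 1) * U1' = pst Kx ^+ d.+1 * U1 - psmap a * J1 ^+ d.+1.
  apply: (@ev_ser_uniq Y1 D); first by rewrite -ED; apply: ev_serM => //; apply: ev_ser_X1.
  apply: ev_serD; first by apply: ev_serM => //; apply/ev_serX/ev_ser_t.
  by apply/ev_serN/ev_serM; [apply: ev_ser_psmap|apply: ev_serX].
have D2 : (Y2 - 1) * U2' = pst Kx ^+ d.+1 * U2 - psmap a * J2 ^+ d.+1.
  apply: (@ev_ser_uniq Y2 D); first by rewrite -ED; apply: ev_serM => //; apply: ev_ser_X1.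
  apply: ev_serD; first by apply: ev_serM => //; apply/ev_serX/ev_ser_t.
  by apply/ev_serN/ev_serM; [apply: ev_ser_psmap|apply: ev_serX].
(* The hypothesis on [U1] and [U2] matches the terms from [G], and the power [d.+1] of [inv] those
   from [J]. *)
have E' : U1' * (Y2 - 1) ^+ d = U2' * (Y1 - 1) ^+ d.
  apply: (mulfI Y1n); apply: (mulfI Y2n).
  transitivity (((Y1 - 1) * U1') * (Y2 - 1) ^+ d.+1); first by rewrite exprS; ring.
  transitivity (((Y2 - 1) * U2') * (Y1 - 1) ^+ d.+1); last by rewrite exprS; ring.
  rewrite D1 D2 !mulrBl -mulrA E -!mulrA -!exprMn inv; ring.
have [e [b Hb]] := IH G' U1' U2' rG' E1' E2' E'.
(* From t^(d+1) G = (X - 1) G' + a J^(d+1): multiplication by t^e makes t^e a the new top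
   coefficient, and the factor X - 1 raises the exponents [d - i] by one. *)
exists (e + d.+1)%N, (fun i => if i == d.+1 then pst K ^+ e * a else b i).
rewrite big_ord_recr /= eqxx subnn expr0 mulr1.
rewrite (eq_bigr (fun i : 'I_d.+1 => (psX - 1) * (psmap (b i) * J ^+ i * (psX - 1) ^+ (d - i)))).
  rewrite -mulr_sumr -Hb exprD -mulrA.
  have -> : pst Kx ^+ d.+1 * G = (psX - 1) * G' + psmap a * J ^+ d.+1 by rewrite ED /D subrK.
  by rewrite rmorphM rmorphXn /= psmap_t; ring.
move=> i _; rewrite ltn_eqF // subSn; last by rewrite -ltnS.
by rewrite exprS; ring.
Qed.

End Invariants.
End Evaluation.

(** * The invariant *)

(* The existential keeps the unifier away from the construction of [{fraction _}]. *)
Lemma fraction_field_embedding (R : idomainType) :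
  exists (F : fieldType) (j : {rmorphism R -> F}), injective j.
Proof.
by exists {fraction R}, (@tofrac R) => a b /eqP; rewrite tofrac_eq => /eqP.
Qed.

Section TutteSeries.
Variables (L : fieldType) (f : {rmorphism KK -> pser L}).
Notation R := (pser L).
Notation nu := (f nuK).
Notation q := (f qK).
Notation w := (f wK).
Notation t := (pst L).

Notation mser := (mcoef f).

(** Tutte's equation is available at elements of a field; the series ring inherits it through its
    fraction field. *)
Lemma tutte_pser (x y : R) n :
  (x - 1) * (y - 1) * mser x y n.+1 =
  (x - 1) * (y - 1) *
    (x * y * w * (q * y + (nu - 1) * (y - 1)) * \sum_(i < n.+1) mser x y i * mser 1 y (n - i)%N +
     x * y * (x * nu - 1) * \sum_(i < n.+1) mser x y i * mser x 1 (n - i)%N) +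
  (x - 1) * x * y * (y * mser x y n - mser x 1 n) +
  (nu - 1) * (y - 1) * x * y * w * (x * mser x y n - mser 1 y n).
Proof.
have [F [j j_inj]] := fraction_field_embedding (pser L).
pose jf : {rmorphism KK -> F} := [the {rmorphism KK -> F} of (j \o f)].
have E x' y' k : mcoef jf (j x') (j y') k = j (mser x' y' k).
  case: k => [|k]; first by rewrite /= rmorph1.
  rewrite /= rmorph_sum; apply: eq_bigr => p _.
  by rewrite 2!(rmorphM j) 2!(rmorphXn j).
have j1 : j 1 = 1 by apply: rmorph1.
have Ex x' k : mcoef jf (j x') 1 k = j (mser x' 1 k) by rewrite -E j1.
have Ey y' k : mcoef jf 1 (j y') k = j (mser 1 y' k) by rewrite -E j1.
have S1 : \sum_(i < n.+1) mcoef jf (j x) (j y) i * mcoef jf 1 (j y) (n - i)%N =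
    j (\sum_(i < n.+1) mser x y i * mser 1 y (n - i)%N).
  by rewrite rmorph_sum; apply: eq_bigr => i _; rewrite rmorphM E Ey.
have S2 : \sum_(i < n.+1) mcoef jf (j x) (j y) i * mcoef jf (j x) 1 (n - i)%N =
    j (\sum_(i < n.+1) mser x y i * mser x 1 (n - i)%N).
  by rewrite rmorph_sum; apply: eq_bigr => i _; rewrite rmorphM E Ex.
have := tutte jf (j x) (j y) n; rewrite S1 S2 !E Ex Ey -[jf nuK]/(j nu) -[jf qK]/(j q) -[jf wK]/(j w).
move: (mser x y n.+1) (mser x y n) (mser x 1 n) (mser 1 y n) nu q w => M3 M0 M1 M2 nu' q' w'.
move: (\sum_(i < n.+1) _) (\sum_(i < n.+1) _) => T1 T2 H.
apply: j_inj; rewrite !(rmorphB, rmorphM, rmorphD, rmorph1).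
exact: H.
Qed.

Lemma tutte_tsum (x y : R) (M := tsum (mser x y)) (A := tsum (mser x 1)) (B := tsum (mser 1 y)) :
  (x - 1) * (y - 1) * (M - 1) =
  t * ((x - 1) * (y - 1) *
    (x * y * w * (q * y + (nu - 1) * (y - 1)) * (M * B) + x * y * (x * nu - 1) * (M * A)) +
  (x - 1) * x * y * (y * M - A) +
  (nu - 1) * (y - 1) * x * y * w * (x * M - B)).
Proof.
have EM : M - 1 = t * tsum (fun n => mser x y n.+1).
  by rewrite {1}/M tsum_shift addrAC subrr add0r.
rewrite EM mulrCA -tsumZ; congr (_ * _).
rewrite /M /A /B !tsumM -!tsumZ -[- tsum _]mulN1r -[- tsum (mser 1 y)]mulN1r -!tsumZ -!tsumD -!tsumZ -!tsumD.
congr tsum; apply: funext => n; rewrite tutte_pser.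
by rewrite !mulN1r.
Qed.

Section Kernel.
Variables (s : R) (c1 : R).
Hypothesis c1E : s * c1 = w * (nu - 1).
Let x := 1 + s * t.
Let A := tsum (mser x 1).

(** The value of x I(y) on the kernel curve, a series in which [y] does not occur. *)
Definition invariant_rhs : R :=
  x - (x * x * c1 + t * x * (x * nu - 1) * A + t * s - t * t * s * x * A).

Lemma kernel_invariant (y : R) (B := tsum (mser 1 y)) :
  (y - 1) * (1 - (x * x * y * c1 + (t * x * y * ((x * nu - 1) * A) +
     t * x * y * w * (((nu - 1) * (y - 1) + q * y) * B)))) = t * x * (y * y) ->
  x * (w * q * (y * y * (y - 1)) * (t * B) + (y - 1) ^+ 2 + t * y ^+ 2) =
  y * (y - 1) * invariant_rhs.
Proof.
move=> KE; have TU := tutte_tsum x y; cbv zeta in TU; rewrite -/A -/B in TU.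
set M := tsum (mser x y) in TU.
(* With x - 1 = ts the kernel is, up to simple factors, the coefficient of [M] in Tutte's equation.
   On the curve [M] drops out, and a factor t can be cancelled. *)
have R0 : s * (y - 1) - t * s * x * y * A - (nu - 1) * (y - 1) * x * y * w * B = 0.
  apply: (mulfI (pst_neq0 L)); rewrite mulr0.
  transitivity (((x - 1) * (y - 1) * (M - 1) - t * ((x - 1) * (y - 1) *
    (x * y * w * (q * y + (nu - 1) * (y - 1)) * (M * B) + x * y * (x * nu - 1) * (M * A)) +
    (x - 1) * x * y * (y * M - A) + (nu - 1) * (y - 1) * x * y * w * (x * M - B))) * (-1)
   + M * t * s * ((y - 1) * (1 - (x * x * y * c1 + (t * x * y * ((x * nu - 1) * A) +
     t * x * y * w * (((nu - 1) * (y - 1) + q * y) * B)))) - t * x * (y * y))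
   + M * t * (y - 1) * x * x * y * (s * c1 - w * (nu - 1))); last first.
    by rewrite TU KE c1E !subrr !mulr0 mul0r !addr0.
  by move: (A) (B) (M) => A' B' M'; rewrite /x; ring.
(* Subtracting the kernel equation from [t * (y - 1)] times [R0] cancels the terms with
   [(nu - 1) * B]; the remaining term in [B] is the one that occurs in I. *)
transitivity (y * (y - 1) * invariant_rhs +
  t * (y - 1) * (s * (y - 1) - t * s * x * y * A - (nu - 1) * (y - 1) * x * y * w * B) -
  ((y - 1) * (1 - (x * x * y * c1 + (t * x * y * ((x * nu - 1) * A) +
     t * x * y * w * (((nu - 1) * (y - 1) + q * y) * B)))) - t * x * (y * y))); last first.
  by rewrite R0 KE subrr mulr0 subr0 addr0.
by rewrite /invariant_rhs -/A; move: (A) (B) => A' B'; rewrite /x; ring.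
Qed.
End Kernel.
End TutteSeries.

Section PsRing.
Variable L : fieldType.
Implicit Types (Y : pser L).

Lemma ps_exp_pser (Y : pser L) k : ps_exp Y k = Y ^+ k :> pser L.
Proof.
elim: k => [|k IH] //.
by rewrite exprS -IH.
Qed.

Lemma ps_c0 : ps_c 0 = 0 :> pser L.
Proof. by apply: pserP => -[|n]. Qed.

(* [kernel_root], with the constants and the two map series as parameters. *)
Definition root_equation (v c nu n1 q w : L) (Y A B : ps L) : Prop :=
   let pa := @ps_add L in let pm := @ps_mul L in let t := ps_t L in
   let x := pa (ps_c 1) (pm (ps_c v) t) in
   let Ym1 := pa Y (ps_c (-1)) in
   let inner :=
     pa (ps_c 1) (ps_opp (pa (pm (pm (pm x x) Y) (ps_c c))
       (pa (pm (pm (pm t x) Y) (pm (pa (pm x (ps_c nu)) (ps_c (-1))) A))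
           (pm (pm (pm (pm t x) Y) (ps_c w))
               (pm (pa (pm (ps_c n1) Ym1) (pm (ps_c q) Y)) B))))) in
   forall n, pa (pm Ym1 inner) (ps_opp (pm (pm t x) (pm Y Y))) n = 0.

Lemma kernel_ring (v c nu n1 q w : L) (Y A B : ps L) :
  n1 = nu - 1 -> root_equation v c nu n1 q w Y A B ->
  let t := pst L in let x := 1 + psc v * t in let y : pser L := Y in
  let A' : pser L := A in let B' : pser L := B in
  (y - 1) * (1 - (x * x * y * psc c + (t * x * y * ((x * psc nu - 1) * A') +
     t * x * y * psc w * (((psc nu - 1) * (y - 1) + psc q * y) * B')))) = t * x * (y * y).
Proof.
move=> n1E H t x y A' B'.
have : (y + psc (-1)) * (psc 1 - ((psc 1 + psc v * t) * (psc 1 + psc v * t) * y * psc c +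
   (t * (psc 1 + psc v * t) * y * (((psc 1 + psc v * t) * psc nu + psc (-1)) * A') +
    t * (psc 1 + psc v * t) * y * psc w * ((psc n1 * (y + psc (-1)) + psc q * y) * B')))) -
   t * (psc 1 + psc v * t) * (y * y) = 0.
  by apply: pserP => n; exact: H n.
by rewrite n1E rmorphB rmorphN1 rmorph1 => /eqP; rewrite subr_eq0 => /eqP.
Qed.

End PsRing.

Section PsEval.
Variables (K Kx : fieldType) (iota : {rmorphism {poly K} -> Kx}).

Lemma ps_peval_ev p (Y : pser Kx) : ps_peval (KtoX iota) p Y = ev iota Y p.
Proof.
rewrite /ev (horner_coef_wide Y (size_poly _ _)).
apply: (big_ind2 (fun (a : ps Kx) (b : pser Kx) => a = b)) => [|a a' b b' -> ->|i _] //.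
  exact: ps_c0.
by rewrite ps_exp_pser coef_map.
Qed.

Lemma ps_compseq_tsum (P : nat -> {poly K}) (X : pser Kx) :
  ps_compseq P (KtoX iota) X = tsum (fun n => ev iota X (P n)).
Proof.
by apply: pserP => N; apply: eq_bigr => n _; rewrite ps_peval_ev.
Qed.

Lemma ev_monomials (I : Type) (r : seq I) (Q : pred I) (c : I -> K) (d : I -> nat) (Y : pser Kx) :
  ev iota Y (\sum_(i <- r | Q i) (c i)%:P * 'X^(d i)) =
  \sum_(i <- r | Q i) KtoPs iota (c i) * Y ^+ d i.
Proof.
rewrite (big_morph (ev iota Y) (evD iota Y) (ev0 iota Y)); apply: eq_bigr => i _.
by rewrite evM evC /ev map_polyXn hornerXn.
Qed.

End PsEval.

Section Invariance.
Variables (L : fieldType) (iota : {rmorphism {poly KK} -> L}).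
Hypothesis iota_inj : injective iota.
Notation R := (pser L).
Notation f := (KtoPs iota : {rmorphism KK -> R}).

Lemma mcoef_x1 (x : R) n : mcoef (@KtoPs KK L iota) x 1 n = ev iota x (M_x1 n).
Proof.
case: n => [|n] /=; first by rewrite ev_one.
rewrite ev_monomials; apply: eq_bigr => p _.
by rewrite expr1n mulr1.
Qed.

Lemma mcoef_1y (y : R) n : mcoef (@KtoPs KK L iota) 1 y n = ev iota y (M_1y n).
Proof.
case: n => [|n] /=; first by rewrite ev_one.
rewrite ev_monomials; apply: eq_bigr => p _.
by rewrite expr1n mulr1.
Qed.

Notation KX := (@KtoX KK L iota).
Let v : L := iota 'X.
Notation X := (@psX KK L iota).
Notation t := (pst L).
Notation evv := (@ev KK L iota).

Lemma v_neq0 : v != 0.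
Proof. by rewrite (iota_eq0 iota_inj) polyX_eq0. Qed.

Lemma v1_neq0 : v - 1 != 0.
Proof. by rewrite -(rmorph1 iota) -rmorphB (iota_eq0 iota_inj) -polyC1 polyXsubC_eq0. Qed.

Definition Mser : R := fun n => iota (M_1y n).
Definition Iser : R :=
  psc (KX (wK * qK) * v) * (t * Mser) + (psc ((v - 1) / v) + psc (v / (v - 1)) * t).
Definition Jser : R := (X - 1) * Iser.

Lemma X1E : X - 1 = psc (v - 1).
Proof. by rewrite rmorphB rmorph1. Qed.

Lemma XJ : X * Jser = psmap iota (psc (wK * qK)) * (X * X * (X - 1)) * (t * Mser)
   + (X - 1) ^+ 2 + t * X ^+ 2.
Proof.
have -> : psmap iota (psc (wK * qK)) = psc (KX (wK * qK)).
  by apply: pserP => -[|n] //; rewrite /psmap /psc /= rmorph0.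
have h1 : X * (X - 1) * psc ((v - 1) / v) = (X - 1) ^+ 2.
  by rewrite X1E -!rmorphM -rmorphXn; congr psc; field; exact: v_neq0.
have h2 : X * (X - 1) * psc (v / (v - 1)) = X ^+ 2.
  by rewrite X1E -!rmorphM -rmorphXn; congr psc; field; exact: v1_neq0.
have key (a b c y u m : R) : y * ((y - 1) * (c * y * (u * m) + (a + b * u))) =
    c * (y * y * (y - 1)) * (u * m) + y * (y - 1) * a + u * (y * (y - 1) * b) by ring.
by rewrite -h1 -h2 -key /Jser /Iser rmorphM.
Qed.

Lemma psc_Xinv : psc v^-1 * X = 1.
Proof. by rewrite -rmorphM mulVf ?v_neq0 // rmorph1. Qed.

Lemma Jser_div : Jser = psc v^-1 * (X * Jser).
Proof. by rewrite mulrA psc_Xinv mul1r. Qed.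

Lemma val1_Jser : val1_ser iota Jser (pst KK).
Proof.
have VX : val1_ser iota X 1.
  move=> [|n]; rewrite pser1 /=; last by rewrite -(rmorph0 KX); apply: val1_const.
  by have := val1_poly iota 'X; rewrite hornerX.
have VXi : val1_ser iota (psc v^-1) 1.
  move=> [|n]; rewrite pser1 /=; last by rewrite -(rmorph0 KX); apply: val1_const.
  by exists 1, 'X; rewrite hornerX hornerC mulr1 oner_neq0 rmorph1 mulVf ?v_neq0.
have V1m : val1_ser iota (-1) (-1).
  by rewrite -(rmorph1 (psmap iota)) -rmorphN; apply: val1_ser_psmap.
have VX1 : val1_ser iota (X - 1) 0 by rewrite -(subrr 1); apply: val1_serD.
have VM : val1_ser iota Mser (fun n => (M_1y n).[1]) by move=> n; apply: val1_poly.
have Vt : val1_ser iota t (pst KK) by rewrite -(psmap_t iota); apply: val1_ser_psmap.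
have := val1_serM VXi (val1_serD (val1_serD
  (val1_serM (val1_serM (val1_ser_psmap iota (psc (wK * qK))) (val1_serM (val1_serM VX VX) VX1)) (val1_serM Vt VM))
  (val1_serX 2 VX1)) (val1_serM Vt (val1_serX 2 VX))).
by rewrite -XJ -Jser_div !mulr0 !mul0r expr0n expr1n !add0r mul1r mulr1.
Qed.

Section Roots.
Variable s : R.
Hypothesis sE : s = psc v.
Let c1 : R := psc (KX (wK * (nuK - 1)) / v).
Let x : R := 1 + s * t.
Notation nu := (KtoPs iota nuK).
Notation q := (KtoPs iota qK).
Notation w := (KtoPs iota wK).
Let A : R := tsum (fun n => evv x (M_x1 n)).

Definition kernel_eq (y : R) := (y - 1) * (1 - (x * x * y * c1 + (t * x * y * ((x * nu - 1) * A) +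
     t * x * y * w * (((nu - 1) * (y - 1) + q * y) * tsum (fun n => evv y (M_1y n)))))) = t * x * (y * y).

Lemma c1E : s * c1 = w * (nu - 1).
Proof.
rewrite sE -rmorphM mulrC divfK ?v_neq0 // /KtoPs !rmorphM !rmorphB !rmorph1 //.
Qed.

Lemma x_neq0 : x != 0.
Proof.
apply/eqP => /(congr1 (fun a : R => a 0%N)); rewrite /x pserD pser0 mulrC pstM addr0.
by apply/eqP/oner_neq0.
Qed.

(** The value of [Jser] read off from [XJ]: once multiplied by the variable, its coefficients are
    polynomials. *)
Definition Jval (y : R) : R := y^-1 *
  (w * q * (y * y * (y - 1)) * (t * tsum (fun n => evv y (M_1y n))) + (y - 1) ^+ 2 + t * y ^+ 2).

Lemma ev_ser_Jser (y : R) : y 0%N != 0 -> ev_ser iota y Jser (Jval y).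
Proof.
move=> y0.
have EXi : ev_ser iota y (psc v^-1) y^-1.
  exists (fun n => if n is 0%N then y^-1 else 0).
    move=> [|n]; rewrite /psc /=; last by rewrite -(rmorph0 iota) -(ev0 iota y); apply: ev_rat_poly.
    exists 1, 'X; rewrite evX ev_one rmorph1; split=> //; first by rewrite mulVf ?v_neq0.
    by rewrite mulVr.
  by apply: pserP => n; rewrite /tsum big_ord_recl /= subn0 big1 ?addr0.
rewrite Jser_div XJ /Jval.
have -> : w * q = psmap iota (psc (wK * qK)).
  rewrite -rmorphM; apply: pserP => -[|n] //; by rewrite /psmap /KtoPs /psc /= rmorph0.
have EX := ev_ser_X iota y; have EX1 := ev_ser_X1 iota y; have Et := ev_ser_t iota y.
apply: ev_serM => //; apply: ev_serD; last by apply: ev_serM => //; apply: ev_serX.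
apply: ev_serD; last exact: ev_serX.
apply: ev_serM; first by apply: ev_serM; [exact: ev_ser_psmap|apply: ev_serM => //; exact: ev_serM].
by apply: ev_serM => //; apply: ev_ser_polys.
Qed.

(** The root enters the right-hand side only through [y - 1]. So J(Y1) (Y2 - 1) = J(Y2) (Y1 - 1),
    which is I(Y1) = I(Y2) without denominators. *)
Lemma Jval_invariant (y : R) : y 0%N != 0 -> kernel_eq y ->
  x * Jval y = (y - 1) * invariant_rhs (@KtoPs KK L iota) s c1.
Proof.
move=> y0 KE.
have yn : y != 0 by apply: contraNneq y0 => ->.
have EA : A = tsum (mcoef (@KtoPs KK L iota) x 1).
  by congr tsum; apply: funext => n; rewrite mcoef_x1.
have EB : tsum (fun n => evv y (M_1y n)) = tsum (mcoef (@KtoPs KK L iota) 1 y).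
  by congr tsum; apply: funext => n; rewrite mcoef_1y.
have := @kernel_invariant L (@KtoPs KK L iota) s c1 c1E y.
move: KE; rewrite /kernel_eq EA EB => KE /(_ KE) H.
apply: (mulfI yn); rewrite [RHS]mulrA -H /Jval EB mulrCA; congr (_ * _).
by rewrite mulVKr ?pser_unitE.
Qed.

Variables Y1 Y2 : R.
Hypotheses (Y10 : Y1 0%N = 1) (Y20 : Y2 0%N = v / KX (wK * (nuK - 1))).
Hypotheses (K1 : kernel_eq Y1) (K2 : kernel_eq Y2).

Lemma kw_neq0 : wK * (nuK - 1) != 0.
Proof.
rewrite mulf_neq0 //; first by rewrite tofrac_eq0 polyX_eq0.
rewrite -tofrac1 -tofracB tofrac_eq0 -polyC1 -polyCB polyC_eq0.
by rewrite -polyC1 polyXsubC_eq0.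
Qed.

(** The constant term of [Y2] is a nonzero constant multiple of the indeterminate, and scaling the
    variable is an invertible substitution. *)
Lemma Y2_transcendental p : evv Y2 p 0%N = 0 -> p = 0.
Proof.
rewrite ev_coef0 Y20; set k := wK * (nuK - 1).
have k0 : k != 0 := kw_neq0.
have -> : v / KX k = iota (k^-1 *: 'X).
  have <- : KX k^-1 = (KX k)^-1 by apply: fmorphV.
  by rewrite -mul_polyC (rmorphM iota) mulrC.
have -> : (map_poly KX p).[iota (k^-1 *: 'X)] = iota (p \Po (k^-1 *: 'X)).
  rewrite /comp_poly -horner_map -map_poly_comp.
  by congr (_.[_]); apply: eq_map_poly => c.
move/eqP; rewrite (iota_eq0 iota_inj) => /eqP p0.
have : (p \Po (k^-1 *: 'X)) \Po (k *: 'X) = p.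
  by rewrite -comp_polyA comp_polyZ comp_polyX scalerA mulVf // scale1r comp_polyXr.
by rewrite p0 comp_poly0.
Qed.

(** In the kernel equation Y1 - 1 times a power series equals t x Y1^2, of valuation 1 in t; so Y1 -
    1, divisible by t, has valuation exactly 1. *)
Lemma Y1_shift : exists2 y : R, Y1 - 1 = t * y & y 0%N != 0.
Proof.
pose y : R := fun n => (Y1 - 1) n.+1.
have E : Y1 - 1 = t * y.
  by apply: pserP => n; rewrite pstM; case: n => [|n] //; rewrite pserD pserN Y10 pser1 subrr.
exists y => //; move: K1; rewrite /kernel_eq E -!mulrA => /(mulfI (pst_neq0 L)).
move/(congr1 (fun a : R => a 0%N)); rewrite !pscoef0M Y10 !mulr1 => H.
apply: contra_eq_neq H => ->; rewrite mul0r eq_sym.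
by rewrite /x pserD pser1 mulrC pstM addr0 oner_neq0.
Qed.

Lemma Y1_neq1 : Y1 - 1 != 0.
Proof.
have [y -> y0] := Y1_shift; rewrite mulf_neq0 ?pst_neq0 //.
by apply: contraNneq y0 => ->.
Qed.

Lemma Y2_unit : Y2 0%N != 0.
Proof.
by rewrite Y20 mulf_neq0 ?v_neq0 // invr_eq0 fmorph_eq0 kw_neq0.
Qed.

Lemma Y2_coef0_neq1 : (Y2 - 1) 0%N != 0.
Proof.
apply/eqP=> H; have := @Y2_transcendental ('X - 1).
rewrite evB evX ev_one => /(_ H) /eqP; by rewrite -polyC1 polyXsubC_eq0.
Qed.

Lemma Y2_neq1 : Y2 - 1 != 0.
Proof. by apply: contraNneq Y2_coef0_neq1 => ->. Qed.

Lemma invariant_in_I d (Hs G U1 U2 : R) : G = (X - 1) ^+ d * Hs -> (forall n, regular1 iota (G n)) ->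
  ev_ser iota Y1 G U1 -> ev_ser iota Y2 G U2 -> U1 * (Y2 - 1) ^+ d = U2 * (Y1 - 1) ^+ d ->
  exists e (a : nat -> pser KK), t ^+ e * Hs = \sum_(i < d.+1) psmap iota (a i) * Iser ^+ i.
Proof.
move=> EG rG E1 E2 EU.
have Y1u : Y1 0%N != 0 by rewrite Y10 oner_neq0.
have J1 := Jval_invariant Y1u K1; have J2 := Jval_invariant Y2_unit K2.
have inv : Jval Y1 * (Y2 - 1) = Jval Y2 * (Y1 - 1).
  by apply: (mulfI x_neq0); rewrite (mulrA x (Jval Y1)) (mulrA x (Jval Y2)) J1 J2; ring.
have [e [a Ha]] := invariant_decomposition iota_inj Y10 Y2_transcendental Y1_neq1 Y2_neq1
  (ev_ser_Jser Y1u) (ev_ser_Jser Y2_unit) val1_Jser inv rG E1 E2 EU.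
exists e, a.
have X1n : X - 1 != 0.
  apply/eqP=> /(congr1 (fun a : R => a 0%N)) => /eqP; rewrite X1E; exact/negP/v1_neq0.
apply: (mulfI (expf_neq0 d X1n)); rewrite mulrCA -EG Ha mulr_sumr; apply: eq_bigr => -[i /= li] _.
rewrite /Jser exprMn -{2}(subnK (_ : i <= d)%N) // exprD; ring.
Qed.

End Roots.
End Invariance.

(** * Laurent series *)

Import Order.TTheory Num.Theory.

(** The cutoff in [subst_rel] is existential; two admissible cutoffs give the same sum. *)
Lemma sum_tail (V : zmodType) (g : nat -> V) a b :
  (forall m, (a <= m)%N -> g m = 0) -> (forall m, (b <= m)%N -> g m = 0) ->
  \sum_(m < a) g m = \sum_(m < b) g m.
Proof.
wlog le : a b / (a <= b)%N.
  by move=> H ga gb; case/orP: (leq_total a b) => le; [|symmetry]; apply: H.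
move=> ga _; rewrite -(subnKC le) big_split_ord /= [X in _ = _ + X]big1 ?addr0 // => i _.
by rewrite ga // leq_addr.
Qed.

Section LaurentField.
Variables (L F : fieldType) (j : {rmorphism pser L -> F}).
Hypothesis j_inj : injective j.
Notation R := (pser L).
Notation t := (pst L).
Let tF : F := j t.

Lemma tF_neq0 : tF != 0.
Proof. by rewrite /tF -(rmorph0 j) (inj_eq j_inj) pst_neq0. Qed.

(** Laurent series as elements of a field that contains the power series; coefficientwise equality
    becomes equality in this field. *)
Definition ls_embed (Z : ls L) : F := tF ^ (lval Z) * j (lps Z : R).

Lemma lcoef_low (Z : ls L) n : n < lval Z -> lcoef Z n = 0.
Proof.
by rewrite /lcoef; case E : (n - lval Z) => [m|m] // lt; move: E lt; lia.
Qed.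

Lemma ls_embed_lcoef (Z : ls L) v0 : v0 <= lval Z ->
  ls_embed Z = tF ^ v0 * j ((fun n => lcoef Z (v0 + n%:Z)) : R).
Proof.
move=> le; have [k Ek] : exists k : nat, lval Z = v0 + k%:Z.
  by exists `|lval Z - v0|%N; rewrite gez0_abs ?subr_ge0 //; lia.
have -> : ((fun n => lcoef Z (v0 + n%:Z)) : R) = t ^+ k * (lps Z : R).
  apply: pserP => n; rewrite pstXM /lcoef Ek.
  have -> : v0 + n%:Z - (v0 + k%:Z) = n%:Z - k%:Z by lia.
  case: leqP => lk; first by rewrite subzn.
  by case E : (n%:Z - k%:Z) => [m|m] //; move: E; lia.
by rewrite rmorphM rmorphXn /ls_embed Ek expfzDr ?tF_neq0 // mulrA.
Qed.

Lemma ls_embed_eq (Z1 Z2 : ls L) : ls_eq Z1 Z2 <-> ls_embed Z1 = ls_embed Z2.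
Proof.
pose v0 := Num.min (lval Z1) (lval Z2).
have l1 : v0 <= lval Z1 by rewrite ge_min lexx.
have l2 : v0 <= lval Z2 by rewrite ge_min lexx orbT.
rewrite (ls_embed_lcoef l1) (ls_embed_lcoef l2); split=> [E|].
  by congr (_ * j _); apply: pserP => n; apply: E.
move/(mulfI (expfz_neq0 _ tF_neq0))/j_inj => E n.
have [lt|le] := ltP n v0.
  by rewrite !lcoef_low // (lt_le_trans lt).
have := congr1 (fun a : R => a `|n - v0|%N) E; rewrite /= gez0_abs ?subr_ge0 //.
by rewrite (_ : v0 + (n - v0) = n) //; lia.
Qed.

Lemma ls_embedD Z1 Z2 : ls_embed (ls_add Z1 Z2) = ls_embed Z1 + ls_embed Z2.
Proof.
have l1 : Num.min (lval Z1) (lval Z2) <= lval Z1 by rewrite ge_min lexx.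
have l2 : Num.min (lval Z1) (lval Z2) <= lval Z2 by rewrite ge_min lexx orbT.
by rewrite (ls_embed_lcoef l1) (ls_embed_lcoef l2) -mulrDr -rmorphD.
Qed.

Lemma ls_embed0 : ls_embed (ls0 L) = 0.
Proof. by rewrite /ls_embed /= mul1r -(rmorph0 j). Qed.

Lemma ls_embedM Z1 Z2 : ls_embed (ls_mul Z1 Z2) = ls_embed Z1 * ls_embed Z2.
Proof.
rewrite /ls_embed /= expfzDr ?tF_neq0 // -[j (ps_mul _ _)]/(j ((lps Z1 : R) * (lps Z2 : R))) rmorphM.
by rewrite mulrACA.
Qed.

Lemma ls_embed_of_ps (a : R) : ls_embed (ls_of_ps a) = j a.
Proof. by rewrite /ls_embed /= mul1r. Qed.

Lemma ls_embed1 : ls_embed (ls1 L) = 1.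
Proof. by rewrite /ls_embed /= mul1r -(rmorph1 j). Qed.

Lemma ls_embedX Z k : ls_embed (ls_exp Z k) = ls_embed Z ^+ k.
Proof.
elim: k => [|k IH]; first exact: ls_embed1.
by rewrite exprS -IH -ls_embedM.
Qed.

Lemma ls_embedZ c Z : ls_embed (ls_scale c Z) = j (psc c) * ls_embed Z.
Proof.
rewrite /ls_embed mulrCA -rmorphM; congr (_ * j _); apply: pserP => n.
by rewrite psc_mulE.
Qed.

Lemma ls_embed_sum n (G : 'I_n -> ls L) :
  ls_embed (\big[@ls_add L/ls0 L]_(i < n) G i) = \sum_(i < n) ls_embed (G i).
Proof. exact: (big_morph ls_embed ls_embedD ls_embed0). Qed.

Lemma lcoef_shift c (Z : ls L) k : lcoef (ls_shift c Z) k = lcoef Z (k - c).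
Proof. by rewrite /lcoef /= opprD addrA addrAC. Qed.

Section Subst.
Variables (K : fieldType) (iota : {rmorphism {poly K} -> L}).
Hypothesis iota_inj : injective iota.
Notation KX := (KtoX iota).

Lemma ls_embed_peval p (Y : R) : ls_embed (ls_peval KX p (ls_of_ps Y)) = j (ev iota Y p).
Proof.
rewrite ls_embed_sum /ev (horner_coef_wide Y (size_poly _ _)) rmorph_sum.
apply: eq_bigr => i _; rewrite ls_embedZ ls_embedX ls_embed_of_ps coef_map.
by rewrite rmorphM rmorphXn.
Qed.

(* [rat_eval_rel], [subst_rel] and [pole_at1_le] over an arbitrary embedding of the polynomials;
   they are convertible to the originals for [tofrac]. *)
Definition rat_eval_in (h : L) (Y Z : ls L) : Prop :=
  exists a b : {poly K}, [/\ b != 0, h = iota a / iota b,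
    ~ ls_eq (ls_peval KX b Y) (ls0 L) &
    ls_eq (ls_mul (ls_peval KX b Y) Z) (ls_peval KX a Y)].

Definition subst_in (H Y Z : ls L) : Prop :=
  exists Zs : nat -> ls L,
    let T m := ls_shift (lval H + m%:Z) (Zs m) in
    [/\ forall m, rat_eval_in (lps H m) Y (Zs m),
        forall N : int, exists m0, forall m, (m0 <= m)%N ->
           forall k : int, k < N -> lcoef (T m) k = 0 &
        forall k : int, exists m0,
           (forall m, (m0 <= m)%N -> lcoef (T m) k = 0) /\
           lcoef Z k = \sum_(m < m0) lcoef (T m) k].

Definition pole_in (d : nat) (h : L) : Prop :=
  exists p r : {poly K}, r.[1] != 0 /\ h = iota p / iota (('X - 1) ^+ d * r).

Lemma rat_eval_uniq h (Y : R) Z Z' :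
  rat_eval_in h (ls_of_ps Y) Z -> rat_eval_in h (ls_of_ps Y) Z' -> ls_eq Z Z'.
Proof.
move=> [a [b [b0 hb nb /ls_embed_eq E]]] [a' [b' [b0' hb' nb' /ls_embed_eq E']]].
apply/ls_embed_eq; move: E E'; rewrite !ls_embedM !ls_embed_peval => E E'.
have e0 : j (ev iota Y b) != 0.
  by apply/eqP=> e; apply: nb; apply/ls_embed_eq; rewrite ls_embed_peval ls_embed0.
have e0' : j (ev iota Y b') != 0.
  by apply/eqP=> e; apply: nb'; apply/ls_embed_eq; rewrite ls_embed_peval ls_embed0.
have ib : iota b != 0 by rewrite (iota_eq0 iota_inj).
have ib' : iota b' != 0 by rewrite (iota_eq0 iota_inj).
have ab : a * b' = a' * b.
  apply: iota_inj; rewrite !(rmorphM iota).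
  have -> : iota a = h * iota b by rewrite hb divfK.
  have -> : iota a' = h * iota b' by rewrite hb' divfK.
  by rewrite mulrAC.
have jab : j (ev iota Y a) * j (ev iota Y b') = j (ev iota Y a') * j (ev iota Y b).
  by rewrite -!(rmorphM j) -!evM ab.
apply: (mulfI e0); apply: (mulfI e0').
by rewrite E mulrC jab -E'; ring.
Qed.

(** * Substitution of one root into a Laurent series *)

Section OneRoot.
Variables (Y y : R) (kap d : nat) (H : ls L) (p r : nat -> {poly K}).
Hypotheses (Yy : Y - 1 = t ^+ kap * y) (y0 : y 0%N != 0) (gY : evaluable iota Y).
Hypotheses (r1 : forall m, (r m).[1] != 0)
  (Hm : forall m, lps H m = iota (p m) / iota (('X - 1) ^+ d * r m)).

Definition subst_coef m : R := ev iota Y (p m) / ev iota Y (r m).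
(** The pole at 1 is split off: (Y - 1)^(-d) = t^(-kap d) y^(-d), with [kap] equal to 1 at [Y1] and
    0 at [Y2]. The other denominators are units. *)
Definition subst_value : ls L := LS (lval H - (kap * d)%:Z) (y^-1 ^+ d * tsum subst_coef).
Let Zs m : ls L := LS (- (kap * d)%:Z) (y^-1 ^+ d * subst_coef m).

Let X1 : ('X - 1 : {poly K}) != 0.
Proof. by rewrite -polyC1 polyXsubC_eq0. Qed.

Let rm0 m : r m != 0.
Proof. by apply: contraNneq (r1 m) => ->; rewrite horner0. Qed.

Lemma jy_neq0 : j y != 0.
Proof. by rewrite -(rmorph0 j) (inj_eq j_inj); apply: contraNneq y0 => ->. Qed.

Lemma j_inv (a : R) : a 0%N != 0 -> j a^-1 = (j a)^-1.
Proof.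
move=> a0; have ja0 : j a != 0.
  by rewrite -(rmorph0 j) (inj_eq j_inj); apply: contraNneq a0 => ->.
by apply: (mulfI ja0); rewrite -rmorphM divrr ?pser_unitE // rmorph1 divff.
Qed.

Lemma ls_embed_subst_term m u : ls_embed (LS m (y^-1 ^+ d * u)) = tF ^ m * ((j y)^-1 ^+ d * j u).
Proof. by rewrite /ls_embed /= rmorphM rmorphXn j_inv. Qed.

Lemma rat_eval_term m : rat_eval_in (lps H m) (ls_of_ps Y) (Zs m).
Proof.
have ebE : j (ev iota Y (('X - 1) ^+ d * r m)) = (tF ^+ kap * j y) ^+ d * j (ev iota Y (r m)).
  rewrite evM rmorphM; congr (_ * _).
  have -> : ev iota Y (('X - 1) ^+ d) = (Y - 1) ^+ d.
    by rewrite (rmorphXn (ev iota Y)) /= evB evX ev_one.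
  by rewrite rmorphXn Yy rmorphM rmorphXn.
have er0 : j (ev iota Y (r m)) != 0.
  by rewrite -(rmorph0 j) (inj_eq j_inj); apply: contraNneq (gY (r1 m)) => ->.
have eb0 : j (ev iota Y (('X - 1) ^+ d * r m)) != 0.
  by rewrite ebE mulf_neq0 // expf_neq0 // mulf_neq0 ?jy_neq0 // expf_neq0 // tF_neq0.
exists (p m), (('X - 1) ^+ d * r m); split=> //.
- by rewrite mulf_neq0 // expf_neq0.
- by move/ls_embed_eq; rewrite ls_embed_peval ls_embed0 => /eqP; apply/negP.
apply/ls_embed_eq; rewrite ls_embedM !ls_embed_peval ebE ls_embed_subst_term.
have -> : j (subst_coef m) = j (ev iota Y (p m)) / j (ev iota Y (r m)).
  by rewrite /subst_coef rmorphM j_inv // gY.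
have jy0 := jy_neq0; have t0 := tF_neq0.
rewrite -exprnN exprVn exprMn -exprM.
have : tF ^+ (kap * d) != 0 by rewrite expf_neq0.
have : j y ^+ d != 0 by rewrite expf_neq0.
move: (tF ^+ (kap * d)) (j y ^+ d) => a b b0 a0; field.
by rewrite er0 b0 a0.
Qed.

Let wc m : R := y^-1 ^+ d * subst_coef m.

Lemma lcoef_term m k : lcoef (ls_shift (lval H + m%:Z) (Zs m)) k =
  match k - (lval H - (kap * d)%:Z) with
  | Posz n => if (m <= n)%N then wc m (n - m)%N else 0 | Negz _ => 0 end.
Proof.
rewrite /lcoef /=.
have -> : k - (- (kap * d)%:Z + (lval H + m%:Z)) = (k - (lval H - (kap * d)%:Z)) - m%:Z.
  by lia.
case: (k - (lval H - _)) => n.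
  case: leqP => lm; first by rewrite subzn.
  by case E : (n%:Z - m%:Z) => [i|i] //; move: E; lia.
by case E : (Negz n - m%:Z) => [i|i] //; move: E; lia.
Qed.

Lemma lcoef_value k : lcoef subst_value k =
  match k - (lval H - (kap * d)%:Z) with
  | Posz n => \sum_(m < n.+1) wc m (n - m)%N | Negz _ => 0 end.
Proof. by rewrite /lcoef /=; case: (k - _) => // n; rewrite -tsumZ. Qed.

Lemma lcoef_value_sum k m0 :
  (forall m, (m0 <= m)%N -> lcoef (ls_shift (lval H + m%:Z) (Zs m)) k = 0) ->
  lcoef subst_value k = \sum_(m < m0) lcoef (ls_shift (lval H + m%:Z) (Zs m)) k.
Proof.
move=> H0; rewrite lcoef_value.
case E : (k - (lval H - (kap * d)%:Z)) => [n|n]; last first.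
  by rewrite big1 // => m _; rewrite lcoef_term E.
rewrite -(@sum_tail _ (fun m => lcoef (ls_shift (lval H + m%:Z) (Zs m)) k) n.+1) //.
  by apply: eq_bigr => m _; rewrite lcoef_term E -ltnS ltn_ord.
by move=> m lm; rewrite lcoef_term E leqNgt lm.
Qed.

Lemma term_vanish k m : k - (lval H - (kap * d)%:Z) < m%:Z ->
  lcoef (ls_shift (lval H + m%:Z) (Zs m)) k = 0.
Proof.
rewrite lcoef_term; case: (k - _) => [n|n] // lt.
by rewrite leqNgt (_ : (n < m)%N).
Qed.

Lemma subst_value_rel : subst_in H (ls_of_ps Y) subst_value.
Proof.
exists Zs; split; first exact: rat_eval_term.
  move=> N; exists `|(N - (lval H - (kap * d)%:Z))%R|%N => m lm k lk.
  by apply: term_vanish; lia.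
move=> k; exists `|(k - (lval H - (kap * d)%:Z))%R|.+1%N.
have V m : (`|(k - (lval H - (kap * d)%:Z))%R|.+1 <= m)%N ->
    lcoef (ls_shift (lval H + m%:Z) (Zs m)) k = 0.
  by move=> lm; apply: term_vanish; lia.
by split=> //; apply: lcoef_value_sum.
Qed.

Lemma subst_value_uniq Z : subst_in H (ls_of_ps Y) Z -> ls_eq Z subst_value.
Proof.
move=> [Zs' [RE _ S]] k; have [m0 [V ->]] := S k.
have E m : lcoef (ls_shift (lval H + m%:Z) (Zs' m)) k =
    lcoef (ls_shift (lval H + m%:Z) (Zs m)) k.
  by rewrite !lcoef_shift; apply: (rat_eval_uniq (RE m) (rat_eval_term m)).
rewrite (@lcoef_value_sum k m0); first by apply: eq_bigr => m _; apply: E.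
by move=> m /V; rewrite E.
Qed.

End OneRoot.
End Subst.
End LaurentField.

(** * From power series back to Laurent series *)

Section Assembly.
Variables (L : fieldType) (iota : {rmorphism {poly KK} -> L}).
Hypothesis iota_inj : injective iota.
Notation R := (pser L).
Notation t := (pst L).
Notation KX := (@KtoX KK L iota).
Notation X := (@psX KK L iota).
Notation s := (psc (iota 'X) : R).

Lemma theorem_in d (H : ls L) (Y1 Y2 : R) :
  Y1 0%N = 1 -> kernel_eq iota s Y1 ->
  Y2 0%N = iota 'X / KX (wK * (nuK - 1)) -> kernel_eq iota s Y2 ->
  (forall m, pole_in iota d (lps H m)) ->
  [/\ (exists Z1, subst_in iota H (ls_of_ps Y1) Z1),
      (exists Z2, subst_in iota H (ls_of_ps Y2) Z2) &
      forall Z1 Z2, subst_in iota H (ls_of_ps Y1) Z1 -> subst_in iota H (ls_of_ps Y2) Z2 ->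
        ls_eq Z1 Z2 ->
        exists A : nat -> ls KK,
          ls_eq H (\big[@ls_add L/ls0 L]_(i < d.+1)
                     ls_mul (ls_map KX (A i)) (ls_exp (ls_of_ps (Iser iota)) i))].
Proof.
move=> Y10 K1 Y20 K2 HP.
have [F [j j_inj]] := fraction_field_embedding R.
have /choice[pr Hpr] : forall m, exists pr : {poly KK} * {poly KK},
    pr.2.[1] != 0 /\ lps H m = iota pr.1 / iota (('X - 1) ^+ d * pr.2).
  by move=> m; have [p [r ?]] := HP m; exists (p, r).
pose p m := (pr m).1; pose r m := (pr m).2.
have r1 m : (r m).[1] != 0 by have [] := Hpr m.
have Hm m : lps H m = iota (p m) / iota (('X - 1) ^+ d * r m) by have [] := Hpr m.
have [y1 Ey1 y10] := Y1_shift Y10 K1.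
have Ey1' : Y1 - 1 = t ^+ 1 * y1 by rewrite Ey1.
have Ey2 : Y2 - 1 = t ^+ 0 * (Y2 - 1) by rewrite mul1r.
have y20 := Y2_coef0_neq1 iota_inj Y20.
have g1 : evaluable iota Y1 := evaluable1 iota Y10.
have g2 : evaluable iota Y2 := evaluable2 (Y2_transcendental iota_inj Y20).
pose Zc1 := subst_value iota Y1 y1 1 d H p r.
pose Zc2 := subst_value iota Y2 (Y2 - 1) 0 d H p r.
split.
- by exists Zc1; apply: (subst_value_rel j_inj Ey1' y10 g1 r1 Hm).
- by exists Zc2; apply: (subst_value_rel j_inj Ey2 y20 g2 r1 Hm).
move=> Z1 Z2 S1 S2 EZ.
have U1 := subst_value_uniq j_inj iota_inj Ey1' y10 g1 r1 Hm S1.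
have U2 := subst_value_uniq j_inj iota_inj Ey2 y20 g2 r1 Hm S2.
have EZc : ls_eq Zc1 Zc2 by move=> k; rewrite -U1 -U2.
pose W1 : R := tsum (subst_coef iota Y1 p r).
pose W2 : R := tsum (subst_coef iota Y2 p r).
have t0 := tF_neq0 j_inj.
have jn0 (a : R) : a 0%N != 0 -> j a != 0.
  by move=> a0; rewrite -(rmorph0 j) (inj_eq j_inj); apply: contraNneq a0 => ->.
(* The equality of the two Laurent series, freed from the common power of t and from the
   denominators (Y1 - 1)^d and (Y2 - 1)^d. *)
have EV : W1 * (Y2 - 1) ^+ d = W2 * (Y1 - 1) ^+ d.
  apply: (j_inj); rewrite Ey1 !(rmorphM j) !(rmorphXn j) rmorphM.
  move/(ls_embed_eq j_inj): EZc; rewrite /Zc1 /Zc2 /subst_value.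
  rewrite (ls_embed_subst_term j_inj d y10) (ls_embed_subst_term j_inj d y20) -/W1 -/W2.
  rewrite mul1n mul0n subr0 expfzDr // -!mulrA => /(mulfI (expfz_neq0 _ t0)).
  rewrite -exprnN !exprVn exprMn.
  have := expf_neq0 d t0; have := expf_neq0 d (jn0 _ y10); have := expf_neq0 d (jn0 _ y20).
  move: (j t ^+ d) (j y1 ^+ d) (j (Y2 - 1) ^+ d) (j W1) (j W2) => a b c v1 v2 c0 b0 a0 E.
  have -> : v1 * c = (a * b * c) * (a^-1 * (b^-1 * v1)) by field; rewrite a0 b0.
  by rewrite E; field; exact: c0.
(* (y - 1)^d times the power series part of [H]; its coefficients have no pole at 1. *)
pose G : R := fun m => iota (p m) / iota (r m).
have ir m : iota (r m) != 0.
  by rewrite (iota_eq0 iota_inj); apply: contraNneq (r1 m) => ->; rewrite horner0.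
have iX : iota 'X - 1 != 0 := v1_neq0 iota_inj.
have EG : G = (X - 1) ^+ d * (lps H : R).
  apply: pserP => m; rewrite X1E -rmorphXn psc_mulE Hm rmorphM rmorphXn rmorphB rmorph1 /G.
  have := expf_neq0 d iX; have := ir m.
  move: (iota (p m)) (iota (r m)) ((iota 'X - 1) ^+ d) => a b c b0 c0.
  by field; rewrite b0 c0.
have rG n : regular1 iota (G n) by exists (p n), (r n); rewrite divfK.
have EvG (Y : R) : evaluable iota Y -> ev_ser iota Y G (tsum (subst_coef iota Y p r)).
  move=> gY; exists (subst_coef iota Y p r) => // m; exists (p m), (r m); split; first exact: gY.
    by rewrite divfK.
  by rewrite /subst_coef mulrVK // pser_unitE gY.
have [e [a Ha]] := invariant_in_I iota_inj erefl Y10 Y20 K1 K2 EG rG (EvG _ g1) (EvG _ g2) EV.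
(* [invariant_in_I] concerns t^e times the power series part of [H]; the valuation restores [lval H]
   and removes t^e. *)
exists (fun i => LS (lval H - e%:Z) (a i)).
apply/(ls_embed_eq j_inj); rewrite ls_embed_sum.
apply: (mulfI (expf_neq0 e t0)).
rewrite {1}/ls_embed mulrCA -rmorphXn -rmorphM Ha rmorph_sum mulr_sumr mulr_sumr.
apply: eq_bigr => i _; rewrite ls_embedM // ls_embedX // ls_embed_of_ps rmorphM (rmorphXn j i) (rmorphXn j e).
rewrite /ls_embed /= expfzDr // -exprnN.
have := expf_neq0 e t0.
move: (j t ^+ e) (_ ^ lval H) (j (Iser iota) ^+ i) => x1 x2 x3 x10.
rewrite -[j (psmap iota (a i))]/(j (fun m => KX (a i m))); move: (j _) => x4.
  by field.
exact: j_inj.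
Qed.

Lemma root_equation_kernel (Y : ps L) :
  root_equation (iota 'X) (KX (wK * (nuK - 1)) / iota 'X) (KX nuK) (KX (nuK - 1)) (KX qK) (KX wK) Y
    (ps_compseq M_x1 KX (ps_add (ps_c 1) (ps_mul (ps_c (iota 'X)) (ps_t L))))
    (ps_compseq M_1y KX Y) ->
  kernel_eq iota s Y.
Proof.
have E : KX (nuK - 1) = KX nuK - 1 by rewrite rmorphB rmorph1.
move=> H; have := kernel_ring E H; rewrite !ps_compseq_tsum.
exact.
Qed.

End Assembly.

Theorem theorem8p1 (d : nat) (H : ls KKx) (Y1 Y2 : ps KKx) :
  Y1 0%N = 1 -> kernel_root Y1 ->
  Y2 0%N = varX / KtoKx (wK * (nuK - 1)) -> kernel_root Y2 ->
  (forall m, pole_at1_le d (lps H m)) ->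
  [/\ (exists Z1, subst_rel H (ls_of_ps Y1) Z1),
      (exists Z2, subst_rel H (ls_of_ps Y2) Z2) &
      forall Z1 Z2, subst_rel H (ls_of_ps Y1) Z1 -> subst_rel H (ls_of_ps Y2) Z2 ->
        ls_eq Z1 Z2 ->
        exists A : nat -> ls KK,
          ls_eq H (\big[@ls_add KKx/ls0 KKx]_(i < d.+1)
                     ls_mul (ls_map KtoKx (A i)) (ls_exp I_ls i))].
Proof.
have tofrac_inj : injective (@tofrac {poly KK}) by move=> a b /eqP; rewrite tofrac_eq => /eqP.
(* For [tofrac], [kernel_root] is an instance of [root_equation] by conversion. *)
move=> Y10 /(@root_equation_kernel KKx (@tofrac {poly KK})) K1.
move=> Y20 /(@root_equation_kernel KKx (@tofrac {poly KK})) K2 HP.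
exact: (theorem_in tofrac_inj Y10 K1 Y20 K2 HP).
Qed.
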